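(* Let $n\ge1$ and $s\in\{1,\dots,1+n\}$. The reduced Wick star product is $$f\star_{\mathrm{red}}g=\sum_{r=0}^\infty\frac1{r!}\,\frac1{(1/\lambda)_{\downarrow,r}}\,\big\langle(D^{\mathrm{sym}}_{\mathrm{red}})^rf\otimes(D^{\mathrm{sym}}_{\mathrm{red}})^rg\,,\,H_{\mathrm{red}}^r\big\rangle$$ for all $f,g\in C^\infty(M_{\mathrm{red}})$, where $\frac{1}{(1/\lambda)_{\downarrow,r}}=\lambda^r\big/\prod_{k=0}^{r-1}(1-k\lambda)\in\mathbb C[[\lambda]]$. Moreover, if even $g\in\mathcal P(M_{\mathrm{red}})$, then the series in $r$ in the product $f\star_{\mathrm{red}}g$ has only finitely many non-zero terms.
   Context: Geometry. Let $\nu_k=+1$ for $0\le k\le s-1$, $\nu_k=-1$ for $s\le k\le n$; $J=\sum_{k=0}^n\nu_kz^k\bar z^k$ on $\mathbb C^{1+n}$; $Z=J^{-1}(\{1\})$; $\mathbb C^{1+n}_+=\{J>0\}$; $M_{\mathrm{red}}=Z/U(1)$, identified with the open complex submanifold $\{[\rho]:J(\rho)>0\}\subseteq\mathbb{CP}^n$; $\mathrm{Pr}:\mathbb C^{1+n}_+\to M_{\mathrm{red}}$, $\rho\mapsto[\rho/\sqrt{J(\rho)}]$ (holomorphic). Functions are complex-valued, tangent bundles complexified. $\mathcal P(M_{\mathrm{red}})$ consists of the functions $[\rho]\mapsto p(\rho)$ ($\rho\in Z$) with $p$ a $U(1)$-invariant polynomial in $z^k,\bar z^k$. For $h\in C^\infty(\mathbb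 C^{1+n}_+)^{U(1)}$ let $h_{\mathrm{red}}\in C^\infty(M_{\mathrm{red}})$, $h_{\mathrm{red}}([\rho])=h(\rho)$ for $\rho\in Z$ (extended to power series in $\lambda$); this map is surjective. Tensors. Symmetric covariant tensor fields have product $\alpha\vee\beta=\mathrm{Sym}(\alpha\otimes\beta)$ ($\mathrm{Sym}$ the averaging projection). $D^{\mathrm{sym}}$ on $\mathbb C^{1+n}$ is $D^{\mathrm{sym}}\omega=\sum_idx^i\vee\nabla_{\partial/\partial x^i}\omega$ with $\nabla$ the flat Euclidean derivative. $H=\sum_{k=0}^n\nu_k\frac\partial{\partial\bar z^k}\otimes\frac\partial{\partial z^k}$. If $H=\sum H^{ab}\partial_a\otimes\partial_b$, then $\langle\alpha\otimes\beta,H^r\rangle=\sum H^{a_1b_1}\cdots H^{a_rb_r}\alpha_{a_1\dots a_r}\beta_{b_1\dots b_r}$ for symmetric $r$-fold covariant tensors. Reduced objects. $H_{\mathrm{red}}|_{[\rho]}=(T_\rho\mathrm{Pr})^{\otimes2}(H|_\rho)$ for $\rho\in Z$. Let $X_{\mathrm i}=\sum_k(\mathrm iz^k\partial_{z^k}-\mathrm i\bar z^k\partial_{\bar z^k})$, $X_{1}=\sum_k(z^k\partial_{z^k}+\bar z^k\partial_{\bar z^k})$, $I$ the complex structure, and $\Xi_\rho=\{\alpha\in T_\rho\mathbb C^{1+n}_+:\alpha(J)=0=(I\alpha)(J)\}$. Then $T\mathbb C^{1+n}_+=\mathbb C X_1\oplus\mathbb CX_{\mathrm i}\oplus\Xi$;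 $\Theta_\Xi$ is the corresponding projection onto $\Xi$ and $\Theta_\Xi^*$ its dual on 1-forms. $D^{\mathrm{sym}}_{\mathrm{red}}$ is the map on symmetric covariant tensor fields on $M_{\mathrm{red}}$ determined by $\mathrm{Pr}^*(D^{\mathrm{sym}}_{\mathrm{red}}\omega)=(\Theta^*_\Xi)^{\otimes(k+1)}D^{\mathrm{sym}}\mathrm{Pr}^*(\omega)$ for $\omega$ of degree $k$. Reduced Wick star product. On $C^\infty(\mathbb C^{1+n}_+)[[\lambda]]$ let $f\star g=\sum_{r\ge0}\frac{\lambda^r}{r!}\langle(D^{\mathrm{sym}})^rf\otimes(D^{\mathrm{sym}})^rg,H^r\rangle$ (Wick star product). Put $\frac{\partial}{\partial J}=\frac1{2J}X_1$ on $\mathbb C^{1+n}_+$. There is a unique operator $T=\mathrm{id}+\sum_{k\ge1}\sum_{\ell=1}^{2k}\lambda^k(T_{k,\ell}\circ J)(\frac\partial{\partial J})^\ell$ with $T_{k,\ell}\in C^\infty(]0,\infty[)$ such that $T(Jf)-JT(f)=\lambda J\frac\partial{\partial J}T(f)$ for all $f\in C^\infty(\mathbb C^{1+n}_+)^{U(1)}$. Put $f\,\tilde\star\,g=T^{-1}(T(f)\star T(g))$. The reduced Wick star product $\star_{\mathrm{red}}$ is the unique (well-defined) $\mathbb C[[\lambda]]$-bilinear product on $C^\infty(M_{\mathrm{red}})[[\lambda]]$ with $f_{\mathrm{red}}\star_{\mathrm{red}}g_{\mathrm{red}}=(f\,\tilde\star\,g)_{\mathrm{red}}$ for all $f,g\in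 C^\infty(\mathbb C^{1+n}_+)^{U(1)}$. *)

(* Defs.v *)
From HB Require Import structures.
From mathcomp Require Import all_boot all_order all_algebra perm.
From mathcomp Require Import generic_quotient.
From mathcomp Require Import all_classical all_reals all_analysis.
From mathcomp Require Import complex ring.
Set Implicit Arguments.
Unset Strict Implicit.
Unset Printing Implicit Defensive.
Import Order.TTheory GRing.Theory Num.Theory.
Import numFieldNormedType.Exports.
Local Open Scope classical_set_scope.
Local Open Scope ring_scope.
Local Open Scope complex_scope.
Local Open Scope quotient_scope.

Section ComplexValuedCalculus.
Variables (R : realType) (V : normedModType R).

Definition reC (f : V -> R[i]) : V -> R := fun y => complex.Re (f y).
Definition imC (f : V -> R[i]) : V -> R := fun y => complex.Im (f y).

(* derivative of a complex-valued function in the real direction [v] *)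
Definition derivC (v : V) (f : V -> R[i]) : V -> R[i] :=
  fun x => ('D_v (reC f) x) +i* ('D_v (imC f) x).

(* [e] is meant to enumerate a basis of [V] and [U] to be open: all iterated
   partial derivatives exist and are continuous on [U] *)
Definition smooth_on (I : Type) (e : I -> V) (U : set V) (f : V -> R[i]) :=
  forall (s : seq I) (x : V), U x ->
  let g := foldr (fun i => derivC (e i)) f s in
  [/\ {for x, continuous (reC g)}, {for x, continuous (imC g)} &
      forall i, derivable (reC g) x (e i) /\ derivable (imC g) x (e i)].

Lemma derivC_lin (v : V) (a : R[i]) (f g : V -> R[i]) (x : V) :
  derivable (reC f) x v -> derivable (imC f) x v ->
  derivable (reC g) x v -> derivable (imC g) x v ->
  derivC v (fun y => a * f y + g y) x = a * derivC v f x + derivC v g x.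
Proof.
move=> f1 f2 g1 g2; rewrite /derivC; case: a => a b.
have -> : reC (fun y => (a +i* b) * f y + g y) =
  a *: reC f - b *: imC f + reC g.
  apply/funext => y; transitivity (a * complex.Re (f y) - b * complex.Im (f y) + complex.Re (g y)) => //.
  by rewrite /reC /imC; case: (f y) => ? ?; case: (g y).
have -> : imC (fun y => (a +i* b) * f y + g y) =
  a *: imC f + b *: reC f + imC g.
  apply/funext => y; transitivity (a * complex.Im (f y) + b * complex.Re (f y) + complex.Im (g y)) => //.
  by rewrite /reC /imC; case: (f y) => ? ?; case: (g y).
have Za (c : R) (h : V -> R) : derivable h x v -> derivable (c *: h) x v.
  exact: derivableZ.
rewrite (deriveD (derivableB (Za a _ f1) (Za b _ f2)) g1).
rewrite (deriveB (Za a _ f1) (Za b _ f2)).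
rewrite (deriveD (derivableD (Za a _ f2) (Za b _ f1)) g2).
rewrite (deriveD (Za a _ f2) (Za b _ f1)).
by rewrite (deriveZ a f1) (deriveZ b f2) (deriveZ a f2) (deriveZ b f1).
Qed.

Lemma derivC_mul (v : V) (f g : V -> R[i]) (x : V) :
  derivable (reC f) x v -> derivable (imC f) x v ->
  derivable (reC g) x v -> derivable (imC g) x v ->
  derivC v (fun y => f y * g y) x = f x * derivC v g x + derivC v f x * g x.
Proof.
move=> f1 f2 g1 g2; rewrite /derivC.
have -> : reC (fun y => f y * g y) = reC f * reC g - imC f * imC g.
  apply/funext => y; transitivity (complex.Re (f y) * complex.Re (g y) - complex.Im (f y) * complex.Im (g y)) => //.
  by rewrite /reC /imC; case: (f y) => ? ?; case: (g y).
have -> : imC (fun y => f y * g y) = reC f * imC g + imC f * reC g.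
  apply/funext => y; transitivity (complex.Re (f y) * complex.Im (g y) + complex.Im (f y) * complex.Re (g y)) => //.
  by rewrite /reC /imC; case: (f y) => ? ?; case: (g y).
rewrite (deriveB (derivableM f1 g1) (derivableM f2 g2)).
rewrite (deriveD (derivableM f1 g2) (derivableM f2 g1)).
rewrite (deriveM f1 g1) (deriveM f2 g2) (deriveM f1 g2) (deriveM f2 g1).
set a' := 'D_v (reC f) x; set b' := 'D_v (imC f) x.
set c' := 'D_v (reC g) x; set d' := 'D_v (imC g) x.
rewrite /reC /imC; case: (f x) => a b; case: (g x) => c d.
by apply/eqP; rewrite eq_complex /= /GRing.scale /=; apply/andP; split;
  apply/eqP; ring.
Qed.

Lemma smooth_on0 (I : Type) (e : I -> V) (U : set V) :
  smooth_on e U (fun=> 0).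
Proof.
have d0 : forall s : seq I, foldr (fun i => derivC (e i)) (fun=> 0) s = fun=> 0.
  elim=> // i s /= ->; apply/funext => x; rewrite /derivC.
  by rewrite (_ : reC _ = cst 0) // (_ : imC _ = cst 0) // !derive_cst.
move=> s x _ /=; rewrite d0; split; [exact: cst_continuous|exact: cst_continuous|].
by move=> i; split; exact: derivable_cst.
Qed.

End ComplexValuedCalculus.

Section Tensors.
Variables (R : realType) (T : Type).

(* covariant tensors are represented by functions of [k] vectors *)
Definition tensor_prod k l (a : ('I_k -> T) -> R[i]) (b : ('I_l -> T) -> R[i])
    (v : 'I_(k + l) -> T) : R[i] :=
  a (fun i => v (lshift l i)) * b (fun j => v (rshift k j)).

Definition Sym k (a : ('I_k -> T) -> R[i]) (v : 'I_k -> T) : R[i] :=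
  (k`!%:R)^-1 * \sum_(sigma : 'S_k) a (fun i => v (sigma i)).

Definition vee k l (a : ('I_k -> T) -> R[i]) (b : ('I_l -> T) -> R[i]) :
  ('I_(k + l) -> T) -> R[i] := Sym (tensor_prod a b).

Definition update k (v : 'I_k -> T) (i : 'I_k) (x : T) : 'I_k -> T :=
  fun j => if j == i then x else v j.

(* the 2-contravariant tensor \sum_i coef i * lft i (x) rgt i *)
Record tensor2 := Tensor2 {
  index2 : finType;
  coef2 : index2 -> R[i];
  lft2 : index2 -> T;
  rgt2 : index2 -> T }.

(* < a (x) b , h^r > *)
Definition pairing (h : tensor2) r (a b : ('I_r -> T) -> R[i]) : R[i] :=
  \sum_(kappa : {ffun 'I_r -> index2 h})
    (\prod_(i < r) coef2 (kappa i)) *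
    a (fun i => lft2 (kappa i)) * b (fun i => rgt2 (kappa i)).

End Tensors.

(* (L (x) L) h *)
Definition map_tensor2 (R : realType) (T T' : Type) (L : T -> T')
    (h : tensor2 R T) : tensor2 R T' :=
  Tensor2 (@coef2 R T h) (fun i => L (lft2 i)) (fun i => L (rgt2 i)).

Section Geometry.
Variables (R : realType) (n s : nat).

(* C^(1+n) in its real coordinates: z^k = rho 0 k + i * rho 1 k *)
Definition E := 'M[R]_(2, n.+1).

(* C^(1+n) with its complexified tangent space: the vector
   \sum_k v 0 k * d/dx^k + v 1 k * d/dy^k *)
Definition TE := 'M[R[i]]_(2, n.+1).

Definition zcoord (rho : E) (k : 'I_n.+1) : R[i] := rho 0 k +i* rho 1 k.

Definition of_zcoord (w : 'I_n.+1 -> R[i]) : E :=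
  \matrix_(j, k) if j == 0 then complex.Re (w k) else complex.Im (w k).

Definition cscale (u : R[i]) (rho : E) : E :=
  of_zcoord (fun k => u * zcoord rho k).

Definition nu (k : 'I_n.+1) : R := if (k < s)%N then 1 else - 1.

Definition J (rho : E) : R :=
  \sum_(k < n.+1) nu k * (rho 0 k ^+ 2 + rho 1 k ^+ 2).

Lemma J_zcoord rho :
  (J rho)%:C = \sum_(k < n.+1) (nu k)%:C * zcoord rho k * (zcoord rho k)^*.
Proof.
rewrite /J rmorph_sum /=; apply: eq_bigr => k _; rewrite /zcoord.
by apply/eqP; rewrite eq_complex /=; apply/andP; split; apply/eqP; ring.
Qed.

Lemma J_scale (a : R) rho : J (a *: rho) = a ^+ 2 * J rho.
Proof.
by rewrite /J mulr_sumr; apply: eq_bigr => k _; rewrite !mxE; ring.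
Qed.

Definition E_pos : set E := [set rho | 0 < J rho].

Definition Cplus := {rho : E | 0 < J rho}.

Definition Z := {rho : E | J rho == 1}.

Lemma zcoord_cscale u rho k : zcoord (cscale u rho) k = u * zcoord rho k.
Proof. by rewrite {1}/zcoord !mxE /=; case: (u * _). Qed.

Lemma zcoord_inj rho rho' : zcoord rho =1 zcoord rho' -> rho = rho'.
Proof.
move=> eqz; apply/matrixP => j k; have [eq0 eq1] := eqz k.
by case: j => [[|[|//]] jlt]; rewrite (_ : Ordinal jlt = inord (Ordinal jlt));
  [rewrite (_ : inord _ = 0) | | rewrite (_ : inord _ = 1) | ];
  rewrite // ; apply: val_inj; rewrite /= inordK.
Qed.

Definition U1_rel (x y : Z) : bool :=
  `[< exists2 u : R[i], `|u| = 1 & val y = cscale u (val x) >].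

Lemma U1_refl : reflexive U1_rel.
Proof.
move=> x; apply/asboolP; exists 1; first exact: normr1.
by apply: zcoord_inj => k; rewrite zcoord_cscale mul1r.
Qed.

Lemma U1_sym : symmetric U1_rel.
Proof.
suff H x y : U1_rel x y -> U1_rel y x by move=> x y; apply/idP/idP; exact: H.
move=> /asboolP[u u1 yE]; apply/asboolP; exists u^-1.
  by rewrite normfV u1 invr1.
apply: zcoord_inj => k; rewrite zcoord_cscale yE zcoord_cscale mulKf //.
by rewrite -normr_eq0 u1 oner_eq0.
Qed.

Lemma U1_trans : transitive U1_rel.
Proof.
move=> y x w /asboolP[u u1 yE] /asboolP[v v1 wE]; apply/asboolP.
exists (v * u); first by rewrite normrM u1 v1 mulr1.
by apply: zcoord_inj => k; rewrite wE yE !zcoord_cscale mulrA.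
Qed.

Canonical U1_equiv := EquivRel U1_rel U1_refl U1_sym U1_trans.

Definition Mred := {eq_quot U1_equiv}.

Lemma J_normalize (rho : Cplus) :
  J ((Num.sqrt (J (val rho)))^-1 *: val rho) == 1.
Proof.
by rewrite J_scale exprVn sqr_sqrtr ?ltW ?(valP rho) // mulVf // gt_eqF // (valP rho).
Qed.

Definition Pr (rho : Cplus) : Mred :=
  \pi_Mred (exist (fun x : E => J x == 1) _ (J_normalize rho) : Z).


(* Functions on C^(1+n)_+ are functions on [E] whose values outside [E_pos]
   are irrelevant. *)
Definition real_basis (i : 'I_2 * 'I_n.+1) : E := delta_mx i.1 i.2.

Definition smooth_pos (f : E -> R[i]) := smooth_on real_basis E_pos f.

Definition U1_invariant (f : E -> R[i]) :=
  forall (u : R[i]) (rho : E), `|u| = 1 -> E_pos rho ->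
    f (cscale u rho) = f rho.

(* directional derivative along a complexified tangent vector *)
Definition act (v : TE) (f : E -> R[i]) (rho : E) : R[i] :=
  \sum_(i : 'I_2 * 'I_n.+1) v i.1 i.2 * derivC (real_basis i) f rho.

Definition dz (k : 'I_n.+1) : TE := 2^-1 *: (delta_mx 0 k - 'i *: delta_mx 1 k).
Definition dzb (k : 'I_n.+1) : TE := 2^-1 *: (delta_mx 0 k + 'i *: delta_mx 1 k).

Definition Htensor : tensor2 R TE := Tensor2 (fun k => (nu k)%:C) dzb dz.

Definition X1_vf (rho : E) : TE :=
  \sum_(k < n.+1) (zcoord rho k *: dz k + (zcoord rho k)^* *: dzb k).

Definition Xi_vf (rho : E) : TE :=
  \sum_(k < n.+1) (('i * zcoord rho k) *: dz k - ('i * (zcoord rho k)^* ) *: dzb k).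

(* I d/dx^k = d/dy^k and I d/dy^k = - d/dx^k *)
Definition cplx_struct (v : TE) : TE :=
  \matrix_(j, k) if j == 0 then - v 1 k else v 0 k.

Definition JC (rho : E) : R[i] := (J rho)%:C.

Definition in_XiSpace (rho : E) (v : TE) :=
  act v JC rho = 0 /\ act (cplx_struct v) JC rho = 0.

(* projection onto the third summand of C X1_vf (+) C Xi_vf (+) XiSpace *)
Definition Theta (rho : E) (v : TE) : TE :=
  xget 0 [set w | in_XiSpace rho w /\
                  exists a b : R[i], v = a *: X1_vf rho + b *: Xi_vf rho + w].

Definition Theta_pullback k (omega : E -> ('I_k -> TE) -> R[i]) :
    E -> ('I_k -> TE) -> R[i] :=
  fun rho v => omega rho (fun i => Theta rho (v i)).

Definition dx (i : 'I_2 * 'I_n.+1) (v : 'I_1 -> TE) : R[i] := v 0 i.1 i.2.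

Definition nabla k (i : 'I_2 * 'I_n.+1) (omega : E -> ('I_k -> TE) -> R[i]) :
    E -> ('I_k -> TE) -> R[i] :=
  fun rho v => derivC (real_basis i) (fun rho' => omega rho' v) rho.

Definition Dsym k (omega : E -> ('I_k -> TE) -> R[i]) :
    E -> ('I_k.+1 -> TE) -> R[i] :=
  fun rho v => \sum_i vee (dx i) (nabla i omega rho) v.

Fixpoint Dsym_iter r (f : E -> R[i]) : E -> ('I_r -> TE) -> R[i] :=
  if r is r'.+1 then Dsym (@Dsym_iter r' f) else fun rho _ => f rho.

Arguments Dsym_iter : clear implicits.

(* M_red carries the quotient manifold structure: Pr is a surjective
   submersion, so that smoothness on M_red is smoothness after pullback. *)
Definition pullback (f : Mred -> R[i]) : E -> R[i] :=
  fun rho => if (insub rho : option Cplus) is Some r then f (Pr r) else 0.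

Record Cinf_red := CinfRed {
  Cinf_fun :> Mred -> R[i];
  Cinf_smooth : smooth_pos (pullback Cinf_fun) }.

Lemma smooth_red0 : smooth_pos (pullback (fun=> 0)).
Proof.
rewrite (_ : pullback _ = fun=> 0); first exact: smooth_on0.
by apply/funext => rho; rewrite /pullback; case: (insub rho).
Qed.

Definition Cinf_red0 : Cinf_red := CinfRed smooth_red0.

(* complexified tangent space of M_red at [p], as point derivations *)
Record tangent (p : Mred) := Tangent {
  tg_fun :> Cinf_red -> R[i];
  tg_linear : forall (a : R[i]) (f g h : Cinf_red),
    (forall q, h q = a * f q + g q) -> tg_fun h = a * tg_fun f + tg_fun g;
  tg_leibniz : forall f g h : Cinf_red,
    (forall q, h q = f q * g q) -> tg_fun h = f p * tg_fun g + tg_fun f * g p }.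

Lemma pullbackE (f : Mred -> R[i]) (rho : Cplus) :
  pullback f (val rho) = f (Pr rho).
Proof. by rewrite /pullback valK. Qed.

Lemma TPr_linear (rho : Cplus) (v : TE) (a : R[i]) (f g h : Cinf_red) :
  (forall q, h q = a * f q + g q) ->
  act v (pullback h) (val rho) =
    a * act v (pullback f) (val rho) + act v (pullback g) (val rho).
Proof.
move=> hE; rewrite /act mulr_sumr -big_split /=; apply: eq_bigr => i _.
have -> : pullback h = fun y => a * pullback f y + pullback g y.
  apply/funext => y; rewrite /pullback; case: (insub y) => [r|]; first exact: hE.
  by rewrite mulr0 addr0.
have [_ _ /(_ i)[f1 f2]] := @Cinf_smooth f [::] (val rho) (valP rho).
have [_ _ /(_ i)[g1 g2]] := @Cinf_smooth g [::] (val rho) (valP rho).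
by rewrite derivC_lin // mulrDr mulrCA.
Qed.

Lemma TPr_leibniz (rho : Cplus) (v : TE) (f g h : Cinf_red) :
  (forall q, h q = f q * g q) ->
  act v (pullback h) (val rho) =
    f (Pr rho) * act v (pullback g) (val rho) +
    act v (pullback f) (val rho) * g (Pr rho).
Proof.
move=> hE; rewrite /act mulr_sumr mulr_suml -big_split /=; apply: eq_bigr => i _.
have -> : pullback h = fun y => pullback f y * pullback g y.
  apply/funext => y; rewrite /pullback; case: (insub y) => [r|]; first exact: hE.
  by rewrite mulr0.
have [_ _ /(_ i)[f1 f2]] := @Cinf_smooth f [::] (val rho) (valP rho).
have [_ _ /(_ i)[g1 g2]] := @Cinf_smooth g [::] (val rho) (valP rho).
by rewrite derivC_mul // !pullbackE mulrDr mulrCA [RHS]/=; congr (_ + _); rewrite mulrA.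
Qed.

Definition TPr (rho : Cplus) (v : TE) : tangent (Pr rho) :=
  @Tangent (Pr rho) (fun f => act v (pullback f) (val rho))
    (@TPr_linear rho v) (@TPr_leibniz rho v).

(* H_red at the point Pr rho; to be used for rho in Z only *)
Definition Hred (rho : Cplus) : tensor2 R (tangent (Pr rho)) :=
  map_tensor2 (TPr rho) Htensor.

Definition pullback_tensor k
    (omega : forall p : Mred, ('I_k -> tangent p) -> R[i]) :
    E -> ('I_k -> TE) -> R[i] :=
  fun rho v => if (insub rho : option Cplus) is Some r
    then omega (Pr r) (fun i => TPr r (v i)) else 0.

(* smooth symmetric covariant tensor fields of degree [k] on M_red *)
Record symtensor k := SymTensor {
  st_fun :> forall p : Mred, ('I_k -> tangent p) -> R[i];
  st_multilinear : forall p (v : 'I_k -> tangent p) (i : 'I_k) (a : R[i])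
      (x y w : tangent p),
    (forall f, w f = a * x f + y f) ->
    st_fun (update v i w) = a * st_fun (update v i x) + st_fun (update v i y);
  st_symmetric : forall p (v : 'I_k -> tangent p) (sigma : 'S_k),
    st_fun (fun i => v (sigma i)) = st_fun v;
  st_smooth : forall v : 'I_k -> TE,
    smooth_pos (fun rho => pullback_tensor st_fun rho v) }.

Lemma symtensor0_multilinear (f : Cinf_red) p (v : 'I_0 -> tangent p)
    (i : 'I_0) (a : R[i]) (x y w : tangent p) :
  (forall g, w g = a * x g + y g) -> f p = a * f p + f p.
Proof. by case: i. Qed.

(* functions are tensor fields of degree 0 *)
Definition symtensor_of_fun (f : Cinf_red) : symtensor 0 :=
  @SymTensor 0 (fun p _ => f p) (@symtensor0_multilinear f)
    (fun _ _ _ => erefl) (fun _ => @Cinf_smooth f).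

Definition is_Dsym_red (D : forall k, symtensor k -> symtensor k.+1) :=
  forall k (omega : symtensor k) (rho : E) (v : 'I_k.+1 -> TE), E_pos rho ->
    pullback_tensor (D k omega) rho v =
    Theta_pullback (Dsym (pullback_tensor omega)) rho v.

Fixpoint Dred_iter (D : forall k, symtensor k -> symtensor k.+1) r
    (f : Cinf_red) : symtensor r :=
  if r is r'.+1 then D r' (Dred_iter D r' f) else symtensor_of_fun f.

Arguments Dred_iter : clear implicits.

(* A formal power series in lambda is the sequence of its coefficients. *)

Definition const_series (f : E -> R[i]) : nat -> E -> R[i] :=
  fun N => if N is 0 then f else fun=> 0.

Definition wick (F G : nat -> E -> R[i]) : nat -> E -> R[i] :=
  fun N rho => \sum_(r < N.+1) \sum_(a < (N - r).+1)
    (r`!%:R)^-1 * pairing Htensor (Dsym_iter r (F a) rho)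
                           (Dsym_iter r (G (N - r - a)%N) rho).

Definition dJ (f : E -> R[i]) : E -> R[i] :=
  fun rho => (2 * JC rho)^-1 * act (X1_vf rho) f rho.

(* coefficient of lambda^k in T, where t k l stands for T_(k,l) *)
Definition T_coef (t : nat -> nat -> R -> R[i]) (k : nat) (f : E -> R[i]) :
    E -> R[i] :=
  if k is 0 then f
  else fun rho => \sum_(1 <= l < k.*2.+1) t k l (J rho) * iter l dJ f rho.

Definition T_series (t : nat -> nat -> R -> R[i]) (F : nat -> E -> R[i]) :
    nat -> E -> R[i] :=
  fun N rho => \sum_(k < N.+1) T_coef t k (F (N - k)%N) rho.

Definition is_T (t : nat -> nat -> R -> R[i]) :=
  (forall k l, (0 < k)%N -> (0 < l <= k.*2)%N ->
     smooth_on (fun _ : unit => 1 : R^o) [set x : R^o | 0 < x] (t k l)) /\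
  (forall f : E -> R[i], smooth_pos f -> U1_invariant f ->
   forall N rho, E_pos rho ->
     T_series t (const_series (fun x => JC x * f x)) N rho -
     JC rho * T_series t (const_series f) N rho =
     if N is M.+1 then JC rho * dJ (T_series t (const_series f) M) rho else 0).

(* coefficients of order at most N of the solution F of T F = G *)
Fixpoint T_inv_upto (t : nat -> nat -> R -> R[i]) (G : nat -> E -> R[i])
    (N : nat) : nat -> E -> R[i] :=
  if N is M.+1 then
    fun m => if (m <= M)%N then T_inv_upto t G M m
             else fun rho => G m rho -
               \sum_(k < M.+1) T_coef t k.+1 (T_inv_upto t G M (M - k)%N) rho
  else fun=> G 0%N.

Definition T_inv t (G : nat -> E -> R[i]) : nat -> E -> R[i] :=
  fun N => T_inv_upto t G N N.

Lemma T_inv_upto_le t G N m : (m <= N)%N -> T_inv_upto t G N m = T_inv t G m.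
Proof.
elim: N => [|N IH]; first by rewrite leqn0 => /eqP ->.
rewrite leq_eqVlt => /orP[/eqP -> //|]; rewrite ltnS => mN /=.
by rewrite mN IH.
Qed.

Lemma T_invK t G : T_series t (T_inv t G) = G.
Proof.
apply/funext => -[|N]; apply/funext => rho; rewrite /T_series.
  by rewrite big_ord_recl big_ord0 addr0.
rewrite big_ord_recl /= subn0 {1}/T_inv /= ltnn.
have -> : \sum_(k < N.+1) T_coef t (lift ord0 k) (T_inv t G (N.+1 - lift ord0 k)%N) rho =
          \sum_(k < N.+1) T_coef t k.+1 (T_inv_upto t G N (N - k)%N) rho.
  by apply: eq_bigr => k _; rewrite T_inv_upto_le ?leq_subr // lift0 subSS.
by rewrite subrK.
Qed.

Definition wick_tilde t (F G : nat -> E -> R[i]) : nat -> E -> R[i] :=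
  T_inv t (wick (T_series t F) (T_series t G)).

Definition const_series_red (f : Cinf_red) : nat -> Cinf_red :=
  fun N => if N is 0 then f else Cinf_red0.

(* phi = f_red *)
Definition is_reduction (f : E -> R[i]) (phi : Mred -> R[i]) :=
  forall rho : Cplus, J (val rho) = 1 -> phi (Pr rho) = f (val rho).

Definition is_reduced_wick t
    (star : (nat -> Cinf_red) -> (nat -> Cinf_red) -> nat -> Cinf_red) :=
  [/\ forall (a : nat -> R[i]) (F F' G K : nat -> Cinf_red),
        (forall N p, K N p = \sum_(i < N.+1) a i * F (N - i)%N p + F' N p) ->
        forall N p, star K G N p =
          \sum_(i < N.+1) a i * star F G (N - i)%N p + star F' G N p,
      forall (a : nat -> R[i]) (F F' G K : nat -> Cinf_red),
        (forall N p, K N p = \sum_(i < N.+1) a i * F (N - i)%N p + F' N p) ->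
        forall N p, star G K N p =
          \sum_(i < N.+1) a i * star G F (N - i)%N p + star G F' N p &
      forall (f g : E -> R[i]) (phi gamma : Cinf_red),
        smooth_pos f -> U1_invariant f -> smooth_pos g -> U1_invariant g ->
        is_reduction f phi -> is_reduction g gamma ->
        forall N, is_reduction
          (wick_tilde t (const_series f) (const_series g) N)
          (star (const_series_red phi) (const_series_red gamma) N)].

Definition is_polynomial (p : E -> R[i]) :=
  exists ms : seq (R[i] * {ffun 'I_n.+1 -> nat} * {ffun 'I_n.+1 -> nat}),
    forall rho, p rho = \sum_(m <- ms)
      m.1.1 * \prod_(k < n.+1) (zcoord rho k ^+ m.1.2 k *
                                (zcoord rho k)^* ^+ m.2 k).

Definition in_Pred (g : Mred -> R[i]) :=
  exists p : E -> R[i], [/\ is_polynomial p,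
    forall u rho, `|u| = 1 -> p (cscale u rho) = p rho & is_reduction p g].

End Geometry.

Arguments Dsym_iter {R n} r f.
Arguments Dred_iter {R n s} D r f.

Section FormalPowerSeries.
Variable R : realType.

Definition fps_mul (a b : nat -> R[i]) : nat -> R[i] :=
  fun N => \sum_(i < N.+1) a i * b (N - i)%N.

(* 1 / (1 - a lambda) *)
Definition fps_geom (a : R[i]) : nat -> R[i] := fun N => a ^+ N.

(* lambda^r / \prod_(k < r) (1 - k lambda) *)
Definition inv_falling (r : nat) : nat -> R[i] :=
  fps_mul (fun N => (N == r)%:R)
    (\big[fps_mul/(fun N => (N == 0)%:R)]_(k < r) fps_geom k%:R).

Lemma inv_falling_lt r N : (N < r)%N -> inv_falling r N = 0.
Proof.
move=> Nr; rewrite /inv_falling /fps_mul big1 // => i _.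
by rewrite (ltn_eqF (leq_ltn_trans _ Nr)) ?mul0r // -ltnS.
Qed.

(* sum of a series of power series whose r-th term is O(lambda^r) *)
Definition fps_sum (u : nat -> nat -> R[i]) : nat -> R[i] :=
  fun N => \sum_(r < N.+1) u r N.

End FormalPowerSeries.

(* r-th term of the series for the reduced star product, at Pr rho *)
Definition star_red_term (R : realType) (n s : nat)
    (D : forall k, symtensor R n s k -> symtensor R n s k.+1)
    (f g : Cinf_red R n s) (r : nat) (rho : Cplus R n s) : nat -> R[i] :=
  fun N => (r`!%:R)^-1 * inv_falling R r N *
    pairing (Hred rho) (@st_fun R n s r (Dred_iter D r f) (Pr rho))
                       (@st_fun R n s r (Dred_iter D r g) (Pr rho)).

(* Main.v *)
(* Let f, g be functions on M_red, pulled back to C^(1+n)_+.  They are annihilated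
   by the holomorphic and the antiholomorphic Euler field, hence fixed by T, and
   f ~* g = T^-1 (sum_r lambda^r/r! W_r) with W_r = <D^r f (x) D^r g, H^r>.

   Writing H = H_hor + J^-1 (conj E) (x) E with E the holomorphic Euler field,
   and expanding H^r, each factor E lowers the order of the derivatives by Euler's
   relation, so that
     W_r = sum_j C(r,j) J^-j ((r-1)(r-2)...(r-j))^2 P_(r-j),
   P_m being the pairing of the horizontal derivatives with H^m.  The projection
   Theta has no effect on pure (anti)holomorphic horizontal derivatives because
   v(J)/J is annihilated to every order by horizontal derivatives of the type of v
   at a point where v is horizontal.  Hence P_m is the pairing of the iterated
   D_red with H_red^m.

   Finally T (J f) = J (1 + lambda d/dJ) T f determines T on the functions
   J^-N h with h of degree 0, and it maps 1/(J/lambda)_(falling m) to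
     sum_M (lambda/J)^M ((M-1)...m)^2 / (M-m)!,
   which is the series multiplying P_m J^m / m! in the Wick product.

   If g comes from a polynomial p, its pullback is p (x / sqrt J); horizontal
   derivatives do not see sqrt J, so those of high order vanish. *)

From HB Require Import structures.
From mathcomp Require Import all_boot all_order all_algebra perm.
From mathcomp Require Import all_classical all_reals all_analysis.
From mathcomp Require Import complex ring.
Require Import Defs.
Set Implicit Arguments.
Unset Strict Implicit.
Unset Printing Implicit Defensive.
Import Order.TTheory GRing.Theory Num.Theory.
Import numFieldNormedType.Exports.
Local Open Scope classical_set_scope.
Local Open Scope ring_scope.
Local Open Scope complex_scope.

(** * Calculus along lines *)

(** Three obstacles shape the proof. [smooth_on] speaks only of iterated partial derivatives along a
    basis, so symmetry of second derivatives and linearity in the direction must be derived from it;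
    in return no charts of the quotient occur, as everything on it is handled through pullbacks.
    Next, [Theta] depends on the base point, and iterating the reduced derivative differentiates it.
    Instead of computing those derivatives, one fixes [rho] and the type of the vectors and works
    modulo the ideal of functions all of whose horizontal derivatives at [rho] vanish. Finally, the
    coefficients: T(J^-N) has unsigned Stirling numbers of the first kind as coefficients, the
    inverse falling factorials have Stirling numbers of the second kind, and the sums of their
    products agree with the squares produced by Euler's relation because both satisfy X(M+1,m+1) =
    X(M,m) + (m+M) X(M,m+1). Both pairings are contractions with matrices that differ by a rank one
    term, so a single expansion lemma gives the passage in either direction. *)

Section RealCalculus.
Variables (R : realType) (V : normedModType R).
Implicit Types (f : V -> R) (x u v e : V).

Lemma is_derive_line f x v (t : R) : derivable f (x + t *: v) v ->
  is_derive t 1 (fun h : R => f (x + h *: v)) ('D_v f (x + t *: v)).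
Proof.
move=> fd; have E : (fun h : R => h^-1 *: (((fun h : R => f (x + h *: v)) \o shift t) (h *: 1) -
    f (x + t *: v))) = (fun h => h^-1 *: ((f \o shift (x + t *: v)) (h *: v) - f (x + t *: v))).
  apply/funext => h /=; congr (_ *: (f _ - _)).
  by rewrite [h *: 1]mulr1 scalerDl addrCA.
by apply: DeriveDef; rewrite /derivable /derive E.
Qed.

(** Restriction to the line reduces this to one variable; [t] may have either sign, so the
    intermediate parameter is only bounded by [|t|]. *)
Lemma MVT_line f x v (t : R) :
  (forall c : R, `|c| <= `|t| -> derivable f (x + c *: v) v) ->
  exists2 c : R, `|c| <= `|t| & f (x + t *: v) - f x = t * 'D_v f (x + c *: v).
Proof.
move=> fd; pose g (h : R) := f (x + h *: v).
have gd (c : R) : `|c| <= `|t| -> is_derive c 1 g ('D_v f (x + c *: v)).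
  by move=> /fd; exact: is_derive_line.
have gc (a b : R) : (forall c, c \in `[a, b] -> `|c| <= `|t|) ->
    {within `[a, b], continuous g}.
  move=> H; apply: derivable_within_continuous => c /H /gd gdc.
  by case: gdc.
have [t0|t0] := leP 0 t.
  have H c : c \in `[0, t] -> `|c| <= `|t|.
    by rewrite in_itv /= => /andP[c0 ct]; rewrite !ger0_norm.
  have H' (c : R) : c \in `]0, t[ -> is_derive c 1 g ('D_v f (x + c *: v)).
    rewrite in_itv /= => /andP[c0 ct]; apply: gd; apply: H.
    by rewrite in_itv /= !ltW.
  have [c /H ct E] := MVT_segment t0 H' (gc _ _ H).
  by exists c => //; move: E; rewrite /g scale0r addr0 subr0 mulrC.
have H c : c \in `[t, 0] -> `|c| <= `|t|.
  by rewrite in_itv /= => /andP[c0 ct]; rewrite !ler0_norm ?lerN2 // ltW.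
have H' (c : R) : c \in `]t, 0[ -> is_derive c 1 g ('D_v f (x + c *: v)).
  rewrite in_itv /= => /andP[c0 ct]; apply: gd; apply: H.
  by rewrite in_itv /= !ltW.
have [c /H ct E] := MVT_segment (ltW t0) H' (gc _ _ H).
exists c => //; move: E; rewrite /g scale0r addr0 sub0r mulrN => E.
by rewrite -opprB E opprK mulrC.
Qed.

Lemma near_le_norm (P : V -> Prop) x : (\forall y \near x, P y) ->
  exists2 d : R, 0 < d & forall y, `|y| < d -> P (x + y).
Proof.
move=> /nbhs_normP[d /= d0 H]; exists d => // y yd; apply: H.
by rewrite /= opprD addrA subrr sub0r normrN.
Qed.

(** The increment along [u + e] splits into one along [u] and one along [e] from the displaced
    point; the mean value theorem and continuity of the derivative along [e] control the second.
    Along [u] only differentiability at [x] enters, so the lemma can be iterated over a sum of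
    directions. *)
Lemma is_derive_addv f x u e : derivable f x u ->
  (\forall y \near x, derivable f y e) -> {for x, continuous ('D_e f)} ->
  is_derive x (u + e) f ('D_u f x + 'D_e f x).
Proof.
move=> fu fe ce.
have C : (fun h : R => h^-1 *: ((f \o shift x) (h *: (u + e)) - f x)) @ 0^' -->
    'D_u f x + 'D_e f x; last first.
  by apply: DeriveDef; [apply/cvg_ex; eexists; exact: C|exact: cvg_lim C].
have -> : (fun h : R => h^-1 *: ((f \o shift x) (h *: (u + e)) - f x)) =
   (fun h : R => h^-1 *: ((f \o shift x) (h *: u) - f x)) \+
   (fun h : R => h^-1 *: (f (x + h *: u + h *: e) - f (x + h *: u))).
  apply/funext => h /=; rewrite -scalerDr; congr (_ *: _).
  rewrite scalerDr addrC [h *: u + x]addrC [h *: u + h *: e + x]addrC addrA.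
  ring.
apply: cvgD; first exact: fu.
apply/cvgrPdist_lt => /= eps eps0.
have : \forall y \near x, derivable f y e /\ `|'D_e f x - 'D_e f y| < eps.
  by near=> y; split; near: y => //; move/cvgrPdist_lt: ce; exact.
move=> /near_le_norm[d d0 H].
have K0 : 0 < `|u| + `|e| + 1 by rewrite ltr_wpDl // addr_ge0.
near=> h.
have hd : `|h| * (`|u| + `|e| + 1) < d.
  rewrite -ltr_pdivlMr //; near: h; apply: dnbhs0_lt; exact: divr_gt0.
have h0 : h != 0 by near: h; exact: nbhs_dnbhs_neq.
have hb c : `|c| <= `|h| -> `|h *: u + c *: e| < d.
  move=> ch; apply: le_lt_trans hd; apply: le_trans (ler_normD _ _) _.
  rewrite !normrZ mulrDr mulr1 mulrDr -addrA lerD2l.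
  by rewrite (le_trans (ler_wpM2r _ ch)) // lerDl.
have D c : `|c| <= `|h| -> derivable f (x + h *: u + c *: e) e.
  by move=> /hb /H[]; rewrite addrA.
have [c ch ->] := MVT_line D.
have [_] := H _ (hb _ ch).
by rewrite addrA (_ : _ *: _ = 'D_e f (x + h *: u + c *: e)) //; exact: mulKf.
Unshelve. all: by end_near. Qed.

Lemma is_derive_from_line f x v (a : R) :
  is_derive (0 : R) 1 (fun h : R => f (x + h *: v)) a -> is_derive x v f a.
Proof.
move=> [cd cv].
have E : (fun h : R => h^-1 *: (((fun h : R => f (x + h *: v)) \o shift 0) (h *: 1) -
    f (x + 0 *: v))) = (fun h => h^-1 *: ((f \o shift x) (h *: v) - f x)).
  apply/funext => h /=; rewrite scale0r !addr0 [h *: 1]mulr1.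
  by rewrite [_ + x]addrC.
have fd : derivable f x v by rewrite /derivable -E.
by split; rewrite // /derive -E.
Qed.

(** On a line, scaling the direction is a change of parameter, to which the chain rule in one
    variable applies. *)
Lemma is_deriveZv f x v (a : R) : derivable f x v ->
  is_derive x (a *: v) f (a * 'D_v f x).
Proof.
move=> fd; have := @is_derive_line f x v 0; rewrite scale0r addr0 => /(_ fd) gd.
have sd : is_derive (0 : R) 1 (fun h : R => h * a) a.
  have -> : (fun h : R => h * a) = a \*: id.
    by apply/funext => h; rewrite /= mulrC.
  by apply: is_derive_eq (is_deriveZ a _) _; rewrite [_ *: _]mulr1.
have gd' : is_derive ((0 : R) * a) 1 (fun h : R => f (x + h *: v)) ('D_v f x).
  by rewrite mul0r.
apply: is_derive_from_line; rewrite mulrC.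
have -> : (fun h : R => f (x + h *: (a *: v))) =
    (fun h => f (x + h *: v)) \o (fun h : R => h * a).
  by apply/funext => h /=; rewrite scalerA.
exact: (@is_derive1_comp _ (fun h => f (x + h *: v)) (fun h : R => h * a) 0 _ _ gd' sd).
Qed.

Lemma is_derive_comp1 (g : R -> R) f x v (a b : R) :
  is_derive (f x) 1 g a -> is_derive x v f b -> is_derive x v (g \o f) (a * b).
Proof.
move=> gd [fd fb]; apply: is_derive_from_line.
have := @is_derive_line f x v 0; rewrite scale0r addr0 fb => /(_ fd) ld.
have gd' : is_derive (f (x + 0 *: v)) 1 g a by rewrite scale0r addr0.
exact: (@is_derive1_comp _ g (fun h : R => f (x + h *: v)) 0 a b gd' ld).
Qed.

Lemma is_derive_rsqrt f x v (a : R) : 0 < f x -> is_derive x v f a ->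
  is_derive x v (fun y => (Num.sqrt (f y))^-1) (- 2^-1 * (Num.sqrt (f x))^-1 ^+ 3 * a).
Proof.
move=> f0 fd; apply: (@is_derive_comp1 (fun y => (Num.sqrt y)^-1) f x v _ a _ fd).
have s0 : Num.sqrt (f x) != 0 by rewrite gt_eqF // sqrtr_gt0.
apply: is_derive_eq (is_deriveV s0 (is_derive1_sqrt f0)) _.
rewrite (_ : _ *: _ = - (Num.sqrt (f x)) ^- 2 * (2 * Num.sqrt (f x))^-1) //.
by field.
Qed.

Lemma continuous_rsqrt f x : 0 < f x -> {for x, continuous f} ->
  {for x, continuous (fun y => (Num.sqrt (f y))^-1)}.
Proof.
move=> f0 fc; have s0 : Num.sqrt (f x) != 0 by rewrite gt_eqF // sqrtr_gt0.
have sc : {for x, continuous (fun y => Num.sqrt (f y))}.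
  exact: (continuous_comp fc (@sqrt_continuous _ _)).
exact: (cvgV s0 sc).
Qed.

Lemma is_derive_sumv (T : Type) (r : seq T) (a : T -> R) (e : T -> V) f x :
  (forall i, \forall y \near x, derivable f y (e i)) ->
  (forall i, {for x, continuous ('D_(e i) f)}) ->
  is_derive x (\sum_(i <- r) a i *: e i) f (\sum_(i <- r) a i * 'D_(e i) f x).
Proof.
move=> fd fc; elim: r => [|i r IH].
  by rewrite !big_nil; split; [exact: derivable0|exact: derive0].
have nd : \forall y \near x, derivable f y (a i *: e i) /\
    'D_(a i *: e i) f y = a i * 'D_(e i) f y.
  have := fd i; apply: filterS => y dy.
  by have [d1 d2] := is_deriveZv (a i) dy.
have nd1 : \forall y \near x, derivable f y (a i *: e i).
  by move: nd; apply: filterS => y [].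
have dc : {for x, continuous ('D_(a i *: e i) f)}.
  have nE : {near x, (fun y => a i * 'D_(e i) f y) =1 'D_(a i *: e i) f}.
    by move: nd; apply: filterS => y [_ ->].
  apply: (@cvg_trans _ ((fun y => a i * 'D_(e i) f y) @ x)); first exact: near_eq_cvg.
  rewrite (nbhs_singleton nd).2.
  by apply: cvgM; [exact: cvg_cst|exact: fc].
have := is_derive_addv (ex_derive (is_derive := IH)) nd1 dc.
rewrite !big_cons (nbhs_singleton nd).2 addrC [X in is_derive _ _ _ X]addrC.
by rewrite (derive_val (is_derive := IH)).
Qed.

Lemma Schwarz f x u v :
  (\forall y \near x, [/\ derivable f y u, derivable f y v,
     derivable ('D_u f) y v & derivable ('D_v f) y u]) ->
  {for x, continuous ('D_v ('D_u f))} -> {for x, continuous ('D_u ('D_v f))} ->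
  'D_v ('D_u f) x = 'D_u ('D_v f) x.
Proof.
move=> fd cvu cuv.
(* the second difference of [f] at scale [h] is [h^2] times a mixed derivative
   at a nearby point, in either order *)
have key u' v' (d : R) : (forall y, `|y| < d -> derivable f (x + y) u' /\
       derivable ('D_u' f) (x + y) v') ->
    forall h : R, 0 < h -> h * (`|u'| + `|v'|) < d -> exists2 y, `|y| <= h * (`|u'| + `|v'|) &
      f (x + h *: u' + h *: v') - f (x + h *: u') - f (x + h *: v') + f x =
      h * (h * 'D_v' ('D_u' f) (x + y)).
  move=> H h h0 hd.
  have hb (a b : R) : `|a| <= `|h| -> `|b| <= `|h| -> `|a *: u' + b *: v'| <= h * (`|u'| + `|v'|).
    rewrite (gtr0_norm h0) => ah bh; apply: le_trans (ler_normD _ _) _.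
    by rewrite !normrZ mulrDr lerD // ler_wpM2r.
  pose g y := f (y + h *: v') - f y.
  have gd y : derivable f (y + h *: v') u' -> derivable f y u' ->
      is_derive y u' g ('D_u' f (y + h *: v') - 'D_u' f y).
    move=> d1 d2; apply: is_deriveB; last exact: derivableP.
    have E : (fun t : R => t^-1 *: (((fun y => f (y + h *: v')) \o shift y) (t *: u') - f (y + h *: v'))) =
       (fun t => t^-1 *: ((f \o shift (y + h *: v')) (t *: u') - f (y + h *: v'))).
      by apply/funext => t /=; rewrite addrA.
    by split; [rewrite /derivable E; exact: d1|rewrite /derive E].
  have D c : `|c| <= `|h| -> derivable f (x + c *: u' + h *: v') u' /\ derivable f (x + c *: u') u'.
    move=> ch; rewrite -addrA; split.
      exact: (H _ (le_lt_trans (hb _ _ ch (lexx _)) hd)).1.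
    case: (H (c *: u')) => //; apply: le_lt_trans hd.
    by rewrite -[c *: u']addr0 -(scale0r v'); apply: hb; rewrite // normr0.
  have [c ch] : exists2 c : R, `|c| <= `|h| & g (x + h *: u') - g x = h * 'D_u' g (x + c *: u').
    by apply: MVT_line => c /D[d1 d2]; case: (gd _ d1 d2).
  have [d1 d2] := D _ ch; have [_ ->] := gd _ d1 d2.
  have [c' c'h ->] : exists2 c' : R, `|c'| <= `|h| & 'D_u' f (x + c *: u' + h *: v') - 'D_u' f (x + c *: u') = h * 'D_v' ('D_u' f) (x + c *: u' + c' *: v').
    apply: (@MVT_line ('D_u' f) (x + c *: u') v' h) => c' c'h; rewrite -addrA.
    by case: (H (c *: u' + c' *: v')) => //; apply: le_lt_trans hd; apply: hb.
  rewrite /g => E; exists (c *: u' + c' *: v'); first exact: hb.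
  by rewrite addrA -E; ring.
(* If the mixed derivatives at [x] differed by [N > 0], continuity would put each within [N / 2] of
   its value at a nearby point, and [key] shows that these two values coincide. *)
apply/eqP; rewrite -subr_eq0 -normr_le0 leNgt; apply/negP => N0.
set N := `|_| in N0; have N2 : 0 < N / 2 by rewrite divr_gt0.
have : \forall y \near x, [/\ derivable f y u, derivable f y v,
     derivable ('D_u f) y v & derivable ('D_v f) y u] /\
   (`|'D_v ('D_u f) x - 'D_v ('D_u f) y| < N / 2 /\
    `|'D_u ('D_v f) x - 'D_u ('D_v f) y| < N / 2).
  have c1 : \forall y \near x, `|'D_v ('D_u f) x - 'D_v ('D_u f) y| < N / 2.
    by move/cvgrPdist_lt: cvu => /(_ _ N2).
  have c2 : \forall y \near x, `|'D_u ('D_v f) x - 'D_u ('D_v f) y| < N / 2.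
    by move/cvgrPdist_lt: cuv => /(_ _ N2).
  by near=> y; split; [exact: (near fd y)|split; [exact: (near c1 y)|exact: (near c2 y)]].
move=> /near_le_norm[d d0 H].
have K0 : 0 < `|u| + `|v| + 1 by rewrite ltr_wpDl // addr_ge0.
(* Small enough for both intermediate points to stay in the ball of radius [d]; the added 1 avoids
   division by zero. *)
pose h := d / (`|u| + `|v| + 1) / 2.
have h0 : 0 < h by rewrite !divr_gt0.
have hd : h * (`|u| + `|v|) < d.
  have : h * (`|u| + `|v| + 1) < d.
    by rewrite /h mulrAC divfK ?gt_eqF // ltr_pdivrMr // mulr_natr mulr2n ltrDl.
  by apply: le_lt_trans; apply: (ler_wpM2l (ltW h0)); rewrite lerDl.
have [|y1 y1d E1] := key u v d _ h h0 hd; first by move=> y /H[[]].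
have hd' : h * (`|v| + `|u|) < d by rewrite addrC.
have [|y2 y2d E2] := key v u d _ h h0 hd'; first by move=> y /H[[]].
rewrite (addrAC x (h *: v)) in E2.
have swap (p q r t A B : R) : p - q - r + t = h * (h * A) ->
    p - r - q + t = h * (h * B) -> A = B.
  move=> Ep Eq; apply: (mulfI (lt0r_neq0 h0)); apply: (mulfI (lt0r_neq0 h0)).
  by rewrite -Ep -Eq; ring.
have E := swap _ _ _ _ _ _ E1 E2.
have [_ [A1 _]] := H y1 (le_lt_trans y1d hd).
have [_ [_ A2]] := H y2 (le_lt_trans y2d hd').
rewrite E in A1.
have tri (a b c m : R) : `|a - c| < m / 2 -> `|b - c| < m / 2 -> `|a - b| < m.
  move=> ac bc; have -> : a - b = (a - c) - (b - c) by ring.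
  by apply: le_lt_trans (ler_normB _ _) _; rewrite [ltRHS]splitr ltrD.
by have := tri _ _ _ _ A1 A2; rewrite -/N ltxx.
Unshelve. all: by end_near. Qed.

End RealCalculus.

(** * Smooth complex-valued functions *)

Section SmoothFunctions.
Variables (R : realType) (V : normedModType R) (I : Type) (e : I -> V).
Variables (U : set V) (oU : open U).
Implicit Types (f g : V -> R[i]) (rho : V).

(** Values outside [U] are arbitrary; since [U] is open, functions equal on [U] have equal
    derivatives there. *)
Definition eqon f g := forall rho, U rho -> f rho = g rho.

Definition regular f := forall rho, U rho ->
  [/\ {for rho, continuous (reC f)}, {for rho, continuous (imC f)} &
      forall i, derivable (reC f) rho (e i) /\
                derivable (imC f) rho (e i)].

(** A version of [smooth_on] graded by order. It suits induction: the derivative of a product is a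
    sum of products in which one order has been lost, whereas words of derivatives would need the
    full Leibniz formula. *)
Fixpoint Cn k f : Prop :=
  regular f /\ (if k is k'.+1 then forall i, Cn k' (derivC (e i) f) else True).

Lemma smooth_onP f : smooth_on e U f <-> forall k, Cn k f.
Proof.
split=> [fs k|fC l rho rho0].
  have {}fs : forall l, regular (foldr (fun i => derivC (e i)) f l).
    by move=> l rho rho0; exact: fs.
  elim: k f fs => [|k IH] f fs; first by split=> //; exact: (fs [::]).
  split; first exact: (fs [::]).
  (* [foldr] applies the last letter of the word first, so the derivative already taken is appended
     at the end. *)
  by move=> i; apply: IH => l; have := fs (rcons l i); rewrite foldr_rcons.
have {}fC := fC (size l).
suff : regular (foldr (fun i => derivC (e i)) f l) by exact.
elim/last_ind: l f fC => [|l i IH] f; first by case.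
by rewrite size_rcons foldr_rcons => -[_ /(_ i)]; exact: IH.
Qed.

Lemma CnW k f : Cn k.+1 f -> Cn k f.
Proof.
elim: k f => [|k IH] f [f0 fD]; split=> // i.
exact/IH/fD.
Qed.

Lemma smooth_regular f : smooth_on e U f -> regular f.
Proof. by move/smooth_onP/(_ 0); case. Qed.

Lemma smooth_derivC f i : smooth_on e U f -> smooth_on e U (derivC (e i) f).
Proof.
by move=> /smooth_onP fs; apply/smooth_onP => k; case: (fs k.+1) => _; exact.
Qed.

Lemma eqon_near f g rho : eqon f g -> U rho -> {near rho, f =1 g}.
Proof.
by move=> fg rho0; have := open_nbhs_nbhs (conj oU rho0); apply: filterS => x; exact: fg.
Qed.

Lemma eqon_derivC f g u : eqon f g -> eqon (derivC u f) (derivC u g).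
Proof.
move=> fg rho rho0; have nfg := eqon_near fg rho0.
by congr Complex; apply: near_eq_derive; apply: filterS nfg => x; rewrite /reC /imC => ->.
Qed.

Lemma eqon_regular f g : eqon f g -> regular f -> regular g.
Proof.
move=> fg fr rho rho0; have [f1 f2 fd] := fr rho rho0; have nfg := eqon_near fg rho0.
have nr : {near rho, reC f =1 reC g} by apply: filterS nfg => x; rewrite /reC => ->.
have ni : {near rho, imC f =1 imC g} by apply: filterS nfg => x; rewrite /imC => ->.
split.
- apply: (@cvg_trans _ (reC f @ rho)); first exact: near_eq_cvg.
  by rewrite -(nbhs_singleton nr).
- apply: (@cvg_trans _ (imC f @ rho)); first exact: near_eq_cvg.
  by rewrite -(nbhs_singleton ni).
- by move=> i; have [d1 d2] := fd i; split; [apply: near_eq_derivable nr d1|apply: near_eq_derivable ni d2].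
Qed.

Lemma eqon_Cn k f g : eqon f g -> Cn k f -> Cn k g.
Proof.
elim: k f g => [|k IH] f g fg [fr fD]; split; [exact: eqon_regular fr|by []|exact: eqon_regular fr|].
by move=> i; apply: IH (fD i); exact: eqon_derivC.
Qed.

Lemma eqon_smooth f g : eqon f g -> smooth_on e U f -> smooth_on e U g.
Proof. by move=> fg /smooth_onP fs; apply/smooth_onP => k; exact: eqon_Cn (fs k). Qed.

Lemma regular_lin (a : R[i]) f g : regular f -> regular g -> regular (fun x => a * f x + g x).
Proof.
move=> fr gr rho rho0; have [f1 f2 fd] := fr rho rho0; have [g1 g2 gd] := gr rho rho0.
case: a => a b.
have -> : reC (fun y => (a +i* b) * f y + g y) = a *: reC f - b *: imC f + reC g.
  apply/funext => y; transitivity (a * complex.Re (f y) - b * complex.Im (f y) + complex.Re (g y)) => //.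
  by rewrite /reC /imC; case: (f y) => ? ?; case: (g y).
have -> : imC (fun y => (a +i* b) * f y + g y) = a *: imC f + b *: reC f + imC g.
  apply/funext => y; transitivity (a * complex.Im (f y) + b * complex.Re (f y) + complex.Im (g y)) => //.
  by rewrite /reC /imC; case: (f y) => ? ?; case: (g y).
have cZ (c : R) (h : V -> R) : {for rho, continuous h} -> {for rho, continuous (c *: h)}.
  by move=> hc; apply: (@continuousM _ _ (cst c) h) => //; exact: cvg_cst.
have dZ (c : R) (h : V -> R) i : derivable h rho (e i) -> derivable (c *: h) rho (e i).
  exact: derivableZ.
split.
- exact: (continuousD (continuousB (cZ a _ f1) (cZ b _ f2)) g1).
- exact: (continuousD (continuousD (cZ a _ f2) (cZ b _ f1)) g2).
- move=> i; have [d1 d2] := fd i; have [d3 d4] := gd i; split.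
    exact: (derivableD (derivableB (dZ a _ _ d1) (dZ b _ _ d2)) d3).
  exact: (derivableD (derivableD (dZ a _ _ d2) (dZ b _ _ d1)) d4).
Qed.

Lemma regular_mul f g : regular f -> regular g -> regular (fun x => f x * g x).
Proof.
move=> fr gr rho rho0; have [f1 f2 fd] := fr rho rho0; have [g1 g2 gd] := gr rho rho0.
have -> : reC (fun y => f y * g y) = reC f * reC g - imC f * imC g.
  apply/funext => y; transitivity (complex.Re (f y) * complex.Re (g y) - complex.Im (f y) * complex.Im (g y)) => //.
  by rewrite /reC /imC; case: (f y) => ? ?; case: (g y).
have -> : imC (fun y => f y * g y) = reC f * imC g + imC f * reC g.
  apply/funext => y; transitivity (complex.Re (f y) * complex.Im (g y) + complex.Im (f y) * complex.Re (g y)) => //.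
  by rewrite /reC /imC; case: (f y) => ? ?; case: (g y).
split.
- exact: (continuousB (continuousM f1 g1) (continuousM f2 g2)).
- exact: (continuousD (continuousM f1 g2) (continuousM f2 g1)).
- move=> i; have [d1 d2] := fd i; have [d3 d4] := gd i; split.
    exact: (derivableB (derivableM d1 d3) (derivableM d2 d4)).
  exact: (derivableD (derivableM d1 d4) (derivableM d2 d3)).
Qed.

Lemma regular_derivC_lin i (a : R[i]) f g : regular f -> regular g ->
  eqon (derivC (e i) (fun x => a * f x + g x))
        (fun x => a * derivC (e i) f x + derivC (e i) g x).
Proof.
move=> fr gr rho rho0; have [_ _ /(_ i)[f1 f2]] := fr rho rho0.
by have [_ _ /(_ i)[g1 g2]] := gr rho rho0; exact: derivC_lin.
Qed.

Lemma regular_derivC_mul i f g : regular f -> regular g ->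
  eqon (derivC (e i) (fun x => f x * g x))
        (fun x => f x * derivC (e i) g x + derivC (e i) f x * g x).
Proof.
move=> fr gr rho rho0; have [_ _ /(_ i)[f1 f2]] := fr rho rho0.
by have [_ _ /(_ i)[g1 g2]] := gr rho rho0; exact: derivC_mul.
Qed.

Lemma Cn_lin k (a : R[i]) f g : Cn k f -> Cn k g -> Cn k (fun x => a * f x + g x).
Proof.
elim: k f g => [|k IH] f g [fr fD] [gr gD]; split; [exact: regular_lin|by []|exact: regular_lin|].
move=> i; apply: (@eqon_Cn _ (fun x => a * derivC (e i) f x + derivC (e i) g x)).
  by move=> rho rho0; rewrite regular_derivC_lin.
exact: (IH _ _ (fD i) (gD i)).
Qed.

Lemma reC_derivC u f : reC (derivC u f) = 'D_u (reC f).
Proof. by []. Qed.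

Lemma imC_derivC u f : imC (derivC u f) = 'D_u (imC f).
Proof. by []. Qed.

Lemma derivC_cst u (a : R[i]) : derivC u (fun _ : V => a) = fun=> 0.
Proof.
apply/funext => x; rewrite /derivC.
by rewrite (_ : reC _ = cst (complex.Re a)) // (_ : imC _ = cst (complex.Im a)) // !derive_cst.
Qed.

Lemma regular_cst (a : R[i]) : regular (fun=> a).
Proof.
move=> rho _; split; [exact: cst_continuous|exact: cst_continuous|].
by move=> i; split; exact: derivable_cst.
Qed.

Lemma Cn_cst k (a : R[i]) : Cn k (fun=> a).
Proof.
elim: k a => [|k IH] a; split; [exact: regular_cst|by []|exact: regular_cst|].
by move=> i; rewrite derivC_cst; exact: IH.
Qed.

Lemma Cn_add k f g : Cn k f -> Cn k g -> Cn k (fun x => f x + g x).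
Proof.
move=> fC gC; apply: eqon_Cn (Cn_lin 1 fC gC) => x _; by rewrite mul1r.
Qed.

Lemma Cn_mul k f g : Cn k f -> Cn k g -> Cn k (fun x => f x * g x).
Proof.
elim: k f g => [|k IH] f g fC gC.
  by case: fC gC => [fr _] [gr _]; split; [exact: (regular_mul fr gr)|by []].
split; first by apply: regular_mul; [case: fC|case: gC].
move=> i; apply: (@eqon_Cn _ (fun x => f x * derivC (e i) g x + derivC (e i) f x * g x)).
  have [[fr _] [gr _]] := (fC, gC).
  by move=> rho rho0; rewrite (regular_derivC_mul i fr gr rho0).
apply: Cn_add; apply: IH; [exact: CnW|exact: gC.2|exact: fC.2|exact: CnW].
Qed.

Lemma smooth_cst (a : R[i]) : smooth_on e U (fun _ : V => a).
Proof. by apply/smooth_onP => k; exact: Cn_cst. Qed.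

Lemma smooth_add f g : smooth_on e U f -> smooth_on e U g -> smooth_on e U (fun x => f x + g x).
Proof.
by move=> /smooth_onP fs /smooth_onP gs; apply/smooth_onP => k; exact: Cn_add.
Qed.

Lemma smooth_mul f g : smooth_on e U f -> smooth_on e U g -> smooth_on e U (fun x => f x * g x).
Proof.
by move=> /smooth_onP fs /smooth_onP gs; apply/smooth_onP => k; exact: Cn_mul.
Qed.

Lemma smooth_scale (a : R[i]) f : smooth_on e U f -> smooth_on e U (fun x => a * f x).
Proof. exact: (smooth_mul (smooth_cst a)). Qed.

Lemma smooth_exp k f : smooth_on e U f -> smooth_on e U (fun x => f x ^+ k).
Proof.
move=> fs; elim: k => [|k IH]; first exact: eqon_smooth (smooth_cst 1).
by apply: eqon_smooth (smooth_mul fs IH) => x _; rewrite [RHS]exprS.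
Qed.

Lemma smooth_sum (T : Type) (r : seq T) (P : pred T) (F : T -> V -> R[i]) :
  (forall i, P i -> smooth_on e U (F i)) ->
  smooth_on e U (fun x => \sum_(i <- r | P i) F i x).
Proof.
move=> Fs; elim: r => [|i r IH].
  by apply: eqon_smooth (smooth_cst 0) => x _; rewrite big_nil.
case Pi : (P i); last by apply: eqon_smooth IH => x _; rewrite big_cons Pi.
by apply: eqon_smooth (smooth_add (Fs i Pi) IH) => x _; rewrite big_cons Pi.
Qed.

(** A bootstrap for functions whose first derivatives are expressed through the function itself and
    smooth functions: order [k] of [f] gives order [k] of its derivatives, hence order [k.+1] of
    [f]. *)
Lemma smooth_from_regular f : regular f ->
  (forall k, Cn k f -> forall i, Cn k (derivC (e i) f)) -> smooth_on e U f.
Proof.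
move=> fr H; apply/smooth_onP; elim=> [|k IH]; first by split.
by split; [exact: fr|exact: (H _ IH)].
Qed.

Lemma derivC_comm i j f rho : smooth_on e U f -> U rho ->
  derivC (e i) (derivC (e j) f) rho =
  derivC (e j) (derivC (e i) f) rho.
Proof.
move=> fs rho0; have r0 := smooth_regular fs.
have ri k := smooth_regular (smooth_derivC k fs).
have rij k l := smooth_regular (smooth_derivC k (smooth_derivC l fs)).
have [c1 c2 _] := rij i j rho rho0; have [c3 c4 _] := rij j i rho rho0.
have nr : \forall y \near rho, U y.
  exact: (open_nbhs_nbhs (conj oU rho0)).
have {}c1 : {for rho, continuous ('D_(e i) ('D_(e j) (reC f)))} by exact: c1.
have {}c3 : {for rho, continuous ('D_(e j) ('D_(e i) (reC f)))} by exact: c3.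
have {}c2 : {for rho, continuous ('D_(e i) ('D_(e j) (imC f)))} by exact: c2.
have {}c4 : {for rho, continuous ('D_(e j) ('D_(e i) (imC f)))} by exact: c4.
have regn y : U y -> [/\ (forall k, derivable (reC f) y (e k) /\ derivable (imC f) y (e k)),
    derivable (reC (derivC (e j) f)) y (e i) /\
    derivable (imC (derivC (e j) f)) y (e i) &
    derivable (reC (derivC (e i) f)) y (e j) /\
    derivable (imC (derivC (e i) f)) y (e j)].
  move=> y0; have [_ _ d0] := r0 y y0.
  have [_ _ d1] := ri j y y0; have [_ _ d2] := ri i y y0.
  by split; [exact: d0|exact: d1|exact: d2].
have nre : \forall y \near rho, [/\ derivable (reC f) y (e j), derivable (reC f) y (e i),
    derivable ('D_(e j) (reC f)) y (e i) &
    derivable ('D_(e i) (reC f)) y (e j)].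
  apply: filterS nr => y /regn[d0 d1 d2].
  by split; [exact: (d0 j).1|exact: (d0 i).1|exact: d1.1|exact: d2.1].
have nim : \forall y \near rho, [/\ derivable (imC f) y (e j), derivable (imC f) y (e i),
    derivable ('D_(e j) (imC f)) y (e i) &
    derivable ('D_(e i) (imC f)) y (e j)].
  apply: filterS nr => y /regn[d0 d1 d2].
  by split; [exact: (d0 j).2|exact: (d0 i).2|exact: d1.2|exact: d2.2].
by rewrite /derivC !reC_derivC !imC_derivC (Schwarz nre c1 c3) (Schwarz nim c2 c4).
Qed.

Lemma derivC_sumv (r : seq I) (a : I -> R) f rho : smooth_on e U f -> U rho ->
  derivC (\sum_(i <- r) a i *: e i) f rho = \sum_(i <- r) (a i)%:C * derivC (e i) f rho.
Proof.
move=> fs rho0; have fr := smooth_regular fs.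
have fri i := smooth_regular (smooth_derivC i fs) rho0.
have nr : \forall y \near rho, U y by exact: (open_nbhs_nbhs (conj oU rho0)).
have d1 i : \forall y \near rho, derivable (reC f) y (e i).
  by apply: filterS nr => y y0; have [_ _ d0] := fr y y0; exact: (d0 i).1.
have d2 i : \forall y \near rho, derivable (imC f) y (e i).
  by apply: filterS nr => y y0; have [_ _ d0] := fr y y0; exact: (d0 i).2.
have c1 i : {for rho, continuous ('D_(e i) (reC f))} by have [c _ _] := fri i.
have c2 i : {for rho, continuous ('D_(e i) (imC f))} by have [_ c _] := fri i.
have [_ e1] := is_derive_sumv r a d1 c1; have [_ e2] := is_derive_sumv r a d2 c2.
rewrite {1}/derivC e1 e2; elim: r {e1 e2} => [|i r IH]; first by rewrite !big_nil.
rewrite !big_cons -IH; apply/eqP; rewrite eq_complex; apply/andP.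
by split; apply/eqP; rewrite /derivC /=; ring.
Qed.

End SmoothFunctions.

(** * Complex vector fields on C^(1+n)_+ *)

Section VectorFields.
Variables (R : realType) (n s : nat).
Implicit Types (f g : E R n -> R[i]) (rho : E R n) (v w : TE R n).

Lemma coord_is_derive (j : 'I_2) (k : 'I_n.+1) rho (u : E R n) :
  is_derive rho u (fun x : E R n => x j k) (u j k).
Proof.
have d : derivable (@id (E R n)) rho u by exact: derivable_id.
have dj := (derivable_mxP id rho u).1 d j k.
split; first exact: dj.
by have := derive_mx d; rewrite derive_id => /matrixP /(_ j k); rewrite mxE => <-.
Qed.

Lemma J_continuous : continuous (J s : E R n -> R).
Proof.
move=> rho; apply: differentiable_continuous.
have -> : (J s : E R n -> R) = \sum_(k < n.+1) (nu R s k *: ((fun rho : E R n => rho 0 k) ^+ 2 + (fun rho : E R n => rho 1 k) ^+ 2)).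
  by apply/funext => x; rewrite fct_sumE.
apply: differentiable_sum => k; apply: differentiableZ.
by apply: differentiableD; apply: differentiableX; exact: differentiable_coord.
Qed.

Lemma E_pos_open : open (E_pos s : set (E R n)).
Proof.
have -> : (E_pos s : set (E R n)) = J s @^-1` [set x : R | 0 < x] by [].
by apply: open_comp; [move=> x _; exact: J_continuous|exact: open_gt].
Qed.

Definition coordC (j : 'I_2) (k : 'I_n.+1) : E R n -> R[i] := fun rho => (rho j k)%:C.

Lemma derivC_coordC (u : E R n) j k : derivC u (coordC j k) = fun=> (u j k)%:C.
Proof.
apply/funext => rho; rewrite /derivC; congr Complex.
  by have [_ ->] := coord_is_derive j k rho u.
by rewrite (_ : imC _ = cst 0) // derive_cst.
Qed.

Lemma coordC_smooth j k : smooth_pos s (coordC j k).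
Proof.
apply: smooth_from_regular => [rho _|m _ i]; last by rewrite derivC_coordC; exact: Cn_cst.
split.
- exact: (differentiable_continuous (differentiable_coord _ _ _)).
- exact: cst_continuous.
- move=> i; split; last exact: derivable_cst.
  by have [] := coord_is_derive j k rho (real_basis R i).
Qed.

Definition eq_pos f g := eqon (E_pos s : set (E R n)) f g.

(* Comparing two instances of [act] by unfolding is very costly, hence the
   locked copy [der]. *)
Definition der v f rho : R[i] := locked (@act R n) v f rho.

Lemma derE : der = @act R n.
Proof. by apply/funext => v; apply/funext => f; apply/funext => rho; rewrite /der -lock. Qed.

Lemma der_eq v f g : eq_pos f g -> eq_pos (der v f) (der v g).
Proof.
move=> fg rho rho0; rewrite derE; apply: eq_bigr => i _; congr (_ * _).
exact: (eqon_derivC E_pos_open _ fg).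
Qed.

Lemma der_lin_vec (a : R[i]) v w f rho :
  der (a *: v + w) f rho = a * der v f rho + der w f rho.
Proof.
by rewrite derE /act mulr_sumr -big_split; apply: eq_bigr => i _ /=; rewrite !mxE; ring.
Qed.

Lemma der0v f rho : der 0 f rho = 0.
Proof. by rewrite derE /act big1 // => i _; rewrite mxE mul0r. Qed.

Lemma der_addv v w f rho : der (v + w) f rho = der v f rho + der w f rho.
Proof. by have := der_lin_vec 1 v w f rho; rewrite scale1r mul1r. Qed.

Lemma der_scalev (a : R[i]) v f rho : der (a *: v) f rho = a * der v f rho.
Proof. by have := der_lin_vec a v 0 f rho; rewrite der0v !addr0. Qed.

Lemma der_sumv (T : Type) (r : seq T) (P : pred T) (F : T -> TE R n) f rho :
  der (\sum_(i <- r | P i) F i) f rho = \sum_(i <- r | P i) der (F i) f rho.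
Proof.
by elim/big_rec2: _ => [|i x y _ <-]; rewrite ?der0v ?der_addv.
Qed.

Lemma der_mul v f g rho : smooth_pos s f -> smooth_pos s g -> E_pos s rho ->
  der v (fun x => f x * g x) rho = f rho * der v g rho + der v f rho * g rho.
Proof.
move=> /smooth_regular fs /smooth_regular gs rho0.
rewrite derE /act mulr_sumr mulr_suml -big_split /=; apply: eq_bigr => i _.
by rewrite (regular_derivC_mul i fs gs rho0); ring.
Qed.

Lemma der_lin v (a : R[i]) f g rho : smooth_pos s f -> smooth_pos s g -> E_pos s rho ->
  der v (fun x => a * f x + g x) rho = a * der v f rho + der v g rho.
Proof.
move=> /smooth_regular fs /smooth_regular gs rho0.
rewrite derE /act mulr_sumr -big_split /=; apply: eq_bigr => i _.
by rewrite (regular_derivC_lin i a fs gs rho0); ring.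
Qed.

Lemma der_cst v (a : R[i]) rho : der v (fun=> a) rho = 0.
Proof. by rewrite derE /act big1 // => i _; rewrite derivC_cst mulr0. Qed.

Lemma der_add v f g rho : smooth_pos s f -> smooth_pos s g -> E_pos s rho ->
  der v (fun x => f x + g x) rho = der v f rho + der v g rho.
Proof.
move=> fs gs rho0; have := der_lin v 1 fs gs rho0; rewrite mul1r => <-.
by apply: der_eq => // x _; rewrite mul1r.
Qed.

Lemma der_scale v (a : R[i]) f rho : smooth_pos s f -> E_pos s rho ->
  der v (fun x => a * f x) rho = a * der v f rho.
Proof.
move=> fs rho0; have := der_lin v a fs (smooth_cst _ 0) rho0.
by rewrite der_cst addr0 => <-; apply: der_eq => // x _; rewrite addr0.
Qed.

Lemma der_sum (T : Type) (r : seq T) v (F : T -> E R n -> R[i]) rho :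
  (forall i, smooth_pos s (F i)) -> E_pos s rho ->
  der v (fun x => \sum_(i <- r) F i x) rho = \sum_(i <- r) der v (F i) rho.
Proof.
move=> Fs rho0; elim: r => [|i r IH].
  rewrite big_nil -[RHS](der_cst v 0 rho); apply: der_eq => // x _.
  by rewrite big_nil.
have rs : smooth_pos s (fun x => \sum_(i <- r) F i x).
  by apply: (smooth_sum E_pos_open) => j _; exact: Fs.
rewrite big_cons -IH -(der_add v (Fs i) rs rho0).
by apply: der_eq => // x _; rewrite big_cons.
Qed.

Lemma smooth_der v f : smooth_pos s f -> smooth_pos s (der v f).
Proof.
move=> fs; rewrite derE; apply: (smooth_sum E_pos_open) => i _; apply: (smooth_scale E_pos_open).
exact: smooth_derivC.
Qed.

Lemma der_comm v w f rho : smooth_pos s f -> E_pos s rho ->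
  der v (der w f) rho = der w (der v f) rho.
Proof.
move=> fs rho0.
have key v' w' : der v' (der w' f) rho = \sum_i \sum_j v' i.1 i.2 * w' j.1 j.2 *
    derivC (real_basis R i) (derivC (real_basis R j) f) rho.
  rewrite derE; apply: eq_bigr => i _.
  have fj j : smooth_pos s (fun x => w' j.1 j.2 * derivC (real_basis R j) f x).
    by apply: (smooth_scale E_pos_open); exact: smooth_derivC.
  have unitv g : derivC (real_basis R i) g rho = der (delta_mx i.1 i.2) g rho.
    rewrite derE /act (bigD1 i) //= big1 ?addr0 => [|j ji].
      by rewrite mxE !eqxx mul1r.
    rewrite mxE; case: eqP => [e1|]; last by rewrite mul0r.
    case: eqP => [e2|]; last by rewrite mul0r.
    by case/negP: ji; apply/eqP; case: i j e1 e2 {fj} => ? ? [? ?] /= <- <-.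
  rewrite unitv (der_sum _ _ fj) // mulr_sumr; apply: eq_bigr => j _.
  rewrite (der_scale _ _ (smooth_derivC j fs) rho0).
  by rewrite -unitv mulrA.
rewrite !key exchange_big; apply: eq_bigr => i _; apply: eq_bigr => j _.
by rewrite (derivC_comm E_pos_open i j fs rho0) [v _ _ * _]mulrC.
Qed.

(** [der] is by definition a combination of partial derivatives. For a real vector it is the
    derivative along an actual line, which is how invariance under scaling becomes a differential
    equation. *)
Lemma derivC_real_vec (u : E R n) f rho : smooth_pos s f -> E_pos s rho ->
  derivC u f rho = der (map_mx (fun x => x%:C) u) f rho.
Proof.
move=> fs rho0; rewrite {1}[u]matrix_sum_delta pair_big.
have -> : \sum_p u p.1 p.2 *: delta_mx p.1 p.2 = \sum_i u i.1 i.2 *: real_basis R i by [].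
rewrite (derivC_sumv E_pos_open _ _ fs rho0) derE.
by apply: eq_bigr => i _; rewrite mxE.
Qed.

End VectorFields.

(** * Complex coordinates, types of vectors and the splitting of the tangent space *)

Lemma sum_scale_sub (C : comNzRingType) (W : lmodType C) (I : Type) (r : seq I)
    (c : C) (p q : I -> C) (x y : I -> W) :
  \sum_(k <- r) ((c * p k) *: x k - (c * q k) *: y k) =
  c *: (\sum_(k <- r) p k *: x k - \sum_(k <- r) q k *: y k).
Proof.
rewrite -sumrB scaler_sumr; apply: eq_bigr => k _.
by rewrite scalerBr !scalerA.
Qed.

Lemma ord2_cases (j : 'I_2) : j = 0 \/ j = 1.
Proof. by case: j => -[|[|//]] ?; [left|right]; apply: val_inj. Qed.

Section ComplexCoordinates.
Variables (R : realType) (n s : nat).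
Implicit Types (f g : E R n -> R[i]) (rho : E R n) (v w : TE R n) (b : bool).
Local Notation pos_open := (@E_pos_open R n s).

(* [b = true] selects the holomorphic, [b = false] the antiholomorphic objects *)
Definition sgi b : R[i] := if b then 'i else - 'i.
Definition zc : bool -> 'I_n.+1 -> E R n -> R[i] :=
  locked (fun b k rho => if b then zcoord rho k else (zcoord rho k)^* ).
Definition dzc : bool -> 'I_n.+1 -> TE R n :=
  locked (fun b k => if b then dz R k else dzb R k).

Lemma zc_def b k rho : zc b k rho = if b then zcoord rho k else (zcoord rho k)^*.
Proof. by rewrite /zc -lock. Qed.

Lemma dzc_def b k : dzc b k = if b then dz R k else dzb R k.
Proof. by rewrite /dzc -lock. Qed.

Lemma sgi_sqr b : sgi b * sgi b = - 1.
Proof. by case: b; rewrite /sgi ?mulrNN -expr2 sqrCi. Qed.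

Lemma sgiD : sgi true + sgi false = 0.
Proof. exact: subrr. Qed.

Lemma zcE b k rho : zc b k rho = sgi b * coordC 1 k rho + coordC 0 k rho.
Proof.
rewrite zc_def /sgi /coordC -complexiE; case: b; apply/eqP; rewrite eq_complex /=.
  by apply/andP; split; apply/eqP; ring.
by apply/andP; split; apply/eqP; ring.
Qed.

Lemma dzcE b k : dzc b k = 2^-1 *: (delta_mx 0 k - sgi b *: delta_mx 1 k).
Proof. by case: b; rewrite dzc_def /sgi ?scaleNr ?opprK. Qed.

Lemma zc_smooth b k : smooth_pos s (zc b k).
Proof.
apply: (eqon_smooth pos_open (f := fun rho => sgi b * coordC 1 k rho + coordC 0 k rho)).
  by move=> rho _; rewrite zcE.
apply: (smooth_add pos_open); last exact: coordC_smooth.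
by apply: (smooth_scale pos_open); exact: coordC_smooth.
Qed.

Lemma der_coordC v j k rho : der v (coordC j k) rho = v j k.
Proof.
rewrite derE /act (bigD1 (j, k)) //= big1 => [|i ik]; rewrite derivC_coordC mxE.
  by rewrite !eqxx mulr1 addr0.
case: i ik => a c /=; rewrite xpair_eqE.
by rewrite eq_sym [c == k]eq_sym => /negbTE ->; rewrite mulr0.
Qed.

Lemma der_zc v b k rho : E_pos s rho -> der v (zc b k) rho = sgi b * v 1 k + v 0 k.
Proof.
move=> rho0; transitivity (der v (fun x => sgi b * coordC 1 k x + coordC 0 k x) rho).
  by apply: (der_eq v _ rho0) => x _; rewrite zcE.
by rewrite (der_lin v _ (coordC_smooth 1 k) (coordC_smooth 0 k) rho0) !der_coordC.
Qed.

(** The (1,0)-vectors for [b = true] and the (0,1)-vectors for [b = false]; equivalently the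
    eigenspace of the complex structure for the eigenvalue [sgi b]. *)
Definition vtype b v := forall k, v 1 k = - sgi b * v 0 k.

Lemma der_zc_type v b b' k rho : vtype b v -> E_pos s rho ->
  der v (zc b' k) rho = if b' == b then 2 * v 0 k else 0.
Proof.
move=> vb rho0; rewrite (der_zc _ _ _ rho0) vb.
case: eqP => [->|]; first by rewrite mulrA mulrN sgi_sqr; ring.
case: b b' {vb} => -[] // _; rewrite /sgi mulrA ?mulrNN ?opprK -expr2 sqrCi; ring.
Qed.

Lemma vtype_expand b v : vtype b v -> v = \sum_k (2 * v 0 k) *: dzc b k.
Proof.
move=> vb; apply/matrixP => j k; rewrite summxE (bigD1 k) //= big1 ?addr0 => [|l lk].
  rewrite dzcE !mxE eqxx andbT andbT.
  have [->|j1] := ord2_cases j.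
  - by rewrite !eqxx (_ : (0 == 1 :> 'I_2) = false) //=; field.
  - by rewrite j1 eqxx vb (_ : (1 == 0 :> 'I_2) = false) //=; field.
by rewrite dzcE !mxE [k == l]eq_sym (negbTE lk) !andbF /= !mulr0 subr0 !mulr0.
Qed.

Lemma dzc_vtype b k : vtype b (dzc b k).
Proof.
by move=> l; rewrite dzcE !mxE !eqxx /= mulr0 subr0 sub0r; ring.
Qed.

Lemma vtype_lin b (a : R[i]) v w : vtype b v -> vtype b w -> vtype b (a *: v + w).
Proof. by move=> vb wb k; rewrite !mxE vb wb; ring. Qed.

Lemma vtype0 b : vtype b 0.
Proof. by move=> k; rewrite !mxE mulr0. Qed.

Lemma vtype_scale b (a : R[i]) v : vtype b v -> vtype b (a *: v).
Proof. by move=> vb k; rewrite !mxE vb; ring. Qed.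

Lemma vtype_sum (I : Type) (r : seq I) b (F : I -> TE R n) :
  (forall i, vtype b (F i)) -> vtype b (\sum_(i <- r) F i).
Proof.
move=> Fb; elim: r => [|i r IH]; first by rewrite big_nil; exact: vtype0.
by rewrite big_cons -[F i]scale1r; exact: vtype_lin.
Qed.

Definition euler : bool -> E R n -> TE R n :=
  locked (fun b rho => \sum_k zc b k rho *: dzc b k).

Lemma eulerE b rho : euler b rho = \sum_k zc b k rho *: dzc b k.
Proof. by rewrite /euler -lock. Qed.


Lemma euler_vtype b rho : vtype b (euler b rho).
Proof. by rewrite eulerE; apply: vtype_sum => k; apply: vtype_scale; exact: dzc_vtype. Qed.

Lemma X1_vfE rho : X1_vf rho = euler true rho + euler false rho.
Proof.
rewrite !eulerE; under eq_bigr do rewrite zc_def dzc_def.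
under [X in _ + X]eq_bigr do rewrite zc_def dzc_def; exact: big_split.
Qed.

Lemma Xi_vfE rho : Xi_vf rho = sgi true *: euler true rho + sgi false *: euler false rho.
Proof.
have -> : Xi_vf rho = sgi true *: (euler true rho - euler false rho).
  rewrite !eulerE; under eq_bigr do rewrite zc_def dzc_def.
  under [X in _ - X]eq_bigr do rewrite zc_def dzc_def; exact: sum_scale_sub.
by rewrite scalerBr -scaleNr.
Qed.

Lemma JCE rho : JC s rho = \sum_k (nu R s k)%:C * zc true k rho * zc false k rho.
Proof. by rewrite /JC J_zcoord; apply: eq_bigr => k _; rewrite !zc_def. Qed.

Lemma JC_smooth : smooth_pos s (JC s : E R n -> R[i]).
Proof.
apply: (eqon_smooth pos_open (f := fun rho => \sum_k (nu R s k)%:C * zc true k rho * zc false k rho)).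
  by move=> rho _; rewrite JCE.
apply: (smooth_sum pos_open) => k _; apply: (smooth_mul pos_open); last exact: zc_smooth.
by apply: (smooth_scale pos_open); exact: zc_smooth.
Qed.

Lemma JC_neq0 rho : E_pos s rho -> JC s rho != 0.
Proof.
by rewrite /E_pos /= => rho0; rewrite eq_complex /= eqxx andbT gt_eqF.
Qed.

Lemma der_JC v rho : E_pos s rho ->
  der v (JC s) rho = \sum_k (nu R s k)%:C *
    (zc true k rho * der v (zc false k) rho + der v (zc true k) rho * zc false k rho).
Proof.
move=> rho0; pose F k := fun rho : E R n => (nu R s k)%:C * (zc true k rho * zc false k rho).
have zz k : smooth_pos s (fun rho => zc true k rho * zc false k rho).
  by apply: (smooth_mul pos_open); exact: zc_smooth.
transitivity (der v (fun rho => \sum_k F k rho) rho).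
  by apply: (der_eq v _ rho0) => x _; rewrite JCE; apply: eq_bigr => k _; rewrite /F mulrA.
rewrite (der_sum _ _ _ rho0) => [|k]; last by apply: (smooth_scale pos_open); exact: zz.
apply: eq_bigr => k _; rewrite (der_scale _ _ (zz k) rho0).
by rewrite (der_mul v (zc_smooth true k) (zc_smooth false k) rho0).
Qed.

Lemma der_JC_type v b rho : vtype b v -> E_pos s rho ->
  der v (JC s) rho = \sum_k ((nu R s k)%:C * (2 * v 0 k)) * zc (~~ b) k rho.
Proof.
move=> vb rho0; rewrite (der_JC _ rho0); apply: eq_bigr => k _.
rewrite !(der_zc_type _ _ vb rho0).
by case: b vb => vb /=; ring.
Qed.

(** [J] is linear in the z^k and in their conjugates separately, so two derivatives of the same type
    annihilate it. *)
Lemma der_der_JC v w b rho : vtype b v -> vtype b w -> E_pos s rho ->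
  der w (der v (JC s)) rho = 0.
Proof.
move=> vb wb rho0.
transitivity (der w (fun x => \sum_k ((nu R s k)%:C * (2 * v 0 k)) * zc (~~ b) k x) rho).
  by apply: (der_eq w _ rho0) => x x0; rewrite (der_JC_type vb x0).
rewrite (der_sum _ _ _ rho0) => [|k]; last by apply: (smooth_scale pos_open); exact: zc_smooth.
rewrite big1 // => k _; rewrite (der_scale _ _ (zc_smooth _ k) rho0).
by rewrite (der_zc_type _ _ wb rho0); case: b {vb wb} => /=; rewrite mulr0.
Qed.

Lemma euler0 b rho k : 2 * euler b rho 0 k = zc b k rho.
Proof.
rewrite eulerE summxE (bigD1 k) //= big1 ?addr0 => [|l lk].
  by rewrite dzcE !mxE !eqxx /=; field.
by rewrite dzcE !mxE [k == l]eq_sym (negbTE lk) !andbF /= !mulr0 subr0 !mulr0.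
Qed.

Lemma der_euler_JC b rho : E_pos s rho -> der (euler b rho) (JC s) rho = JC s rho.
Proof.
move=> rho0; rewrite (der_JC_type (euler_vtype b rho) rho0) JCE.
by apply: eq_bigr => k _; rewrite euler0; case: b => /=; ring.
Qed.

Lemma cplx_struct_lin (a : R[i]) v w :
  cplx_struct (a *: v + w) = a *: cplx_struct v + cplx_struct w.
Proof. by apply/matrixP => j k; rewrite !mxE; case: ifP => _; ring. Qed.

Lemma cplx_structD v w : cplx_struct (v + w) = cplx_struct v + cplx_struct w.
Proof. by apply/matrixP => j k; rewrite !mxE; case: ifP => _; ring. Qed.

Lemma cplx_struct_type b v : vtype b v -> cplx_struct v = sgi b *: v.
Proof.
move=> vb; apply/matrixP => j k; rewrite !mxE; case: eqP => [->|j0].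
  by rewrite vb mulNr opprK.
have [//|->] := ord2_cases j.
by rewrite vb mulrA mulrN sgi_sqr opprK mul1r.
Qed.

Lemma der_X1_JC rho : E_pos s rho -> der (X1_vf rho) (JC s) rho = 2 * JC s rho.
Proof.
move=> rho0. rewrite X1_vfE. rewrite der_addv. rewrite (der_euler_JC true rho0). rewrite (der_euler_JC false rho0).
by rewrite mulr_natl.
Qed.

Lemma der_Xi_JC rho : E_pos s rho -> der (Xi_vf rho) (JC s) rho = 0.
Proof.
move=> rho0. rewrite Xi_vfE. rewrite der_addv. rewrite !der_scalev. rewrite (der_euler_JC true rho0) (der_euler_JC false rho0).
by rewrite -mulrDl sgiD mul0r.
Qed.

Lemma cplx_struct_X1 rho : cplx_struct (X1_vf rho) = Xi_vf rho.
Proof.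
rewrite X1_vfE. rewrite Xi_vfE. rewrite cplx_structD.
by rewrite (cplx_struct_type (euler_vtype true rho)) (cplx_struct_type (euler_vtype false rho)).
Qed.

Lemma cplx_struct_Xi rho : cplx_struct (Xi_vf rho) = - X1_vf rho.
Proof.
rewrite X1_vfE. rewrite Xi_vfE. rewrite cplx_structD.
rewrite (cplx_struct_type (vtype_scale _ (euler_vtype true rho))).
rewrite (cplx_struct_type (vtype_scale _ (euler_vtype false rho))).
by rewrite !scalerA !sgi_sqr !scaleN1r opprD.
Qed.

Lemma euler_X b rho : euler b rho = 2^-1 *: (X1_vf rho - sgi b *: Xi_vf rho).
Proof.
rewrite X1_vfE Xi_vfE; apply/matrixP => j k; rewrite !mxE.
have sf : sgi false = - sgi true by [].
set p := euler true rho j k; set q := euler false rho j k.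
have i2 := sgi_sqr true; case: b; rewrite ?sf -/p -/q.
  transitivity (2^-1 * (p + q - (sgi true * sgi true) * (p - q))); last by ring.
  by rewrite i2; field.
transitivity (2^-1 * (p + q + (sgi true * sgi true) * (p - q))); last by ring.
by rewrite i2; field.
Qed.

(** The derivatives of [J] along [v] and along [cplx_struct v] read off the two coefficients,
    because the complex structure maps [X1_vf] to [Xi_vf] and [Xi_vf] to [- X1_vf], while [J] has
    derivative 2J along [X1_vf] and 0 along [Xi_vf]. This is the uniqueness needed to evaluate the
    choice [xget] in [Theta]. *)
Lemma XiSpace_coefs rho v w (x y : R[i]) : E_pos s rho -> in_XiSpace s rho w ->
  v = x *: X1_vf rho + y *: Xi_vf rho + w ->
  x = (2 * JC s rho)^-1 * der v (JC s) rho /\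
  y = - (2 * JC s rho)^-1 * der (cplx_struct v) (JC s) rho.
Proof.
move=> rho0; rewrite /in_XiSpace -derE => -[w1 w2] ->.
have J0 := JC_neq0 rho0; have J2 : 2 * JC s rho != 0 by rewrite mulf_neq0 // pnatr_eq0.
rewrite -[X in cplx_struct X]addrA !cplx_struct_lin cplx_struct_X1 cplx_struct_Xi -[- X1_vf rho]scaleN1r.
rewrite !der_addv !der_scalev der_X1_JC // der_Xi_JC // w1 w2.
by split; field.
Qed.

(** A vector of type [b] is an eigenvector of the complex structure, so both conditions of
    [in_XiSpace] say that it annihilates [J]. As [J] has derivative [J] along [euler b], subtracting
    a multiple of that field achieves this without leaving the type. *)
Lemma Theta_type b v rho : vtype b v -> E_pos s rho ->
  Theta s rho v = v - (der v (JC s) rho / JC s rho) *: euler b rho.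
Proof.
move=> vb rho0; have J0 := JC_neq0 rho0; apply: xget_unique.
  set w := v - _; have wE : w = (- (der v (JC s) rho / JC s rho)) *: euler b rho + v.
    by rewrite scaleNr addrC.
  have wb : vtype b w by rewrite wE; apply: vtype_lin => //; exact: euler_vtype.
  have wJ : der w (JC s) rho = 0.
    by rewrite wE der_lin_vec (der_euler_JC b rho0) mulNr divfK // addNr.
  split; first by rewrite /in_XiSpace -derE (cplx_struct_type wb) der_scalev wJ mulr0.
  pose c := der v (JC s) rho / JC s rho.
  (* The coefficients come from [euler_X], which writes [euler b] through [X1_vf] and [Xi_vf]. *)
  exists (2^-1 * c); exists (- (2^-1 * c * sgi b)).
  suff <- : c *: euler b rho = (2^-1 * c) *: X1_vf rho + (- (2^-1 * c * sgi b)) *: Xi_vf rho.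
    by rewrite /w -/c addrC subrK.
  by rewrite euler_X !scalerBr !scalerA scaleNr [c * 2^-1]mulrC.
move=> w [wXi [x [y vE]]].
have [xE yE] := XiSpace_coefs rho0 wXi vE.
have -> : w = v - (x *: X1_vf rho + y *: Xi_vf rho) by rewrite vE addrC addKr.
rewrite xE yE (cplx_struct_type vb) der_scalev euler_X; congr (_ - _).
rewrite scalerA scalerBr scalerA -scaleNr; congr (_ *: _ + _ *: _); last by field.
by field.
Qed.

(** J^(-1/2), the factor that normalizes a point to Z. Its square serves as a form of 1/J whose
    smoothness passes to all powers. *)
Definition rJ rho : R[i] := ((Num.sqrt (J s rho))^-1)%:C.

Lemma rJ_sqr rho : E_pos s rho -> rJ rho ^+ 2 * JC s rho = 1.
Proof.
rewrite /E_pos /= => rho0; rewrite /rJ /JC -rmorphXn -rmorphM exprVn sqr_sqrtr ?ltW //.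
by rewrite mulVf ?gt_eqF.
Qed.

(** The derivative is a polynomial in [rJ] times a derivative of [J], the closed form required by
    the bootstrap [smooth_from_regular]. *)
Lemma derivC_rJ i : eq_pos s (derivC (real_basis R i) rJ)
  (fun rho => (- 2^-1) * (rJ rho * (rJ rho * rJ rho)) * derivC (real_basis R i) (JC s) rho).
Proof.
move=> rho rho0; have [_ _ /(_ i)[d1 _]] := smooth_regular JC_smooth rho0.
have [_ e1] := is_derive_rsqrt rho0 (derivableP d1).
pose D := 'D_(real_basis R i) (reC (JC s)) rho; rewrite -/D in e1.
have -> : derivC (real_basis R i) (JC s) rho = D%:C.
  by rewrite /derivC (_ : imC (JC s) = cst 0) // derive_cst.
rewrite /derivC (_ : imC rJ = cst 0) // derive_cst (_ : reC rJ = fun y => (Num.sqrt (J s y))^-1) //.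
rewrite e1 /rJ; move: (Num.sqrt _)^-1 D {e1} => a D.
transitivity ((- 2^-1 * a ^+ 3 * D)%:C) => //.
rewrite !exprS expr0 mulr1 !rmorphM rmorphN fmorphV rmorph_nat.
by [].
Qed.

Lemma rJ_smooth : smooth_pos s rJ.
Proof.
apply: smooth_from_regular => [rho rho0|k rk i].
  have [c1 _ dJ1] := smooth_regular JC_smooth rho0; split.
  - exact: (continuous_rsqrt rho0 c1).
  - exact: cst_continuous.
  - move=> i; split; last exact: derivable_cst.
    by have [] := is_derive_rsqrt rho0 (derivableP (dJ1 i).1).
apply: (eqon_Cn pos_open (f := fun rho => (- 2^-1) * (rJ rho * (rJ rho * rJ rho)) * derivC (real_basis R i) (JC s) rho)).
  by move=> rho rho0; rewrite derivC_rJ.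
apply: (Cn_mul pos_open).
  apply: (Cn_mul pos_open); first exact: Cn_cst.
  by apply: (Cn_mul pos_open) => //; apply: (Cn_mul pos_open).
exact: ((smooth_onP _ _ _).1 (smooth_derivC i JC_smooth) k).
Qed.

Lemma der_rJ v rho : E_pos s rho ->
  der v rJ rho = (- 2^-1) * rJ rho ^+ 3 * der v (JC s) rho.
Proof.
move=> rho0; rewrite derE /act mulr_sumr; apply: eq_bigr => i _.
by rewrite derivC_rJ // !exprS expr0 mulr1; ring.
Qed.

End ComplexCoordinates.

(** * Iterated derivatives and the symmetrized derivative *)

Section IteratedDerivatives.
Variables (R : realType) (n s : nat).
Implicit Types (f g : E R n -> R[i]) (rho : E R n) (v w : TE R n) (vs ws us : seq (TE R n)).
Local Notation pos_open := (@E_pos_open R n s).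

Definition ders vs f : E R n -> R[i] := foldr (@der R n) f vs.

Lemma ders_cons v vs f : ders (v :: vs) f = der v (ders vs f).
Proof. by []. Qed.

Lemma ders_cat vs ws f : ders (vs ++ ws) f = ders vs (ders ws f).
Proof. exact: foldr_cat. Qed.

Lemma ders_rcons vs v f : ders (rcons vs v) f = ders vs (der v f).
Proof. exact: foldr_rcons. Qed.

Lemma smooth_ders vs f : smooth_pos s f -> smooth_pos s (ders vs f).
Proof. by move=> fs; elim: vs => [|v vs IH]; [exact: fs|exact: (smooth_der v IH)]. Qed.

Lemma ders_eq vs f g : eq_pos s f g -> eq_pos s (ders vs f) (ders vs g).
Proof. by move=> fg; elim: vs => [|v vs IH]; [exact: fg|exact: (der_eq v IH)]. Qed.

Lemma ders_lin vs (a : R[i]) f g : smooth_pos s f -> smooth_pos s g ->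
  eq_pos s (ders vs (fun x => a * f x + g x)) (fun x => a * ders vs f x + ders vs g x).
Proof.
move=> fs gs; elim: vs => [//|v vs IH] rho rho0; rewrite !ders_cons (der_eq v IH rho0).
exact: (der_lin v a (smooth_ders vs fs) (smooth_ders vs gs) rho0).
Qed.

Lemma ders_cst0 vs rho : E_pos s rho -> ders vs (fun=> 0) rho = 0.
Proof.
elim: vs rho => [//|v vs IH] rho rho0; rewrite ders_cons -[RHS](der_cst v 0 rho).
by apply: (der_eq v _ rho0) => x; exact: IH.
Qed.

Lemma ders_add vs f g : smooth_pos s f -> smooth_pos s g ->
  eq_pos s (ders vs (fun x => f x + g x)) (fun x => ders vs f x + ders vs g x).
Proof.
move=> fs gs rho rho0; rewrite -[ders vs f rho]mul1r -(ders_lin _ _ fs gs rho0).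
by apply: (ders_eq _ _ rho0) => x _; rewrite mul1r.
Qed.

Lemma ders_sum (I : Type) (r : seq I) vs (F : I -> E R n -> R[i]) :
  (forall i, smooth_pos s (F i)) ->
  eq_pos s (ders vs (fun x => \sum_(i <- r) F i x)) (fun x => \sum_(i <- r) ders vs (F i) x).
Proof.
move=> Fs; elim: r => [|i r IH] rho rho0.
  rewrite big_nil -[RHS](ders_cst0 vs rho0); apply: (ders_eq _ _ rho0) => x _.
  by rewrite big_nil.
have rs : smooth_pos s (fun x => \sum_(i <- r) F i x).
  by apply: (smooth_sum pos_open) => j _; exact: Fs.
rewrite big_cons -IH // -(ders_add vs (Fs i) rs rho0).
by apply: (ders_eq _ _ rho0) => x _; rewrite big_cons.
Qed.

Lemma ders_move vs v ws f : smooth_pos s f ->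
  eq_pos s (ders (vs ++ v :: ws) f) (ders (v :: vs ++ ws) f).
Proof.
move=> fs; elim: vs => [//|w vs IH] rho rho0; rewrite cat_cons ders_cons (der_eq w IH rho0).
exact: (der_comm w v (smooth_ders (vs ++ ws) fs) rho0).
Qed.

Lemma ders_perm vs ws f : smooth_pos s f -> perm_eq vs ws ->
  eq_pos s (ders vs f) (ders ws f).
Proof.
move=> fs; elim: vs ws => [|v vs IH] ws pvw.
  by move: pvw; rewrite perm_sym => /perm_nilP ->.
have vws : v \in ws by rewrite -(perm_mem pvw) mem_head.
case/splitPr: vws pvw => w1 w2 pvw.
have {}pvw : perm_eq vs (w1 ++ w2).
  by rewrite -(perm_cons v); apply: perm_trans pvw _; rewrite -cat_rcons -cats1 -catA perm_catCA.
move=> rho rho0; rewrite (ders_move _ _ _ fs rho0).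
exact: (der_eq v (IH _ pvw) rho0).
Qed.

Lemma ders_slot_lin vs (a : R[i]) v w us f : smooth_pos s f ->
  eq_pos s (ders (vs ++ (a *: v + w) :: us) f)
    (fun x => a * ders (vs ++ v :: us) f x + ders (vs ++ w :: us) f x).
Proof.
move=> fs rho rho0; rewrite !ders_cat /=.
have us_s := smooth_ders us fs.
rewrite -(ders_lin vs a (smooth_der v us_s) (smooth_der w us_s) rho0).
by apply: (ders_eq _ _ rho0) => x _; rewrite der_lin_vec.
Qed.

Lemma ders_slot0 vs us f rho : E_pos s rho -> ders (vs ++ 0 :: us) f rho = 0.
Proof.
move=> rho0; rewrite ders_cat -[RHS](ders_cst0 vs rho0) /=.
by apply: (ders_eq _ _ rho0) => x _; rewrite der0v.
Qed.

Lemma ders_slot_sum (I : Type) (r : seq I) vs (a : I -> R[i]) (d : I -> TE R n) us f :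
  smooth_pos s f -> eq_pos s (ders (vs ++ (\sum_(i <- r) a i *: d i) :: us) f)
    (fun x => \sum_(i <- r) a i * ders (vs ++ d i :: us) f x).
Proof.
move=> fs rho rho0; elim: r => [|i r IH]; first by rewrite !big_nil ders_slot0.
by rewrite !big_cons (ders_slot_lin _ _ _ _ _ fs rho0) IH.
Qed.

(** The sum over the basis one-forms collapses to a single derivative in the direction that the
    permutation puts into the first slot. *)
Lemma DsymE k (omega : E R n -> ('I_k -> TE R n) -> R[i]) rho (v : 'I_k.+1 -> TE R n) :
  Dsym omega rho v = (k.+1`!%:R)^-1 * \sum_(sigma : 'S_k.+1)
    der (v (sigma ord0)) (fun rho' => omega rho' (fun j => v (sigma (lift ord0 j)))) rho.
Proof.
have l0 : lshift k (0 : 'I_1) = (ord0 : 'I_(1 + k)) by apply: val_inj.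
have r1 (j : 'I_k) : rshift 1 j = (lift ord0 j : 'I_(1 + k)) by apply: val_inj.
rewrite /Dsym /vee /Defs.Sym -mulr_sumr exchange_big /=; congr (_ * _).
apply: eq_bigr => sigma _; rewrite derE; apply: eq_bigr => i _.
rewrite /tensor_prod /dx /nabla l0; congr (_ * _).
congr derivC; apply/funext => x; congr (omega x _).
by apply/funext => j; rewrite r1.
Qed.

Lemma perm_map_perm k (T : eqType) (v : 'I_k -> T) (sigma : 'S_k) :
  perm_eq [seq v (sigma i) | i <- enum 'I_k] [seq v i | i <- enum 'I_k].
Proof.
rewrite map_comp; apply: perm_map; apply: uniq_perm; rewrite ?enum_uniq //.
  by rewrite map_inj_uniq ?enum_uniq //; exact: perm_inj.
move=> i; rewrite mem_enum; apply/mapP; exists (sigma^-1%g i); rewrite ?mem_enum //.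
by rewrite permKV.
Qed.

Lemma sum_perm_const k (c : R[i]) : (k`!%:R)^-1 * (\sum_(sigma : 'S_k) c) = c.
Proof.
rewrite sumr_const card_Sn -[c *+ _]mulr_natl mulKf // pnatr_eq0 -lt0n; exact: fact_gt0.
Qed.

(** Constant vector fields commute, so once every summand of the symmetrization is an iterated
    derivative, all summands are equal and averaging has no effect. *)
Lemma Dsym_ders k (omega : E R n -> ('I_k -> TE R n) -> R[i]) f rho (v : 'I_k.+1 -> TE R n) :
  smooth_pos s f -> E_pos s rho ->
  (forall sigma : 'S_k.+1,
    der (v (sigma ord0)) (fun rho' => omega rho' (fun j => v (sigma (lift ord0 j)))) rho =
    ders [seq v (sigma i) | i <- enum 'I_k.+1] f rho) ->
  Dsym omega rho v = ders [seq v i | i <- enum 'I_k.+1] f rho.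
Proof.
move=> fs rho0 H; rewrite DsymE -[RHS](sum_perm_const k.+1); congr (_ * _).
apply: eq_bigr => sigma _; rewrite H.
by apply: (ders_perm fs _ rho0); exact: perm_map_perm.
Qed.

Lemma map_enum_ordS (T : Type) k (v : 'I_k.+1 -> T) :
  [seq v i | i <- enum 'I_k.+1] = v ord0 :: [seq v (lift ord0 j) | j <- enum 'I_k].
Proof. by rewrite enum_ordSl /= -map_comp. Qed.

Lemma Dsym_iterE r f rho (v : 'I_r -> TE R n) : smooth_pos s f -> E_pos s rho ->
  Dsym_iter r f rho v = ders [seq v i | i <- enum 'I_r] f rho.
Proof.
move=> fs; elim: r rho v => [|r IH] rho v rho0.
  by rewrite (_ : enum 'I_0 = [::]) //; apply: size0nil; rewrite size_enum_ord.
apply: Dsym_ders => // sigma; rewrite map_enum_ordS ders_cons.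
by apply: (der_eq _ _ rho0) => x x0; exact: IH.
Qed.

End IteratedDerivatives.

(** * Horizontal vectors and functions vanishing along them to every order *)

Section Horizontal.
Variables (R : realType) (n s : nat) (b : bool) (rho : E R n).
Hypothesis rho0 : E_pos s rho.
Implicit Types (f g : E R n -> R[i]) (v w : TE R n) (vs ws us : seq (TE R n)).
Local Notation pos_open := (@E_pos_open R n s).

Definition horizontal v := vtype b v /\ der v (JC s) rho = 0.

(* an ideal of the smooth functions; working modulo it replaces differentiation
   of the [rho]-dependent projection [Theta] by a congruence *)
Definition hnull f :=
  forall ws, (forall w, w \in ws -> horizontal w) -> ders ws f rho = 0.

Lemma horizontal_rcons ws w : (forall u, u \in rcons ws w -> horizontal u) ->
  horizontal w /\ (forall u, u \in ws -> horizontal u).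
Proof.
move=> H; split; first by apply: H; rewrite mem_rcons mem_head.
by move=> u uw; apply: H; rewrite mem_rcons inE uw orbT.
Qed.

Lemma hnull_eq f g : eq_pos s f g -> hnull f -> hnull g.
Proof. by move=> fg f0 ws hw; rewrite -(ders_eq ws fg rho0) f0. Qed.

Lemma hnull0 : hnull (fun=> 0).
Proof. by move=> ws _; exact: (ders_cst0 ws rho0). Qed.

Lemma hnull_add f g : smooth_pos s f -> smooth_pos s g -> hnull f -> hnull g ->
  hnull (fun x => f x + g x).
Proof. by move=> fs gs f0 g0 ws hw; rewrite (ders_add _ fs gs rho0) f0 // g0 // addr0. Qed.

Lemma hnull_der f w : horizontal w -> hnull f -> hnull (der w f).
Proof.
move=> hw f0 ws hws; rewrite -ders_rcons f0 // => u.
by rewrite mem_rcons inE => /orP[/eqP -> //|]; exact: hws.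
Qed.

(** Induction on the word: Leibniz applied to the innermost derivative leaves two products, each
    with a factor [f] or [der w f] that vanishes to every order. *)
Lemma hnull_mul f g : smooth_pos s f -> smooth_pos s g -> hnull f ->
  hnull (fun x => f x * g x).
Proof.
move=> fs gs f0 ws; elim/last_ind: ws f g fs gs f0 => [|ws w IH] f g fs gs f0 hws.
  by have /= -> := f0 [::] hws; rewrite mul0r.
have [hw {}hws] := horizontal_rcons hws; rewrite ders_rcons.
have E : eq_pos s (der w (fun x => f x * g x)) (fun x => f x * der w g x + der w f x * g x).
  by move=> x x0; exact: (der_mul w fs gs x0).
rewrite (ders_eq ws E rho0).
have [dfs dgs] : smooth_pos s (der w f) /\ smooth_pos s (der w g).
  by split; [exact: (smooth_der w fs)|exact: (smooth_der w gs)].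
rewrite (ders_add _ (smooth_mul pos_open fs dgs) (smooth_mul pos_open dfs gs) rho0).
rewrite (IH f _ fs dgs f0 hws) (IH _ g dfs gs _ hws) ?addr0 //.
exact: hnull_der.
Qed.

Lemma hnull_sum (I : Type) (r : seq I) (F : I -> E R n -> R[i]) :
  (forall i, smooth_pos s (F i)) -> (forall i, hnull (F i)) ->
  hnull (fun x => \sum_(i <- r) F i x).
Proof.
move=> Fs F0 ws hws; rewrite (ders_sum _ _ Fs rho0) big1 // => i _; exact: F0.
Qed.

Lemma hnull_intro f : f rho = 0 -> (forall w, horizontal w -> hnull (der w f)) -> hnull f.
Proof.
move=> f0 fD ws; elim/last_ind: ws => // ws w _ /horizontal_rcons[hw hws].
by rewrite ders_rcons fD.
Qed.

(** The value vanishes by horizontality, and every further derivative of the same type vanishes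
    identically by [der_der_JC]. *)
Lemma hnull_der_JC v : horizontal v -> hnull (der v (JC s)).
Proof.
move=> [vb v0]; apply: hnull_intro => // w [wb _].
by apply: hnull_eq hnull0 => x x0; rewrite (der_der_JC vb wb x0).
Qed.

(** A horizontal derivative of [rJ] is a smooth multiple of [der w (JC s)], so to every order [rJ]
    looks constant in horizontal directions. *)
Lemma hnull_rJ : hnull (fun x => rJ s x - rJ s rho).
Proof.
have rs := @rJ_smooth R n s.
apply: hnull_intro => [|w hw]; first by rewrite subrr.
apply: (hnull_eq (f := fun x => der w (JC s) x * (- 2^-1 * rJ s x ^+ 3))).
  move=> x x0; have := der_lin w 1 rs (smooth_cst _ (- rJ s rho)) x0.
  rewrite der_cst mul1r addr0 der_rJ // => E0.
  rewrite mulrC -E0; apply: (der_eq w _ x0) => y _; by rewrite mul1r.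
apply: hnull_mul (hnull_der_JC hw).
  exact: smooth_der (@JC_smooth R n s).
by apply: (smooth_scale pos_open); apply: (smooth_exp pos_open).
Qed.

Definition hcong f g := hnull (fun x => f x - g x).

Lemma hcong_ders f g ws : smooth_pos s f -> smooth_pos s g -> hcong f g ->
  (forall w, w \in ws -> horizontal w) -> ders ws f rho = ders ws g rho.
Proof.
move=> fs gs fg hws; apply/eqP; rewrite -subr_eq0 -mulN1r addrC; apply/eqP.
rewrite -(ders_lin ws (-1) gs fs rho0) -[RHS](fg ws hws).
by apply: (ders_eq ws _ rho0) => x _; rewrite mulN1r addrC.
Qed.

End Horizontal.

(** * Invariant functions and Euler's relation *)

Lemma derive_near_cst (R : realType) (V : normedModType R) (F : V -> R) (x u : V) :
  (\forall h \near (0 : R), F (h *: u + x) = F x) -> 'D_u F x = 0.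
Proof.
move=> H; rewrite /derive; apply: (@cvg_lim _ _ _ (0^')%classic) => //.
apply: cvg_near_cst; apply: cvg_within; apply: filterS H => h /= ->.
by rewrite subrr scaler0.
Qed.

Section Invariance.
Variables (R : realType) (n s : nat).
Implicit Types (f g : E R n -> R[i]) (rho : E R n) (v w : TE R n) (vs ws us : seq (TE R n)).
Local Notation pos_open := (@E_pos_open R n s).

Lemma zcoord_scale (a : R) rho k : zcoord (a *: rho) k = a%:C * zcoord rho k.
Proof. by rewrite /zcoord !mxE; apply/eqP; rewrite eq_complex /= !mul0r subr0 addr0 !eqxx. Qed.

Lemma J_cscale (a b : R) rho : J s (Defs.cscale (a +i* b) rho) = (a ^+ 2 + b ^+ 2) * J s rho.
Proof.
rewrite /J mulr_sumr; apply: eq_bigr => k _; rewrite !mxE /=; ring.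
Qed.

(** Since [Pr] normalizes the modulus, scaling by a nonzero complex u changes the representative
    only by the phase u/|u|. *)
Lemma Pr_cscale (a b : R) (x y : Cplus R n s) :
  val y = Defs.cscale (a +i* b) (val x) -> Pr y = Pr x.
Proof.
move=> yE; apply/eqmodP; rewrite /= U1_sym; apply/asboolP => /=.
have y0 : 0 < J s (val y) := valP y; have x0 : 0 < J s (val x) := valP x.
have N0 : 0 < a ^+ 2 + b ^+ 2.
  by move: y0; rewrite yE J_cscale pmulr_lgt0.
exists ((a +i* b) * ((Num.sqrt (a ^+ 2 + b ^+ 2))^-1)%:C).
  have q0 : 0 < Num.sqrt (a ^+ 2 + b ^+ 2) by rewrite sqrtr_gt0.
  rewrite normrM normc_def /= ger0_norm; last by rewrite lecR invr_ge0 ltW.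
  by rewrite -rmorphM mulfV ?gt_eqF.
apply: zcoord_inj => k; rewrite zcoord_cscale !zcoord_scale yE zcoord_cscale J_cscale.
rewrite sqrtrM ?ltW // invfM rmorphM; set p := (_^-1)%:C; set q := (_^-1)%:C; ring.
Qed.

Lemma E_pos_cscale (a b : R) rho : a ^+ 2 + b ^+ 2 != 0 -> E_pos s rho ->
  E_pos s (Defs.cscale (a +i* b) rho).
Proof.
move=> ab; rewrite /E_pos /= J_cscale => r0; apply: mulr_gt0 => //.
by rewrite lt0r ab addr_ge0 // sqr_ge0.
Qed.

Lemma pullback_pos (f : Mred R n s -> R[i]) rho (r0 : E_pos s rho) :
  pullback f rho = f (Pr (exist _ rho r0 : Cplus R n s)).
Proof. exact: (pullbackE f (exist _ rho r0)). Qed.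

Lemma pullback_cscale (f : Mred R n s -> R[i]) (a b : R) rho :
  a ^+ 2 + b ^+ 2 != 0 -> E_pos s rho ->
  pullback f (Defs.cscale (a +i* b) rho) = pullback f rho.
Proof.
move=> ab r0; rewrite (pullback_pos f r0) (pullback_pos f (E_pos_cscale ab r0)).
by rewrite (@Pr_cscale a b (exist _ rho r0)).
Qed.

Lemma pullback_invariant (f : Mred R n s -> R[i]) : U1_invariant s (pullback f).
Proof.
move=> [a b] rho ab r0; apply: pullback_cscale => //.
apply/eqP => ab0; move: ab; rewrite normc_def /= ab0 sqrtr0 => /eqP.
by rewrite eq_sym oner_eq0.
Qed.

(** The line through [rho] in the direction u [rho] consists of the multiples 1 + hu of [rho]; these
    factors are nonzero for small h, and a pullback is constant there. *)
Lemma derivC_pullback (f : Mred R n s -> R[i]) (a b : R) rho : E_pos s rho ->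
  derivC (Defs.cscale (a +i* b) rho) (pullback f) rho = 0.
Proof.
move=> r0; have lineE (h : R) : h *: Defs.cscale (a +i* b) rho + rho =
    Defs.cscale ((1 + h * a) +i* (h * b)) rho.
  by apply/matrixP => j k; rewrite !mxE; case: (ord2_cases j) => -> /=; ring.
have H : \forall h \near (0 : R), pullback f (h *: Defs.cscale (a +i* b) rho + rho) = pullback f rho.
  near=> h; rewrite lineE pullback_cscale //.
  have ha : `|h * a| < 1.
    rewrite normrM; apply: (@le_lt_trans _ _ (`|h| * (`|a| + 1))).
      by rewrite ler_wpM2l // lerDl.
    rewrite -ltr_pdivlMr ?ltr_wpDl //; near: h; apply: nbhs0_lt.
  rewrite gt_eqF // ltr_wpDr ?sqr_ge0 // exprn_gt0 //.
  by move: ha; rewrite ltr_norml => /andP[]; rewrite -subr_gt0 opprK addrC.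
have Hr : \forall h \near (0 : R), reC (pullback f) (h *: Defs.cscale (a +i* b) rho + rho) = reC (pullback f) rho.
  by move: H; apply: filterS => h; rewrite /reC => ->.
have Hi : \forall h \near (0 : R), imC (pullback f) (h *: Defs.cscale (a +i* b) rho + rho) = imC (pullback f) rho.
  by move: H; apply: filterS => h; rewrite /imC => ->.
by rewrite /derivC (derive_near_cst Hr) (derive_near_cst Hi).
Unshelve. all: by end_near. Qed.

Lemma euler1 b rho k : euler b rho 1 k = - sgi R b * (2^-1 * zc b k rho).
Proof. by rewrite (euler_vtype b rho) -(euler0 b rho) mulKf // pnatr_eq0. Qed.

Lemma euler0' b rho k : euler b rho 0 k = 2^-1 * zc b k rho.
Proof. by rewrite -(euler0 b rho) mulKf // pnatr_eq0. Qed.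

Lemma X1_vf_real rho : X1_vf rho = map_mx (fun x => x%:C) (Defs.cscale (1 +i* 0) rho).
Proof.
have sf : sgi R false = - sgi R true by [].
have i2 := sgi_sqr R true.
apply/matrixP => j k; rewrite X1_vfE; case: (ord2_cases j) => ->; rewrite mxE.
  rewrite !euler0' !zcE sf; move: (sgi R true) i2 => i i2.
  by rewrite /coordC !mxE /= mul1r mul0r subr0; field.
rewrite !euler1 !zcE sf; move: (sgi R true) i2 => i i2.
rewrite /coordC !mxE /= mul1r mul0r addr0; set x := (rho 0 k)%:C; set y := (rho 1 k)%:C.
by transitivity (- (i * i) * y); [field|rewrite i2 opprK mul1r].
Qed.

Lemma Xi_vf_real rho : Xi_vf rho = map_mx (fun x => x%:C) (Defs.cscale (0 +i* 1) rho).
Proof.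
have sf : sgi R false = - sgi R true by [].
have i2 := sgi_sqr R true.
apply/matrixP => j k; rewrite Xi_vfE; case: (ord2_cases j) => ->; rewrite !mxE.
  rewrite !euler0' !zcE sf; move: (sgi R true) i2 => i i2.
  rewrite /coordC /= mul1r mul0r sub0r rmorphN.
  set x := (rho 0 k)%:C; set y := (rho 1 k)%:C.
  by transitivity ((i * i) * y); [field|rewrite i2 mulN1r].
rewrite !euler1 !zcE sf; move: (sgi R true) i2 => i i2.
rewrite /coordC /= mul1r mul0r add0r; set x := (rho 0 k)%:C; set y := (rho 1 k)%:C.
by transitivity (- (i * i) * x); [field|rewrite i2 opprK mul1r].
Qed.

(** The infinitesimal form of invariance under complex scaling. The comparison of the Wick and the
    horizontal pairings assumes only this and smoothness. *)
Definition euler_invariant f := forall b rho, E_pos s rho -> der (euler b rho) f rho = 0.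

Lemma pullback_euler (f : Cinf_red R n s) : euler_invariant (pullback f).
Proof.
move=> b rho r0; have fs := Cinf_smooth f.
rewrite euler_X der_scalev -[- (_ *: _)]scaleNr addrC der_lin_vec.
rewrite X1_vf_real Xi_vf_real -!(derivC_real_vec _ fs r0) !(derivC_pullback f _ _ r0).
by rewrite mulr0 addr0 mulr0.
Qed.

Lemma der_eulerE b g rho : der (euler b rho) g rho = \sum_k zc b k rho * der (dzc R b k) g rho.
Proof. by rewrite eulerE der_sumv; apply: eq_bigr => k _; rewrite der_scalev. Qed.

Lemma der_vtypeE b v g rho : vtype b v ->
  der v g rho = \sum_k (2 * v 0 k) * der (dzc R b k) g rho.
Proof.
by move=> /vtype_expand {1}->; rewrite der_sumv; apply: eq_bigr => k _; rewrite der_scalev.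
Qed.

(** The commutator of [euler b'] with a constant vector [v] of type [b] is [- v] if the types agree
    and 0 otherwise, so each derivative lowers the degree of its own type by one. *)
Lemma euler_ders f b b' vs rho : smooth_pos s f -> euler_invariant f ->
  (forall v, v \in vs -> vtype b v) -> E_pos s rho ->
  der (euler b' rho) (ders vs f) rho = - ((b' == b) * size vs)%N%:R * ders vs f rho.
Proof.
move=> fs fI; elim: vs rho => [|v vs IH] rho vsb r0.
  by rewrite muln0 mulr0n oppr0 mul0r; exact: fI.
have vb : vtype b v by apply: vsb; rewrite mem_head.
have {}IH x : E_pos s x -> der (euler b' x) (ders vs f) x = - ((b' == b) * size vs)%N%:R * ders vs f x.
  by apply: IH => w wvs; apply: vsb; rewrite inE wvs orbT.
rewrite ders_cons; set g := ders vs f in IH *.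
have gs : smooth_pos s g by exact: smooth_ders.
have dgs k : smooth_pos s (der (dzc R b' k) g) by exact: smooth_der.
pose F k := fun x : E R n => zc b' k x * der (dzc R b' k) g x.
have Fs k : smooth_pos s (F k) := smooth_mul pos_open (zc_smooth b' k) (dgs k).
(* The relation for [g] is differentiated along [v]; the product rule then also hits the
   coefficients of the Euler field, which supplies the extra term [der v g]. *)
have E1 : der v (fun x => \sum_k F k x) rho = - ((b' == b) * size vs)%N%:R * der v g rho.
  rewrite -(der_scale v _ gs r0); apply: (der_eq v _ r0) => x x0.
  by rewrite -(IH x x0) der_eulerE.
rewrite (der_sum _ _ Fs r0) in E1.
have E2 k : der v (F k) rho = zc b' k rho * der (dzc R b' k) (der v g) rho +
    (if b' == b then 2 * v 0 k else 0) * der (dzc R b' k) g rho.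
  rewrite /F (der_mul v (zc_smooth b' k) (dgs k) r0) (der_comm v _ gs r0).
  by rewrite (der_zc_type _ _ vb r0).
rewrite (eq_bigr _ (fun k _ => E2 k)) big_split /= -der_eulerE in E1.
apply: (addIr (\sum_k (if b' == b then 2 * v 0 k else 0) * der (dzc R b' k) g rho)).
rewrite E1; case: (b' =P b) => [->|_].
  by rewrite -(der_vtypeE _ _ vb) !mul1n -natr1; ring.
by rewrite !mul0n big1 ?addr0 // => k _; rewrite mul0r.
Qed.

End Invariance.

(** * The reduced derivative *)

Section ReducedDerivative.
Variables (R : realType) (n s : nat).
Implicit Types (F : E R n -> R[i]) (rho : E R n) (v w : TE R n) (vs ws us : seq (TE R n)).
Local Notation pos_open := (@E_pos_open R n s).

Lemma JC_inv rho : E_pos s rho -> (JC s rho)^-1 = rJ s rho ^+ 2.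
Proof.
by move=> r0; rewrite -[LHS]mul1r -(rJ_sqr r0) mulfK // JC_neq0.
Qed.

Lemma Theta_vtype b v rho : vtype b v -> E_pos s rho -> vtype b (Theta s rho v).
Proof.
move=> vb r0; rewrite (Theta_type vb r0) addrC -scaleNr.
by apply: vtype_lin => //; exact: euler_vtype.
Qed.

Lemma Theta_horizontal b v rho : vtype b v -> E_pos s rho -> horizontal s b rho (Theta s rho v).
Proof.
move=> vb r0; split; first exact: Theta_vtype.
rewrite (Theta_type vb r0) addrC -scaleNr der_lin_vec (der_euler_JC b r0).
by rewrite mulNr divfK ?JC_neq0 // addNr.
Qed.

(** With 1/J written as [rJ ^+ 2] and the Euler field expanded, the dependence on the point sits
    entirely in smooth coefficients of constant vectors. *)
Lemma Theta_sum b v rho : vtype b v -> E_pos s rho ->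
  Theta s rho v = \sum_k (- (der v (JC s) rho * rJ s rho ^+ 2 * zc b k rho)) *: dzc R b k + v.
Proof.
move=> vb r0; rewrite (Theta_type vb r0) addrC -scaleNr eulerE scaler_sumr (JC_inv r0).
by congr (_ + _); apply: eq_bigr => k _; rewrite scalerA mulNr.
Qed.

(** In each slot [Theta s x w] differs from [w] by constant vectors with coefficients divisible by
    [der w (JC s)], which vanishes at [rho] to every order. The word [vs] holds the slots already
    treated; in the correction terms these are filled with arbitrary basis vectors, hence no
    condition on [vs]. *)
Lemma hcong_Theta b rho F vs ws : E_pos s rho -> smooth_pos s F ->
  (forall w, w \in ws -> horizontal s b rho w) ->
  smooth_pos s (fun x => ders (vs ++ [seq Theta s x w | w <- ws]) F x) /\
  hcong s b rho (fun x => ders (vs ++ [seq Theta s x w | w <- ws]) F x) (ders (vs ++ ws) F).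
Proof.
move=> r0 Fs; elim: ws vs => [|w ws IH] vs hws.
  split; first exact: (smooth_ders (vs ++ [::]) Fs).
  have E0 : eq_pos s (fun=> 0) (fun x => ders (vs ++ [::]) F x - ders (vs ++ [::]) F x).
    by move=> x _; rewrite subrr.
  exact: (hnull_eq r0 E0 (hnull0 r0)).
have hw : horizontal s b rho w by apply: hws; rewrite mem_head.
have {}hws u : u \in ws -> horizontal s b rho u by move=> uw; apply: hws; rewrite inE uw orbT.
have {}IH vs' := IH vs' hws.
pose g u := fun x => ders (rcons vs u ++ [seq Theta s x w | w <- ws]) F x.
have gs u : smooth_pos s (g u) by have [] := IH (rcons vs u).
pose lam k := fun x => - (rJ s x ^+ 2 * zc b k x) * g (dzc R b k) x.
have lam0 k : smooth_pos s (fun x : E R n => - (rJ s x ^+ 2 * zc b k x)).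
  have h : smooth_pos s (fun x : E R n => rJ s x ^+ 2 * zc b k x).
    exact: (smooth_mul pos_open (smooth_exp pos_open 2 (@rJ_smooth R n s)) (zc_smooth b k)).
  by apply: (eqon_smooth pos_open _ (smooth_scale pos_open (-1) h)) => x _; rewrite mulN1r.
have lams k : smooth_pos s (lam k) := smooth_mul pos_open (lam0 k) (gs _).
have ls k : smooth_pos s (fun x => der w (JC s) x * lam k x).
  exact: (smooth_mul pos_open (smooth_der w (@JC_smooth R n s)) (lams k)).
have sum_s : smooth_pos s (fun x => \sum_k der w (JC s) x * lam k x).
  by apply: (smooth_sum pos_open) => i _; exact: ls.
have E1 : eq_pos s (fun x => \sum_k der w (JC s) x * lam k x + g w x)
    (fun x => ders (vs ++ [seq Theta s x w | w <- w :: ws]) F x).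
  move=> x x0; rewrite map_cons (Theta_sum hw.1 x0) -[\sum_k _ *: _]scale1r.
  rewrite (ders_slot_lin _ _ _ _ _ Fs x0) mul1r (ders_slot_sum _ _ _ _ _ Fs x0).
  rewrite /g -!cat_rcons; congr (_ + _); apply: eq_bigr => k _.
  by rewrite /lam /g -cat_rcons !mulNr mulrN -!mulrA.
split; first exact: (eqon_smooth pos_open E1 (smooth_add pos_open sum_s (gs w))).
have [_ gw] := IH (rcons vs w).
have null_sum : hnull s b rho (fun x => \sum_k der w (JC s) x * lam k x).
  apply: (hnull_sum r0 _ ls) => k.
  exact: (hnull_mul r0 (smooth_der w (@JC_smooth R n s)) (lams k) (hnull_der_JC r0 hw)).
have ds : smooth_pos s (fun x => g w x - ders (rcons vs w ++ ws) F x).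
  apply: (eqon_smooth pos_open _ (smooth_add pos_open (gs w)
    (smooth_scale pos_open (-1) (smooth_ders (rcons vs w ++ ws) Fs)))) => x _.
  by rewrite mulN1r.
have E2 : eq_pos s (fun x => \sum_k der w (JC s) x * lam k x + (g w x - ders (rcons vs w ++ ws) F x))
    (fun x => ders (vs ++ [seq Theta s x w | w <- w :: ws]) F x - ders (vs ++ w :: ws) F x).
  by move=> x x0; rewrite -(E1 x x0) cat_rcons addrA.
exact: (hnull_eq r0 E2 (hnull_add r0 sum_s ds null_sum gw)).
Qed.

Variable D : forall k, symtensor R n s k -> symtensor R n s k.+1.
Hypothesis hD : is_Dsym_red D.

(** In the induction step the outer derivative acts on an expression containing
    [Theta s x (Theta s rho v)] with [x] varying. Its direction and the inner vectors are horizontal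
    at [rho] and of one type, so [hcong_Theta] lets the outer [Theta s x] be dropped before
    differentiating. *)
Lemma Dred_iterE r (f : Cinf_red R n s) b (v : 'I_r -> TE R n) rho : E_pos s rho ->
  (forall i, vtype b (v i)) ->
  pullback_tensor (Dred_iter D r f) rho v =
  ders [seq Theta s rho (v i) | i <- enum 'I_r] (pullback f) rho.
Proof.
have fs := Cinf_smooth f.
elim: r v rho => [|r IH] v rho r0 vb.
  by rewrite (_ : enum 'I_0 = [::]) //; apply: size0nil; rewrite size_enum_ord.
rewrite [LHS](hD _ _ r0) /Theta_pullback.
apply: (Dsym_ders fs r0) => sigma; rewrite map_enum_ordS ders_cons.
set W := Theta s rho (v (sigma ord0)).
pose ws := [seq Theta s rho (v (sigma (lift ord0 j))) | j <- enum 'I_r].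
have hW : horizontal s b rho W by exact: Theta_horizontal.
have hws w : w \in ws -> horizontal s b rho w.
  by move=> /mapP[j _ ->]; exact: Theta_horizontal.
have [Gs Gc] := hcong_Theta [::] r0 fs hws.
have hW1 w : w \in [:: W] -> horizontal s b rho w by rewrite inE => /eqP ->.
have := hcong_ders r0 Gs (smooth_ders ws fs) Gc hW1; rewrite !ders_cons => <-.
apply: (der_eq W _ r0) => x x0; have vb' j : vtype b (Theta s rho (v (sigma (lift ord0 j)))).
  exact: (Theta_vtype (vb _) r0).
have E0 := IH (fun j => Theta s rho (v (sigma (lift ord0 j)))) x x0 vb'.
apply: (eq_trans E0).
have <- : [seq Theta s x w | w <- ws] = [seq Theta s x (Theta s rho (v (sigma (lift ord0 i)))) | i <- enum 'I_r].
  exact: esym (map_comp _ _ _).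
by [].
Qed.

(** The common shape of the pairings with H and with H_red: [u] and [w] are the coordinate frames,
    plain or projected at the point. *)
Definition pairing_sum r (u w : 'I_n.+1 -> TE R n) (F G : E R n -> R[i]) rho : R[i] :=
  \sum_(kappa : {ffun 'I_r -> 'I_n.+1}) (\prod_(i < r) (nu R s (kappa i))%:C) *
    ders [seq u (kappa i) | i <- enum 'I_r] F rho *
    ders [seq w (kappa i) | i <- enum 'I_r] G rho.

Lemma pairing_HredE r (f g : Cinf_red R n s) (rho : Cplus R n s) :
  pairing (Hred rho) (@st_fun R n s r (Dred_iter D r f) (Pr rho))
                     (@st_fun R n s r (Dred_iter D r g) (Pr rho)) =
  pairing_sum r (fun k => Theta s (val rho) (dzc R false k))
    (fun k => Theta s (val rho) (dzc R true k)) (pullback f) (pullback g) (val rho).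
Proof.
have r0 : E_pos s (val rho) := valP rho.
have stE (h : Cinf_red R n s) (v : 'I_r -> TE R n) :
    st_fun (Dred_iter D r h) (fun i => TPr rho (v i)) =
    pullback_tensor (Dred_iter D r h) (val rho) v.
  by rewrite /pullback_tensor valK.
apply: eq_bigr => kappa _; congr (_ * _ * _).
  rewrite [LHS](stE f (fun i => dzb R (kappa i))).
  rewrite (Dred_iterE f (b := false) r0) => [|i]; last by have := dzc_vtype R false (kappa i); rewrite dzc_def.
  by congr ders; apply: eq_map => i; rewrite dzc_def.
rewrite [LHS](stE g (fun i => dz R (kappa i))).
rewrite (Dred_iterE g (b := true) r0) => [|i]; last by have := dzc_vtype R true (kappa i); rewrite dzc_def.
by congr ders; apply: eq_map => i; rewrite dzc_def.
Qed.

Lemma pairing_HE r F G rho : smooth_pos s F -> smooth_pos s G -> E_pos s rho ->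
  pairing (Htensor R n s) (Dsym_iter r F rho) (Dsym_iter r G rho) =
  pairing_sum r (dzc R false) (dzc R true) F G rho.
Proof.
move=> Fs Gs r0; apply: eq_bigr => kappa _; congr (_ * _ * _).
  rewrite [LHS](Dsym_iterE _ Fs r0).
  by congr ders; apply: eq_map => i; rewrite dzc_def.
rewrite [LHS](Dsym_iterE _ Gs r0).
by congr ders; apply: eq_map => i; rewrite dzc_def.
Qed.

End ReducedDerivative.

(** * Contraction with rank one perturbations *)

Section Contractions.
Variables (C : comNzRingType) (I : finType).
Implicit Types (M N : I -> I -> C) (L : seq (I -> I -> C)) (phi : seq I -> seq I -> C).

(* Contracts the [i]-th index of the first and the [i]-th index of the second
   argument of [phi] with the [i]-th matrix of [L]. *)
Fixpoint ctr L phi : C :=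
  if L is M :: L' then
    \sum_a \sum_b M a b * ctr L' (fun x y => phi (a :: x) (b :: y))
  else phi [::] [::].

Lemma ctr_ext L phi psi :
  (forall x y, size x = size L -> size y = size L -> phi x y = psi x y) ->
  ctr L phi = ctr L psi.
Proof.
elim: L phi psi => [|M L IH] phi psi H /=; first exact: H.
apply: eq_bigr => a _; apply: eq_bigr => b _; congr (_ * _).
by apply: IH => x y xL yL; apply: H; rewrite /= ?xL ?yL.
Qed.

Lemma ctr_sum (T : Type) (r : seq T) (c : T -> C) (phi : T -> seq I -> seq I -> C) L :
  ctr L (fun x y => \sum_(i <- r) c i * phi i x y) = \sum_(i <- r) c i * ctr L (phi i).
Proof.
elim: L phi => [//|M L IH] phi /=.
under eq_bigr => a _ do under eq_bigr => b _ do rewrite IH mulr_sumr.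
under eq_bigr => a _ do rewrite exchange_big.
rewrite exchange_big; apply: eq_bigr => i _; rewrite mulr_sumr.
apply: eq_bigr => a _; rewrite mulr_sumr; apply: eq_bigr => b _.
by rewrite mulrCA.
Qed.

Lemma ctr_scale (c : C) phi L : ctr L (fun x y => c * phi x y) = c * ctr L phi.
Proof.
have := ctr_sum [:: tt] (fun=> c) (fun=> phi) L; rewrite big_seq1 => <-.
by apply: ctr_ext => x y _ _; rewrite big_seq1.
Qed.

Lemma ctr_head_lin (c : C) M N L phi :
  ctr ((fun a b => M a b + c * N a b) :: L) phi = ctr (M :: L) phi + c * ctr (N :: L) phi.
Proof.
rewrite /= mulr_sumr -big_split; apply: eq_bigr => a _ /=.
rewrite mulr_sumr -big_split; apply: eq_bigr => b _ /=.
by rewrite mulrDl mulrA.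
Qed.

Definition sym2 phi := forall x x' y y', perm_eq x x' -> perm_eq y y' -> phi x y = phi x' y'.

Lemma sym2_cons phi a b : sym2 phi -> sym2 (fun x y => phi (a :: x) (b :: y)).
Proof. by move=> H x x' y y' xx' yy'; apply: H; rewrite perm_cons. Qed.

(** Symmetry of [phi] in each argument makes the slots interchangeable, provided the two indices of
    one matrix move together. *)
Lemma ctr_move L1 M L2 phi : sym2 phi -> ctr (L1 ++ M :: L2) phi = ctr (M :: L1 ++ L2) phi.
Proof.
elim: L1 phi => [//|N L1 IH] phi phiS.
transitivity (\sum_a \sum_b N a b * ctr (M :: L1 ++ L2) (fun x y => phi (a :: x) (b :: y))).
  apply: eq_bigr => a _; apply: eq_bigr => b _; congr (_ * _).
  exact: (IH _ (sym2_cons a b phiS)).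
rewrite /=.
under eq_bigr => a _ do under eq_bigr => b _ do rewrite mulr_sumr.
under eq_bigr => a _ do under eq_bigr => b _ do under eq_bigr => c _ do rewrite mulr_sumr.
rewrite pair_big /= exchange_big /=; apply: eq_bigr => c _.
rewrite exchange_big /=; apply: eq_bigr => d _.
rewrite -(pair_big xpredT xpredT (fun a b => N a b *
  (M c d * ctr (L1 ++ L2) (fun x y => phi [:: a, c & x] [:: b, d & y])))) /= mulr_sumr.
apply: eq_bigr => a _; rewrite mulr_sumr; apply: eq_bigr => b _.
rewrite mulrCA; congr (_ * (_ * _)); apply: ctr_ext => x y _ _; apply: phiS.
  by rewrite -[_ :: _ :: x]/([:: a] ++ [:: c] ++ x) perm_catCA.
by rewrite -[_ :: _ :: y]/([:: b] ++ [:: d] ++ y) perm_catCA.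
Qed.

Section Euler.
Variables (p q : I -> C) (phi : seq I -> seq I -> C).
Hypothesis phiS : sym2 phi.
(* Euler's relation for [phi] homogeneous of degree minus the number of indices *)
Hypothesis eul1 : forall x y, \sum_a p a * phi (a :: x) y = - (size x)%:R * phi x y.
Hypothesis eul2 : forall x y, \sum_b q b * phi x (b :: y) = - (size y)%:R * phi x y.

(** Both Euler relations act on the same slot, with [size L] indices left on either side; the two
    factors [- size L] multiply to a square. *)
Lemma ctr_euler L :
  ctr ((fun a b => p a * q b) :: L) phi = (size L)%:R ^+ 2 * ctr L phi.
Proof.
rewrite /=; have -> : \sum_a \sum_b p a * q b * ctr L (fun x y => phi (a :: x) (b :: y)) =
    ctr L (fun x y => \sum_a p a * \sum_b q b * phi (a :: x) (b :: y)).
  rewrite ctr_sum; apply: eq_bigr => a _; rewrite ctr_sum mulr_sumr.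
  by apply: eq_bigr => b _; rewrite mulrA.
rewrite -ctr_scale; apply: ctr_ext => x y xL yL.
under eq_bigr => a _ do rewrite eul2 mulrCA.
by rewrite -mulr_sumr eul1 xL yL mulrA mulrNN.
Qed.

(** Induction on the number [a] of perturbed slots, with [b] counting those already reduced to [M].
    The head slot contributes either [M], which is moved behind and raises [b], or the rank one
    part, which costs the squared number of remaining slots. *)
Lemma ctr_expand (c : C) M (a b : nat) :
  let K := fun i j => M i j + c * (p i * q j) in
  ctr (nseq a K ++ nseq b M) phi =
  \sum_(j < a.+1) ('C(a, j)%:R * c ^+ j * (((a + b).-1 ^_ j)%:R ^+ 2)) *
    ctr (nseq (a + b - j) M) phi.
Proof.
move=> K; elim: a b => [|a IH] b.
  by rewrite big_ord1 bin0 expr0 ffactn0 expr1n !mul1r subn0.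
rewrite [nseq a.+1 K ++ _]/= [LHS](ctr_head_lin c M (fun i j => p i * q j)).
rewrite -ctr_move // -[M :: nseq b M]/(nseq b.+1 M) IH ctr_euler IH size_cat !size_nseq.
pose G j := (((a + b) ^_ j)%:R ^+ 2 : C) * ctr (nseq (a.+1 + b - j) M) phi.
have -> : \sum_(j < a.+1) ('C(a, j)%:R * c ^+ j * (((a + b.+1).-1 ^_ j)%:R ^+ 2)) *
    ctr (nseq (a + b.+1 - j) M) phi = \sum_(j < a.+1) 'C(a, j)%:R * c ^+ j * G j.
  by apply: eq_bigr => j _; rewrite addnS -addSn /G mulrA.
have -> : c * ((a + b)%:R ^+ 2 * (\sum_(j < a.+1) ('C(a, j)%:R * c ^+ j * (((a + b).-1 ^_ j)%:R ^+ 2)) *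
    ctr (nseq (a + b - j) M) phi)) = \sum_(j < a.+1) 'C(a, j)%:R * c ^+ j.+1 * G j.+1.
  rewrite !mulr_sumr; apply: eq_bigr => j _; rewrite /G addSn subSS ffactnS natrM exprMn [c ^+ j.+1]exprS.
  by ring.
under [RHS]eq_bigr => j _ do rewrite [(a.+1 + b).-1]/= -mulrA -/(G j).
(* The extreme terms of the two sums stand alone; all others combine in pairs by Pascal's rule. *)
rewrite [RHS]big_ord_recl bin0 [X in X + _]big_ord_recl bin0 -!addrA; congr (_ + _).
rewrite [X in _ + X = _]big_ord_recr [RHS]big_ord_recr /= binn binn addrA; congr (_ + _).
rewrite -big_split; apply: eq_bigr => j _ /=.
by rewrite /bump /= !add1n binS natrD -!mulrDl addrC.
Qed.

End Euler.

(** * Sums over multi-indices as contractions *)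

Fixpoint isum r (Psi : seq I -> C) : C :=
  if r is r'.+1 then \sum_a isum r' (fun x => Psi (a :: x)) else Psi [::].

Lemma isum_ext r Psi Psi' : Psi =1 Psi' -> isum r Psi = isum r Psi'.
Proof.
elim: r Psi Psi' => [|r IH] Psi Psi' H /=; first exact: H.
by apply: eq_bigr => a _; apply: IH => x; exact: H.
Qed.

Lemma isum_sum (T : Type) (u : seq T) (c : T -> C) (Psi : T -> seq I -> C) r :
  isum r (fun x => \sum_(i <- u) c i * Psi i x) = \sum_(i <- u) c i * isum r (Psi i).
Proof.
elim: r Psi => [//|r IH] Psi /=; under eq_bigr do rewrite IH.
by rewrite exchange_big; apply: eq_bigr => i _; rewrite mulr_sumr.
Qed.

Definition ffcons r (x : I * {ffun 'I_r -> I}) : {ffun 'I_r.+1 -> I} :=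
  [ffun i => if unlift ord0 i is Some j then x.2 j else x.1].

Lemma ffcons_bij r : bijective (@ffcons r).
Proof.
exists (fun k : {ffun 'I_r.+1 -> I} => (k ord0, [ffun j => k (lift ord0 j)])).
  move=> [a k]; rewrite /ffcons ffunE unlift_none; congr (_, _).
  by apply/ffunP => j; rewrite !ffunE liftK.
move=> k; apply/ffunP => i; rewrite ffunE; case: unliftP => [j ->|-> //].
by rewrite ffunE.
Qed.

Lemma sum_ffun_isum r (Psi : seq I -> C) :
  \sum_(k : {ffun 'I_r -> I}) Psi [seq k i | i <- enum 'I_r] = isum r Psi.
Proof.
elim: r Psi => [|r IH] Psi /=.
  have e0 : enum 'I_0 = [::] by apply: size0nil; rewrite size_enum_ord.
  by rewrite e0 /= sumr_const card_ffun card_ord expn0 mulr1n.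
rewrite (reindex (@ffcons r)) /=; last exact: onW_bij (ffcons_bij r).
under [RHS]eq_bigr do rewrite -IH.
rewrite pair_big; apply: eq_bigr => -[a k] _; congr Psi.
rewrite enum_ordSl /= ffunE unlift_none -map_comp; congr (_ :: _).
by apply: eq_map => j; rewrite /= ffunE liftK.
Qed.

Section Multilinear.
Variables (V W : lmodType C).

Definition mlin2 (Phi : seq V -> seq W -> C) :=
  (forall p us ws (c : I -> C) (d : I -> V),
    Phi (p ++ (\sum_i c i *: d i) :: us) ws = \sum_i c i * Phi (p ++ d i :: us) ws) /\
  (forall q us ws (c : I -> C) (d : I -> W),
    Phi us (q ++ (\sum_i c i *: d i) :: ws) = \sum_i c i * Phi us (q ++ d i :: ws)).

Lemma mlin2_cons Phi v w : mlin2 Phi -> mlin2 (fun us ws => Phi (v :: us) (w :: ws)).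
Proof.
by move=> [H1 H2]; split=> [p us ws c d|q us ws c d]; [exact: (H1 (v :: p))|exact: (H2 (w :: q))].
Qed.

(** Expanding [u k] and [w k] in the frames [d] and [e] allows the sum over [k] to be done slot by
    slot. It produces the matrix product of the transpose of [P], the diagonal matrix of [nu], and
    [Q]. *)
Lemma isum_ctr r Phi (nu : I -> C) (P Q : I -> I -> C) (u d : I -> V) (w e : I -> W) :
  mlin2 Phi -> (forall k, u k = \sum_a P k a *: d a) -> (forall k, w k = \sum_b Q k b *: e b) ->
  isum r (fun x => (\prod_(a <- x) nu a) * Phi (map u x) (map w x)) =
  ctr (nseq r (fun a b => \sum_k nu k * P k a * Q k b)) (fun x y => Phi (map d x) (map e y)).
Proof.
move=> PhiL uE wE; elim: r Phi PhiL => [|r IH] Phi PhiL /=; first by rewrite big_nil mul1r.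
transitivity (\sum_k \sum_a \sum_b (nu k * P k a * Q k b) *
    ctr (nseq r (fun a b => \sum_k nu k * P k a * Q k b)) (fun x y => Phi (d a :: map d x) (e b :: map e y))).
  apply: eq_bigr => k _.
  transitivity (isum r (fun x => \sum_a (nu k * P k a) * (\sum_b Q k b *
      ((\prod_(a <- x) nu a) * Phi (d a :: map u x) (e b :: map w x))))).
    apply: isum_ext => x; rewrite big_cons /= uE wE.
    rewrite (PhiL.1 [::]) mulr_sumr; apply: eq_bigr => a _.
    rewrite (PhiL.2 [::]) !mulr_sumr; apply: eq_bigr => b _ /=.
    ring.
  rewrite isum_sum; apply: eq_bigr => a _; rewrite isum_sum mulr_sumr.
  apply: eq_bigr => b _; rewrite mulrA; congr (_ * _).
  exact: IH (mlin2_cons _ _ PhiL).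
rewrite exchange_big; apply: eq_bigr => a _; rewrite exchange_big; apply: eq_bigr => b _.
by rewrite mulr_suml.
Qed.

End Multilinear.

End Contractions.

(** * Formal power series *)

Section PowerSeriesCoefficients.
Variable R : realType.
Local Notation C := R[i].

Definition geom_prod (l : seq C) : nat -> C :=
  \big[@fps_mul R/(fun N => (N == 0)%:R)]_(a <- l) fps_geom a.

Lemma geom_prod_nil N : geom_prod [::] N = (N == 0)%:R.
Proof. by rewrite /geom_prod big_nil. Qed.

Lemma geom_prod_cons0 a l : geom_prod (a :: l) 0 = geom_prod l 0.
Proof. by rewrite /geom_prod big_cons /fps_mul big_ord1 /fps_geom expr0 mul1r. Qed.

Lemma geom_prod_consS a l N :
  geom_prod (a :: l) N.+1 = geom_prod l N.+1 + a * geom_prod (a :: l) N.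
Proof.
rewrite /geom_prod !big_cons /fps_mul big_ord_recl /fps_geom expr0 mul1r subn0.
congr (_ + _); rewrite mulr_sumr; apply: eq_bigr => i _.
by rewrite lift0 subSS exprS mulrA.
Qed.

Lemma geom_prod0 l : geom_prod l 0 = 1.
Proof. by elim: l => [|a l IH]; rewrite ?geom_prod_nil ?geom_prod_cons0. Qed.

(** Multiplication by 1 - b lambda cancels the last factor. The big product unfolds at its first
    factor, so the last one is reached by induction. *)
Lemma geom_prod_rconsS l b N :
  geom_prod (rcons l b) N.+1 = geom_prod l N.+1 + b * geom_prod (rcons l b) N.
Proof.
elim: l N => [|a l IH]; first exact: geom_prod_consS.
elim=> [|N IHN]; rewrite rcons_cons geom_prod_consS IH.
  by rewrite geom_prod_consS !geom_prod0; ring.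
rewrite rcons_cons in IHN; rewrite (geom_prod_consS a l N.+1).
by rewrite [in RHS](geom_prod_consS a (rcons l b) N) IHN; ring.
Qed.

Definition falling_prod r : nat -> C := geom_prod [seq k%:R | k <- iota 0 r].

Lemma falling_prodS r N :
  falling_prod r.+1 N.+1 = falling_prod r N.+1 + r%:R * falling_prod r.+1 N.
Proof. by rewrite /falling_prod -addn1 iotaD map_cat cats1 geom_prod_rconsS. Qed.

Lemma inv_fallingE r N : (r <= N)%N -> inv_falling R r N = falling_prod r (N - r).
Proof.
move=> rN; have -> : falling_prod r = \big[@fps_mul R/(fun N => (N == 0)%:R)]_(k < r) fps_geom k%:R.
  rewrite /falling_prod /geom_prod big_map -[iota 0 r](_ : index_iota 0 r = _); last by rewrite /index_iota subn0.
  exact: big_mkord.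
rewrite /inv_falling /fps_mul (bigD1 (inord r)) //= inordK ?ltnS // eqxx mul1r.
rewrite big1 ?addr0 // => i ir; case: eqP => [E|]; last by rewrite mul0r.
by case/eqP: ir; apply: val_inj; rewrite /= inordK ?ltnS.
Qed.

Lemma inv_falling0 N : inv_falling R 0 N = (N == 0)%:R.
Proof. by rewrite inv_fallingE // subn0 /falling_prod geom_prod_nil. Qed.

(** The series for m + 1 times 1 - m lambda is lambda times the series for m. This is the recursion
    of the Stirling numbers of the second kind, with both arguments shifted by one. *)
Lemma inv_fallingS m N :
  inv_falling R m.+1 N.+1 = inv_falling R m N + m%:R * inv_falling R m.+1 N.
Proof.
have [Nm|mN|->] := ltngtP N m.
- by rewrite !inv_falling_lt ?mulr0 ?addr0 // ltnW.
- rewrite (inv_fallingE (N := N.+1)) ?ltnS ?(ltnW mN) // subSS.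
  rewrite (inv_fallingE (ltnW mN)) (inv_fallingE mN).
  by rewrite -[(N - m)%N]prednK ?subn_gt0 // -subnS falling_prodS.
- rewrite (inv_fallingE (ltnSn m)) inv_fallingE // (inv_falling_lt R (ltnSn m)) !subnn.
  by rewrite /falling_prod !geom_prod0 mulr0 addr0.
Qed.

(* coefficient of lambda^k J^(-N-k) in T(J^-N) *)
Fixpoint cT N : nat -> nat :=
  if N is N'.+1 then
    fix cTN k := if k is k'.+1 then (cT N' k + (N' + k) * cTN k')%N else cT N' 0
  else fun k => (k == 0).

Arguments cT : simpl never.

(** The recursion of the unsigned Stirling numbers of the first kind: [cT N k] counts the
    permutations of N + k elements with N cycles. *)
Lemma cTSS N k : cT N.+1 k.+1 = (cT N k.+1 + (N + k.+1) * cT N.+1 k)%N.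
Proof. by []. Qed.

Lemma cT0 N : cT N 0 = 1%N.
Proof. by elim: N => [//|N IH]; exact: IH. Qed.

(* coefficient of lambda^M J^(-M) in the image under T of
   1 / (J/lambda) (J/lambda - 1) ... (J/lambda - m + 1) *)
Definition T_inv_falling M m : C :=
  \sum_(k < M.+1) (cT (M - k) k)%:R * inv_falling R m (M - k).

Lemma T_inv_falling0 M : T_inv_falling M 0 = (M == 0)%:R.
Proof.
rewrite /T_inv_falling big_ord_recr /= subnn inv_falling0 eqxx mulr1 /=.
rewrite big1 ?add0r // => k _; rewrite inv_falling0 subn_eq0 leqNgt ltn_ord mulr0 //.
Qed.

Lemma T_inv_falling_lt M m : (M < m)%N -> T_inv_falling M m = 0.
Proof.
move=> Mm; rewrite /T_inv_falling big1 // => k _.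
by rewrite inv_falling_lt ?mulr0 // (leq_ltn_trans (leq_subr _ _) Mm).
Qed.

(** The factor in the recursion of [cT (M - k).+1 k] is (M - k) + k = M, independent of the
    summation index; [inv_fallingS] contributes the factor m. *)
Lemma T_inv_fallingS M m :
  T_inv_falling M.+1 m.+1 = T_inv_falling M m + (m + M)%:R * T_inv_falling M m.+1.
Proof.
have S1 : T_inv_falling M.+1 m.+1 =
    \sum_(k < M.+1) (cT (M - k).+1 k)%:R * inv_falling R m.+1 (M - k).+1.
  rewrite /T_inv_falling big_ord_recr /= subnn inv_falling_lt // mulr0 addr0.
  by apply: eq_bigr => k _; rewrite subSn // -ltnS.
have S2 : T_inv_falling M m.+1 = \sum_(k < M.+1) (cT (M - k) k)%:R * inv_falling R m.+1 (M - k) by [].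
(* The part of the sum with factor [M], shifted by one in k: its term at k = 0 is absent, and the
   last term on the right vanishes since [inv_falling] of index m + 1 has no constant
   coefficient. *)
have S3 : \sum_(k < M.+1) (if nat_of_ord k is k'.+1 then (M * cT (M - k).+1 k')%N else 0%N)%:R *
      inv_falling R m.+1 (M - k).+1 = M%:R * T_inv_falling M m.+1 :> C.
  rewrite big_ord_recl /= mul0r add0r /T_inv_falling big_ord_recr /= subnn.
  rewrite inv_falling_lt // mulr0 addr0 mulr_sumr; apply: eq_bigr => k _.
  rewrite /bump /= !(add0n, add1n) (subnSK (ltn_ord k)) natrM.
  by rewrite mulrA.
rewrite S1 natrD mulrDl -S3 S2 mulr_sumr addrA /T_inv_falling -!big_split.
apply: eq_bigr => k _ /=; rewrite inv_fallingS.
case: k => -[|k] kM /=; first by rewrite !subn0 !cT0; ring.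
have -> : cT (M - k.+1).+1 k.+1 = (cT (M - k.+1) k.+1 + M * cT (M - k.+1).+1 k)%N.
  by rewrite cTSS subnK.
by rewrite natrD natrM; ring.
Qed.

(** For 1 <= m <= M this is the integer C(M-1, m-1) (M-1)!/(m-1)!, a relative of the Lah numbers.
    The square comes from [ctr_expand], the denominator from its binomial coefficient. *)
Definition wick_coef M m : C :=
  if (m <= M)%N then ((M.-1 ^_ (M - m))%:R ^+ 2) / ((M - m)`!)%:R else 0.

Lemma wick_coefS M m :
  wick_coef M.+1 m.+1 = wick_coef M m + (m + M)%:R * wick_coef M m.+1.
Proof.
rewrite /wick_coef ltnS subSS /=; have [mM|Mm] := leqP m M; last first.
  by rewrite leqNgt (ltn_trans Mm (ltnSn m)) mulr0 addr0.
move: mM; rewrite leq_eqVlt => /orP[/eqP ->|mM].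
  by rewrite subnn ltnn !ffactn0 mulr0 addr0.
rewrite mM; have -> : (M - m = (M - m.+1).+1)%N by rewrite subnSK.
set j := (M - m.+1)%N; have jM : (m + j.+1 = M)%N by rewrite /j subnSK // subnKC // ltnW.
case: M mM @j jM => [//|M] mM j jM /=; rewrite ffactnS /=.
have -> : (M ^_ j.+1 = M ^_ j * m)%N by rewrite ffactnSr; congr (_ * _)%N; rewrite /j subSS subKn.
rewrite factS -jM !natrM.
have f0 : (j`!)%:R != 0 :> C by rewrite pnatr_eq0 -lt0n fact_gt0.
have j0 : (j.+1)%:R != 0 :> C by rewrite pnatr_eq0.
rewrite !natrD; move: (M ^_ j)%:R => x.
rewrite -[j.+1%:R]natr1 in j0 *; by field; rewrite f0 j0.
Qed.

Lemma T_inv_fallingE M m : T_inv_falling M m = wick_coef M m.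
Proof.
elim: M m => [|M IH] [|m].
- by rewrite T_inv_falling0 /wick_coef /= subnn ffactn0 expr1n divr1.
- by rewrite T_inv_falling_lt.
- rewrite T_inv_falling0 /wick_coef /= subn0 ffact_small //.
  by rewrite expr0n mul0r.
- by rewrite T_inv_fallingS wick_coefS !IH.
Qed.

End PowerSeriesCoefficients.

(** * Wick and reduced pairings *)

Lemma prod_map_ffun (C : comNzRingType) (I : finType) r (c : I -> C) (k : {ffun 'I_r -> I}) :
  \prod_(i < r) c (k i) = \prod_(a <- [seq k i | i <- enum 'I_r]) c a.
Proof. by rewrite big_map big_enum. Qed.

Section Pairings.
Variables (R : realType) (n s : nat).
Variables (F G : E R n -> R[i]).
Hypotheses (Fs : smooth_pos s F) (Gs : smooth_pos s G).
Hypotheses (FI : euler_invariant s F) (GI : euler_invariant s G).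
Implicit Types (rho : E R n).
Local Notation pos_open := (@E_pos_open R n s).

Definition ders2 rho (us ws : seq (TE R n)) : R[i] := ders us F rho * ders ws G rho.

Lemma ders2_mlin rho : E_pos s rho -> mlin2 'I_n.+1 (ders2 rho).
Proof.
move=> r0; split=> p us ws c d; rewrite /ders2.
  by rewrite (ders_slot_sum _ _ _ _ _ Fs r0) mulr_suml; apply: eq_bigr => i _; rewrite mulrA.
rewrite (ders_slot_sum _ _ _ _ _ Gs r0) mulr_sumr; apply: eq_bigr => i _.
by rewrite mulrCA.
Qed.

Definition idx2 rho (x y : seq 'I_n.+1) : R[i] :=
  ders2 rho (map (dzc R false) x) (map (dzc R true) y).

Lemma idx2_sym rho : E_pos s rho -> sym2 (idx2 rho).
Proof.
move=> r0 x x' y y' xx' yy'; rewrite /idx2 /ders2.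
by rewrite (ders_perm Fs (perm_map _ xx') r0) (ders_perm Gs (perm_map _ yy') r0).
Qed.

Lemma map_dzc_vtype b (x : seq 'I_n.+1) v : v \in map (dzc R b) x -> vtype b v.
Proof. by move=> /mapP[k _ ->]; exact: dzc_vtype. Qed.

Lemma idx2_euler1 rho : E_pos s rho ->
  forall x y, \sum_a zc false a rho * idx2 rho (a :: x) y = - (size x)%:R * idx2 rho x y.
Proof.
move=> r0 x y; rewrite /idx2 /ders2.
have := euler_ders false Fs FI (@map_dzc_vtype false x) r0.
rewrite eqxx mul1n size_map der_eulerE mulrA => <-; rewrite mulr_suml.
by apply: eq_bigr => a _; rewrite mulrA.
Qed.

Lemma idx2_euler2 rho : E_pos s rho ->
  forall x y, \sum_b zc true b rho * idx2 rho x (b :: y) = - (size y)%:R * idx2 rho x y.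
Proof.
move=> r0 x y; rewrite /idx2 /ders2.
have := euler_ders true Gs GI (@map_dzc_vtype true y) r0.
rewrite eqxx mul1n size_map der_eulerE mulrCA => <-; rewrite mulr_sumr.
by apply: eq_bigr => a _; rewrite mulrCA.
Qed.

Lemma pairing_sum_ctr r (P Q : 'I_n.+1 -> 'I_n.+1 -> R[i]) u w rho : E_pos s rho ->
  (forall k, u k = \sum_a P k a *: dzc R false a) ->
  (forall k, w k = \sum_b Q k b *: dzc R true b) ->
  pairing_sum s r u w F G rho =
  ctr (nseq r (fun a b => \sum_k (nu R s k)%:C * P k a * Q k b)) (idx2 rho).
Proof.
move=> r0 uE wE.
rewrite -(isum_ctr r (fun k => (nu R s k)%:C) (ders2_mlin r0) uE wE) -sum_ffun_isum.
apply: eq_bigr => kappa _; rewrite -mulrA /ders2 -(map_comp u) -(map_comp w); congr (_ * _).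
exact: (prod_map_ffun (fun k => (nu R s k)%:C) kappa).
Qed.

Definition wick_pairing r rho := pairing_sum s r (dzc R false) (dzc R true) F G rho.

Definition red_pairing r rho :=
  pairing_sum s r (fun k => Theta s rho (dzc R false k)) (fun k => Theta s rho (dzc R true k)) F G rho.

Definition diag_nu (a b : 'I_n.+1) : R[i] := (nu R s a)%:C * (a == b)%:R.

Lemma nu_sqr (k : 'I_n.+1) : (nu R s k)%:C * (nu R s k)%:C = 1 :> R[i].
Proof. by rewrite -rmorphM /nu; case: ifP => _; rewrite ?mulrNN mulr1. Qed.

Lemma sum_delta (c : 'I_n.+1 -> R[i]) a : \sum_k (k == a)%:R * c k = c a.
Proof.
rewrite (bigD1 a) //= eqxx mul1r big1 ?addr0 // => k /negbTE ->; exact: mul0r.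
Qed.

Lemma wick_pairing_ctr r rho : E_pos s rho ->
  wick_pairing r rho = ctr (nseq r diag_nu) (idx2 rho).
Proof.
move=> r0; have dE b k : dzc R b k = \sum_a (a == k)%:R *: dzc R b a :> TE R n.
  rewrite (bigD1 k) //= eqxx scale1r big1 ?addr0 // => a /negbTE ->; exact: scale0r.
rewrite /wick_pairing (pairing_sum_ctr r r0 (dE false) (dE true)).
congr (ctr (nseq r _) _); apply/funext => a; apply/funext => b.
rewrite /diag_nu -[RHS](sum_delta (fun k => (nu R s a)%:C * (k == b)%:R)).
apply: eq_bigr => k _; rewrite [a == k]eq_sym [b == k]eq_sym.
by case: (k =P a) => [->|_]; rewrite ?mulr1 ?mul1r ?mulr0 ?mul0r.
Qed.

Lemma der_dzc_JC b k rho : E_pos s rho ->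
  der (dzc R b k) (JC s) rho = (nu R s k)%:C * zc (~~ b) k rho.
Proof.
move=> r0; rewrite (der_JC_type (dzc_vtype R b k) r0).
have d0 l : 2 * dzc R b k 0 l = (l == k)%:R :> R[i].
  by rewrite dzcE !mxE /=; case: (l == k) => /=; field.
rewrite -[RHS](sum_delta (fun l => (nu R s l)%:C * zc (~~ b) l rho)).
by apply: eq_bigr => l _; rewrite d0; ring.
Qed.

(** Each of the two projections subtracts the same rank one term, and the product of the two
    subtractions restores it once, because the sum of nu_k z^k times its conjugate is J. A single
    negative term remains. *)
Lemma red_pairing_ctr r rho : E_pos s rho -> red_pairing r rho =
  ctr (nseq r (fun a b => diag_nu a b + (- (JC s rho)^-1) * (zc false a rho * zc true b rho))) (idx2 rho).
Proof.
move=> r0; have J0 := JC_neq0 r0.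
pose P b (k a : 'I_n.+1) : R[i] := (a == k)%:R - (nu R s k)%:C * zc (~~ b) k rho / JC s rho * zc b a rho.
have TE b k : Theta s rho (dzc R b k) = \sum_a P b k a *: dzc R b a.
  rewrite (Theta_type (dzc_vtype R b k) r0) (der_dzc_JC b k r0) eulerE.
  under [RHS]eq_bigr => a _ do rewrite scalerBl -scalerA.
  rewrite sumrB -scaler_sumr; congr (_ - _).
  by rewrite (bigD1 k) //= eqxx scale1r big1 ?addr0 // => a /negbTE ->; exact: scale0r.
rewrite /red_pairing (pairing_sum_ctr r r0 (TE false) (TE true)).
congr (ctr (nseq r _) _); apply/funext => a; apply/funext => b.
rewrite /P /=; set j := JC s rho in J0 *.
have S1 : \sum_k (k == a)%:R * ((nu R s k)%:C * (k == b)%:R) = diag_nu a b.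
  by rewrite sum_delta.
have S2 : \sum_k (k == a)%:R * ((nu R s k)%:C * (nu R s k)%:C * zc false k rho) = zc false a rho.
  by rewrite sum_delta nu_sqr mul1r.
have S3 : \sum_k (k == b)%:R * ((nu R s k)%:C * (nu R s k)%:C * zc true k rho) = zc true b rho.
  by rewrite sum_delta nu_sqr mul1r.
have S4 : \sum_k (nu R s k)%:C * (nu R s k)%:C * ((nu R s k)%:C * zc true k rho * zc false k rho) = j.
  by rewrite /j JCE; apply: eq_bigr => k _; rewrite nu_sqr mul1r.
transitivity (\sum_k (k == a)%:R * ((nu R s k)%:C * (k == b)%:R)
  - j^-1 * zc true b rho * (\sum_k (k == a)%:R * ((nu R s k)%:C * (nu R s k)%:C * zc false k rho))
  - j^-1 * zc false a rho * (\sum_k (k == b)%:R * ((nu R s k)%:C * (nu R s k)%:C * zc true k rho))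
  + j^-1 * j^-1 * zc false a rho * zc true b rho *
   (\sum_k (nu R s k)%:C * (nu R s k)%:C * ((nu R s k)%:C * zc true k rho * zc false k rho))).
  rewrite !mulr_sumr -!sumrB -big_split; apply: eq_bigr => k _ /=.
  rewrite [a == k]eq_sym [b == k]eq_sym; move: (k == a) (k == b) => da db.
  by field.
rewrite S1 S2 S3 S4; by field.
Qed.

(** Here [ctr_expand] starts from the horizontal matrix and treats [diag_nu] as its perturbation,
    with [c] equal to 1/J. *)
Lemma wick_of_red r rho : E_pos s rho -> wick_pairing r rho =
  \sum_(j < r.+1) 'C(r, j)%:R * (JC s rho)^-1 ^+ j * ((r.-1 ^_ j)%:R ^+ 2) * red_pairing (r - j) rho.
Proof.
move=> r0.
pose M a b := diag_nu a b + (- (JC s rho)^-1) * (zc false a rho * zc true b rho).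
have := ctr_expand (idx2_sym r0) (idx2_euler1 r0) (idx2_euler2 r0) (JC s rho)^-1 M r 0.
rewrite /= cats0 addn0 wick_pairing_ctr // => E0.
have -> : diag_nu = (fun i j => M i j + (JC s rho)^-1 * (zc false i rho * zc true j rho)).
  by apply/funext => i; apply/funext => j; rewrite /M; ring.
rewrite E0; apply: eq_bigr => j _; by rewrite (red_pairing_ctr _ r0).
Qed.

(** The same expansion with the roles exchanged and [c] equal to -1/J. It writes horizontal
    pairings, whose frames vary with the point, through Wick pairings, whose smoothness and
    homogeneity are visible. *)
Lemma red_of_wick r rho : E_pos s rho -> red_pairing r rho =
  \sum_(j < r.+1) 'C(r, j)%:R * (- (JC s rho)^-1) ^+ j * ((r.-1 ^_ j)%:R ^+ 2) * wick_pairing (r - j) rho.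
Proof.
move=> r0.
have := ctr_expand (idx2_sym r0) (idx2_euler1 r0) (idx2_euler2 r0) (- (JC s rho)^-1) diag_nu r 0.
rewrite /= cats0 addn0 red_pairing_ctr // => ->.
by apply: eq_bigr => j _; rewrite (wick_pairing_ctr _ r0).
Qed.

(** * Homogeneity with respect to the real Euler field *)

Definition homog (d : R[i]) (f : E R n -> R[i]) :=
  forall rho, E_pos s rho -> der (X1_vf rho) f rho = d * f rho.

Lemma homog_mul d d' f g : smooth_pos s f -> smooth_pos s g -> homog d f -> homog d' g ->
  homog (d + d') (fun x => f x * g x).
Proof.
move=> fs gs fd gd rho r0; rewrite (der_mul _ fs gs r0) fd // gd //; ring.
Qed.

Lemma homog_scale d (c : R[i]) f : smooth_pos s f -> homog d f -> homog d (fun x => c * f x).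
Proof. by move=> fs fd rho r0; rewrite (der_scale _ _ fs r0) fd // mulrCA. Qed.

Lemma homog_sum (I : Type) (r : seq I) d (f : I -> E R n -> R[i]) :
  (forall i, smooth_pos s (f i)) -> (forall i, homog d (f i)) ->
  homog d (fun x => \sum_(i <- r) f i x).
Proof.
move=> fs fd rho r0; rewrite (der_sum _ _ fs r0) mulr_sumr; apply: eq_bigr => i _.
exact: fd.
Qed.

Lemma homog_exp d k f : smooth_pos s f -> homog d f -> homog (k%:R * d) (fun x => f x ^+ k).
Proof.
move=> fs fd; elim: k => [|k IH] rho r0.
  rewrite mul0r mul0r -[RHS](der_cst (X1_vf rho) 1 rho); apply: (der_eq _ _ r0) => x _.
  by rewrite expr0.
have -> : k.+1%:R * d * f rho ^+ k.+1 = (d + k%:R * d) * (f rho * f rho ^+ k).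
  by rewrite exprS -natr1; ring.
rewrite -(homog_mul fs (smooth_exp pos_open k fs) fd IH r0).
by apply: (der_eq _ _ r0) => x _; rewrite exprS.
Qed.

Lemma homog_JC : homog 2 (JC s).
Proof. by move=> rho r0; rewrite der_X1_JC. Qed.

Lemma homog_rJ : homog (-1) (rJ s).
Proof.
move=> rho r0; rewrite der_rJ // der_X1_JC //.
transitivity (- rJ s rho * (rJ s rho ^+ 2 * JC s rho)).
  by move: (rJ s rho) (JC s rho) => x y; field.
by rewrite rJ_sqr // mulr1 mulN1r.
Qed.

Lemma homog_ders f b vs : smooth_pos s f -> euler_invariant s f ->
  (forall v, v \in vs -> vtype b v) -> homog (- (size vs)%:R) (ders vs f).
Proof.
move=> fs fI vb rho r0; rewrite X1_vfE der_addv !(euler_ders _ fs fI vb r0).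
by case: b {vb} => /=; rewrite ?mul1n ?mul0n; ring.
Qed.

Lemma wick_pairing_smooth r : smooth_pos s (wick_pairing r).
Proof.
apply: (smooth_sum pos_open) => kappa _; apply: (smooth_mul pos_open); last exact: (smooth_ders _ Gs).
by apply: (smooth_scale pos_open); exact: (smooth_ders _ Fs).
Qed.

Lemma wick_pairing_homog r : homog (- (r%:R + r%:R)) (wick_pairing r).
Proof.
have t b (kappa : {ffun 'I_r -> 'I_n.+1}) v :
    v \in [seq dzc R b (kappa i) | i <- enum 'I_r] -> vtype b v.
  by move=> /mapP[i _ ->]; exact: dzc_vtype.
have sz b (kappa : {ffun 'I_r -> 'I_n.+1}) : size [seq dzc R b (kappa i) | i <- enum 'I_r] = r.
  by rewrite size_map size_enum_ord.
apply: homog_sum => kappa.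
  apply: (smooth_mul pos_open); last exact: (smooth_ders _ Gs).
  by apply: (smooth_scale pos_open); exact: (smooth_ders _ Fs).
have h1 := homog_ders Fs FI (@t false kappa).
have h2 := homog_ders Gs GI (@t true kappa).
rewrite sz in h1; rewrite sz in h2; rewrite opprD.
apply: homog_mul h2; [|exact: (smooth_ders _ Gs)|].
  by apply: (smooth_scale pos_open); exact: (smooth_ders _ Fs).
by apply: homog_scale h1; exact: (smooth_ders _ Fs).
Qed.

(* [wick_pairing] and [red_pairing] have degree -2r; [wick0] and [red0] are their
   multiples of degree 0, which dJ annihilates *)
Definition wick0 r rho := JC s rho ^+ r * wick_pairing r rho.

Lemma wick0_smooth r : smooth_pos s (wick0 r).
Proof.
exact: (smooth_mul pos_open (smooth_exp pos_open r (@JC_smooth R n s)) (wick_pairing_smooth r)).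
Qed.

Lemma wick0_homog r : homog 0 (wick0 r).
Proof.
have := homog_mul (smooth_exp pos_open r (@JC_smooth R n s)) (wick_pairing_smooth r)
  (homog_exp r (@JC_smooth R n s) homog_JC) (wick_pairing_homog r).
have -> : r%:R * 2 + - (r%:R + r%:R) = 0 :> R[i] by ring.
by [].
Qed.

Definition red0 m rho : R[i] :=
  \sum_(j < m.+1) 'C(m, j)%:R * (-1) ^+ j * ((m.-1 ^_ j)%:R ^+ 2) * wick0 (m - j) rho.

Lemma red0E m rho : E_pos s rho -> red0 m rho = JC s rho ^+ m * red_pairing m rho.
Proof.
move=> r0; rewrite /red0 (red_of_wick _ r0) mulr_sumr; apply: eq_bigr => j _.
have jm : (j <= m)%N by rewrite -ltnS.
rewrite /wick0 -[in JC s rho ^+ m](subnK jm) exprD [(- (JC s rho)^-1) ^+ j]exprNn exprVn.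
have J0 : JC s rho ^+ j != 0 by rewrite expf_neq0 // JC_neq0.
move: J0; move: (JC s rho ^+ j) (JC s rho ^+ (m - j)) => y z y0; by field.
Qed.

Lemma red0_smooth m : smooth_pos s (red0 m).
Proof.
by apply: (smooth_sum pos_open) => j _; apply: (smooth_scale pos_open); exact: wick0_smooth.
Qed.

Lemma red0_homog m : homog 0 (red0 m).
Proof.
apply: homog_sum => j; last exact: homog_scale (wick0_smooth _) (wick0_homog _).
by apply: (smooth_scale pos_open); exact: wick0_smooth.
Qed.

(** Summing over m = r - j turns C(r, j)/r! into 1/(m! (r - m)!), and the second factorial is
    absorbed into [wick_coef]. *)
Lemma wick_of_red0 r rho : E_pos s rho -> (r`!%:R)^-1 * wick_pairing r rho =
  (JC s rho)^-1 ^+ r * \sum_(m < r.+1) wick_coef R r m * (m`!%:R)^-1 * red0 m rho.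
Proof.
move=> r0; rewrite (wick_of_red _ r0) (reindex_inj rev_ord_inj) /= !mulr_sumr.
apply: eq_bigr => m _; have mr : (m <= r)%N by rewrite -ltnS.
rewrite subSS subKn // (red0E _ r0) /wick_coef mr bin_sub //.
have f0 k : (k`!)%:R != 0 :> R[i] by rewrite pnatr_eq0 -lt0n fact_gt0.
have bE : 'C(r, m)%:R = r`!%:R / (m`!%:R * (r - m)`!%:R) :> R[i].
  by rewrite -(bin_fact mr) !natrM mulfK // mulf_neq0.
have JE : (JC s rho)^-1 ^+ r = (JC s rho)^-1 ^+ (r - m) * (JC s rho ^+ m)^-1.
  by rewrite -exprVn -exprD subnK.
rewrite bE JE; have J0 : JC s rho ^+ m != 0 by rewrite expf_neq0 // JC_neq0.
move: (JC s rho ^+ m) J0 ((JC s rho)^-1 ^+ (r - m)) (red_pairing m rho) => y y0 z p.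
move: (f0 r) (f0 m) (f0 (r - m)%N) => f1 f2 f3.
by field; rewrite f1 f2 f3 y0.
Qed.

End Pairings.

(** * The operator T *)

Section OperatorT.
Variables (R : realType) (n s : nat) (t : nat -> nat -> R -> R[i]).
Implicit Types (f g h : E R n -> R[i]) (rho : E R n).
Local Notation pos_open := (@E_pos_open R n s).

Lemma dJE f rho : dJ s f rho = (2 * JC s rho)^-1 * der (X1_vf rho) f rho.
Proof. by rewrite /dJ derE. Qed.

Lemma dJ_eq f g : eq_pos s f g -> eq_pos s (dJ s f) (dJ s g).
Proof. by move=> fg rho r0; rewrite !dJE (der_eq _ fg r0). Qed.

Lemma iter_dJ_eq l f g : eq_pos s f g -> eq_pos s (iter l (dJ s) f) (iter l (dJ s) g).
Proof. by move=> fg; elim: l => [|l IH]; [exact: fg|rewrite !iterS; exact: dJ_eq]. Qed.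

Lemma T_coef_eq k f g : eq_pos s f g -> eq_pos s (T_coef s t k f) (T_coef s t k g).
Proof.
move=> fg; case: k => [|k] rho r0; first exact: fg.
by apply: eq_bigr => l _; rewrite (iter_dJ_eq l fg r0).
Qed.

(** J^-k, expressed through [rJ] so that smoothness and degree come from those of powers of [rJ]. *)
Definition Jinv k rho : R[i] := (rJ s rho ^+ 2) ^+ k.

Lemma JinvE k rho : E_pos s rho -> Jinv k rho = (JC s rho)^-1 ^+ k.
Proof. by move=> r0; rewrite /Jinv -(JC_inv r0). Qed.

Lemma Jinv_smooth k : smooth_pos s (Jinv k).
Proof. exact: (smooth_exp pos_open k (smooth_exp pos_open 2 (@rJ_smooth R n s))). Qed.

Lemma Jinv_homog k : homog s (k%:R * (2%:R * -1)) (Jinv k).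
Proof.
exact: (homog_exp k (smooth_exp pos_open 2 (@rJ_smooth R n s))
  (homog_exp 2 (@rJ_smooth R n s) (@homog_rJ R n s))).
Qed.

Lemma dJ_homog (d : R[i]) f rho : homog s d f -> E_pos s rho ->
  dJ s f rho = (d / 2) * (rJ s rho ^+ 2 * f rho).
Proof.
move=> fd r0; rewrite dJE fd // -(JC_inv r0); have := JC_neq0 r0.
by move: (JC s rho) (f rho) => x y x0; field.
Qed.

(** The falling factorial of -N, which is the coefficient in the l-th J-derivative of J^-N. *)
Definition falling_neg N l : R[i] := \prod_(i < l) - (N + i)%:R.

Lemma iter_dJ_Jinv N l h : smooth_pos s h -> homog s 0 h ->
  eq_pos s (iter l (dJ s) (fun x => Jinv N x * h x))
           (fun x => falling_neg N l * (Jinv (N + l) x * h x)).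
Proof.
move=> hs h0; elim: l => [|l IH] rho r0.
  by rewrite /falling_neg big_ord0 mul1r addn0.
rewrite iterS (dJ_eq IH r0).
have Js : smooth_pos s (fun x => Jinv (N + l) x * h x).
  exact: (smooth_mul pos_open (Jinv_smooth (N + l)) hs).
have Jd := homog_scale (falling_neg N l) Js (homog_mul (Jinv_smooth (N + l)) hs (Jinv_homog (N + l)) h0).
rewrite (dJ_homog Jd r0) /falling_neg big_ord_recr /= addnS /Jinv.
move: (\prod_(i < l) _) ((N + l)%:R) (rJ s rho ^+ 2) => P x z; rewrite [z ^+ _.+1]exprS.
by move: (z ^+ (N + l)) (h rho) => y w; field.
Qed.

(** [dJ] is a derivation that annihilates functions of degree 0, so [T] acts on the power of J
    alone. *)
Lemma T_coef_Jinv k N h : smooth_pos s h -> homog s 0 h ->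
  eq_pos s (T_coef s t k (fun x => Jinv N x * h x))
           (fun x => T_coef s t k (Jinv N) x * h x).
Proof.
move=> hs h0 rho r0; case: k => [//|k]; rewrite /= mulr_suml; apply: eq_bigr => l _.
rewrite (iter_dJ_Jinv N l hs h0 r0).
have one_h : homog s 0 (fun _ : E R n => 1 : R[i]).
  by move=> x x0; rewrite der_cst mul0r.
have E0 : eq_pos s (Jinv N) (fun x => Jinv N x * 1) by move=> x _; rewrite mulr1.
rewrite (iter_dJ_eq l E0 r0) (iter_dJ_Jinv N l (smooth_cst _ 1) one_h r0) mulr1.
by rewrite !mulrA.
Qed.

Lemma iter_dJ0 l : iter l (dJ s) (fun _ : E R n => 0) = fun=> 0.
Proof.
elim: l => [//|l IH]; rewrite iterS IH; apply/funext => rho.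
by rewrite dJE der_cst mulr0.
Qed.

Lemma T_coef0 k rho : T_coef s t k (fun=> 0) rho = 0.
Proof. by case: k => [//|k]; rewrite /= big1 // => l _; rewrite iter_dJ0 mulr0. Qed.

Lemma T_series_const f k rho : T_series s t (const_series f) k rho = T_coef s t k f rho.
Proof.
rewrite /T_series big_ord_recr /= subnn big1 ?add0r // => j _.
by have := ltn_ord j; rewrite -subn_gt0; case: (k - j)%N => // m _; exact: T_coef0.
Qed.

Lemma Jinv_U1 k : U1_invariant s (Jinv k : E R n -> R[i]).
Proof.
move=> [a b] rho; rewrite normc_def /= => -[ab] _.
have N1 : a ^+ 2 + b ^+ 2 = 1.
  by rewrite -[LHS]sqr_sqrtr ?addr_ge0 ?sqr_ge0 // ab expr1n.
by rewrite /Jinv /rJ J_cscale N1 mul1r.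
Qed.

Hypothesis ht : is_T n s t.

(** The defining relation of [T], applied to J^-(N+1), expresses the order k of T(J^-(N+1)) through
    the order k of T(J^-N) and the order k - 1 of T(J^-(N+1)); this reproduces the recursion of
    [cT]. In the base case T(1) = 1, since every correction term contains at least one [dJ]. *)
Lemma T_coef_Jinv_pow N k :
  eq_pos s (T_coef s t k (Jinv N)) (fun x => (cT N k)%:R * Jinv (N + k) x).
Proof.
elim: N k => [|N IHN].
  case=> [|k] rho r0; first by rewrite /= mul1r.
  rewrite [RHS]mul0r /= big_nat big1 // => l /andP[l0 _].
  have one_h : homog s 0 (fun _ : E R n => 1 : R[i]) by move=> x x0; rewrite der_cst mul0r.
  have E0 : eq_pos s (Jinv 0) (fun x => Jinv 0 x * 1) by move=> x _; rewrite mulr1.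
  rewrite (iter_dJ_eq l E0 r0) (iter_dJ_Jinv 0 l (smooth_cst _ 1) one_h r0).
  by case: l l0 => [//|l] _; rewrite /falling_neg big_ord_recl /= oppr0 !mul0r mulr0.
have E1 : eq_pos s (fun x => JC s x * Jinv N.+1 x) (Jinv N).
  by move=> x x0; rewrite !JinvE // exprS mulVKf // JC_neq0.
have H k rho : E_pos s rho -> (cT N k)%:R * Jinv (N + k) rho - JC s rho * T_coef s t k (Jinv N.+1) rho =
    if k is M.+1 then JC s rho * dJ s (T_coef s t M (Jinv N.+1)) rho else 0.
  move=> r0; have := ht.2 _ (Jinv_smooth N.+1) (@Jinv_U1 N.+1) k rho r0.
  rewrite !T_series_const (T_coef_eq k E1 r0) IHN // => ->.
  case: k => [//|k]; congr (_ * _); apply: dJ_eq => // x _; exact: T_series_const.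
have solve k rho y : E_pos s rho ->
    (cT N k)%:R * Jinv (N + k) rho - JC s rho * T_coef s t k (Jinv N.+1) rho = y ->
    T_coef s t k (Jinv N.+1) rho = (JC s rho)^-1 * ((cT N k)%:R * Jinv (N + k) rho - y).
  by move=> r0 <-; rewrite opprB addrC subrK mulKf // JC_neq0.
elim=> [|k IHk] rho r0.
  by rewrite (solve _ _ _ r0 (H 0%N rho r0)) subr0 !cT0 !mul1r !JinvE // !addn0 -exprS.
rewrite (solve _ _ _ r0 (H k.+1 rho r0)) (dJ_eq IHk r0).
have Jd := homog_scale (cT N.+1 k)%:R (Jinv_smooth (N.+1 + k)) (Jinv_homog (N.+1 + k)).
rewrite (dJ_homog Jd r0) cTSS [(cT N k.+1 + _)%:R]natrD [(_ * cT N.+1 k)%:R]natrM -(JC_inv r0) !JinvE // !addnS !addSn !exprS.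
have := JC_neq0 r0; rewrite -[(N + k).+1%:R]natr1; move: (JC s rho) ((JC s rho)^-1 ^+ (N + k)) (N + k)%:R => x y z x0.
by field.
Qed.

(** The order M of T(F) is [F M] plus terms in lower orders of [F], so equality on [E_pos]
    propagates from order to order. *)
Lemma T_inv_unique (F G : nat -> E R n -> R[i]) :
  (forall M, eq_pos s (T_series s t F M) (G M)) ->
  forall M, eq_pos s (T_inv s t G M) (F M).
Proof.
move=> H M; elim/ltn_ind: M => M IH rho r0.
have := H M rho r0; rewrite -{1}(T_invK s t G) /T_series !big_ord_recl (_ : (M - @ord0 M)%N = M) ?subn0 //.
set S1 := \sum_(i < M) _; set S2 := \sum_(i < M) _.
suff -> : S1 = S2 by move/addIr.
apply: eq_bigr => k _; apply: (T_coef_eq _ _ r0) => x x0; rewrite IH //.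
by rewrite lift0 ltn_subrL /= (leq_ltn_trans _ (ltn_ord k)).
Qed.

(** * The Wick product transported by T *)

Section StarFormula.
Variables (F G : E R n -> R[i]).
Hypotheses (Fs : smooth_pos s F) (Gs : smooth_pos s G).
Hypotheses (FI : euler_invariant s F) (GI : euler_invariant s G).

Lemma euler_homog f : euler_invariant s f -> homog s 0 f.
Proof. by move=> fI rho r0; rewrite X1_vfE der_addv !fI // addr0 mul0r. Qed.

Lemma T_series_invariant f a : smooth_pos s f -> euler_invariant s f ->
  eq_pos s (T_series s t (const_series f) a) (const_series f a).
Proof.
move=> fs fI rho r0; rewrite T_series_const.
have E0 : eq_pos s f (fun x => Jinv 0 x * f x) by move=> x _; rewrite /Jinv expr0 mul1r.
rewrite (T_coef_eq a E0 r0) (T_coef_Jinv _ _ fs (euler_homog fI) r0) T_coef_Jinv_pow //.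
by case: a => [|a]; rewrite /= ?mul1r ?mul0r.
Qed.

Lemma const_series_smooth f a : smooth_pos s f -> smooth_pos s (const_series f a).
Proof. by case: a => [//|a] _; exact: smooth_on0. Qed.

Lemma pairing_sum0l r u w g rho : E_pos s rho -> pairing_sum s r u w (fun=> 0) g rho = 0.
Proof. by move=> r0; rewrite /pairing_sum big1 // => k _; rewrite (ders_cst0 _ r0) mulr0 mul0r. Qed.

Lemma pairing_sum0r r u w f rho : E_pos s rho -> pairing_sum s r u w f (fun=> 0) rho = 0.
Proof. by move=> r0; rewrite /pairing_sum big1 // => k _; rewrite (ders_cst0 _ r0) mulr0. Qed.

Lemma pairing_series r a b rho : E_pos s rho ->
  pairing (Htensor R n s) (Dsym_iter r (T_series s t (const_series F) a) rho)
                          (Dsym_iter r (T_series s t (const_series G) b) rho) =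
  ((a == 0) && (b == 0))%:R * wick_pairing s F G r rho.
Proof.
move=> r0; have EF := T_series_invariant a Fs FI; have EG := T_series_invariant b Gs GI.
have Fas := eqon_smooth pos_open (fun x x0 => esym (EF x x0)) (const_series_smooth a Fs).
have Gbs := eqon_smooth pos_open (fun x x0 => esym (EG x x0)) (const_series_smooth b Gs).
rewrite (pairing_HE _ Fas Gbs r0).
have -> : pairing_sum s r (dzc R false) (dzc R true) (T_series s t (const_series F) a)
    (T_series s t (const_series G) b) rho =
    pairing_sum s r (dzc R false) (dzc R true) (const_series F a) (const_series G b) rho.
  by apply: eq_bigr => k _; rewrite (ders_eq _ EF r0) (ders_eq _ EG r0).
case: a {EF Fas} => [|a] /=; last by rewrite mul0r pairing_sum0l.
by case: b {EG Gbs} => [|b] /=; [rewrite mul1r|rewrite mul0r pairing_sum0r].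
Qed.

(** Both factors are fixed by [T] and live in order 0 of lambda, so only [r = N] contributes to
    order N. *)
Lemma wick_const N rho : E_pos s rho ->
  wick s (T_series s t (const_series F)) (T_series s t (const_series G)) N rho =
  (N`!%:R)^-1 * wick_pairing s F G N rho.
Proof.
move=> r0; rewrite /wick big_ord_recr /= subnn big_ord1 (pairing_series _ _ _ r0) mul1r.
rewrite big1 ?add0r // => r _; rewrite big1 // => a _.
rewrite (pairing_series _ _ _ r0); have rN := ltn_ord r.
case: (nat_of_ord a) => [|a'] /=; last by rewrite mul0r mulr0.
by rewrite subn0 subn_eq0 leqNgt rN mul0r mulr0.
Qed.

(** The claimed coefficient of (lambda/J)^N, continued from Z to a function of degree 0 on
    C^(1+n)_+. *)
Definition star_coef N rho : R[i] :=
  \sum_(m < N.+1) inv_falling R m N * (m`!%:R)^-1 * red0 s F G m rho.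

Lemma star_coef_smooth N : smooth_pos s (star_coef N).
Proof.
by apply: (smooth_sum pos_open) => m _; apply: (smooth_scale pos_open); exact: red0_smooth.
Qed.

Lemma star_coef_homog N : homog s 0 (star_coef N).
Proof.
apply: homog_sum => m; last exact: (homog_scale _ (red0_smooth Fs Gs m) (red0_homog Fs Gs FI GI m)).
by apply: (smooth_scale pos_open); exact: red0_smooth.
Qed.

(** [inv_falling R m N] vanishes for m > N; a range of m independent of N is what permits exchanging
    the sums over m and over orders. *)
Lemma star_coef_widen N M rho : (N <= M)%N ->
  star_coef N rho = \sum_(m < M.+1) inv_falling R m N * (m`!%:R)^-1 * red0 s F G m rho.
Proof.
move=> NM; rewrite /star_coef.
rewrite (big_ord_widen M.+1 (fun m => inv_falling R m N * (m`!%:R)^-1 * red0 s F G m rho)) ?ltnS //.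
rewrite big_mkcond; apply: eq_bigr => m _; rewrite ltnS leqNgt; case: ltnP => //= Nm.
by rewrite inv_falling_lt // !mul0r.
Qed.

(** It suffices that [T] maps the claimed series to the Wick product. Applying [T] to the powers of
    J and collecting the coefficient of [red0 m] gives [T_inv_falling M m], which equals the
    [wick_coef] on the Wick side. *)
Lemma star_formula N : eq_pos s (wick_tilde s t (const_series F) (const_series G) N)
  (fun rho => Jinv N rho * star_coef N rho).
Proof.
apply: (T_inv_unique (F := fun k x => Jinv k x * star_coef k x)) => M rho r0.
rewrite wick_const // (wick_of_red0 Fs Gs FI GI M r0) -JinvE //.
have -> : T_series s t (fun k x => Jinv k x * star_coef k x) M rho =
    \sum_(k < M.+1) (cT (M - k) k)%:R * Jinv M rho * star_coef (M - k) rho.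
  rewrite /T_series; apply: eq_bigr => k _.
  rewrite (T_coef_Jinv k (M - k) (star_coef_smooth (M - k)) (star_coef_homog (M - k)) r0).
  by rewrite (T_coef_Jinv_pow (M - k) k r0) subnK // -ltnS.
under eq_bigr => k _ do rewrite (star_coef_widen rho (leq_subr k M)) mulr_sumr.
rewrite exchange_big mulr_sumr; apply: eq_bigr => m _.
rewrite -T_inv_fallingE /T_inv_falling !mulr_suml mulr_sumr; apply: eq_bigr => k _.
by rewrite !mulrA [(cT _ _)%:R * _]mulrC.
Qed.

End StarFormula.

End OperatorT.

(** * Polynomials *)

Section Killed.
Variables (R : realType) (n s : nat).
Implicit Types (f g : E R n -> R[i]) (rho : E R n) (ws : seq (TE R n)).
Local Notation pos_open := (@E_pos_open R n s).

(** [f] behaves like a polynomial of degree less than [r] in the real coordinates; [r = 0] forces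
    [f] to vanish. *)
Definition killed r f := smooth_pos s f /\
  forall ws rho, (r <= size ws)%N -> E_pos s rho -> ders ws f rho = 0.

Lemma killed_eq r f g : eq_pos s f g -> killed r f -> killed r g.
Proof.
move=> fg [fs f0]; split; first exact: (eqon_smooth pos_open fg).
by move=> ws rho rw r0; rewrite -(ders_eq ws fg r0) f0.
Qed.

Lemma killed_le r r' f : (r <= r')%N -> killed r f -> killed r' f.
Proof. by move=> rr [fs f0]; split=> // ws rho rw r0; rewrite f0 // (leq_trans rr). Qed.

Lemma killed_der r w f : killed r.+1 f -> killed r (der w f).
Proof.
move=> [fs f0]; split; first exact: smooth_der.
by move=> ws rho rw r0; rewrite -ders_rcons f0 // size_rcons.
Qed.

Lemma killed0 f rho : killed 0 f -> E_pos s rho -> f rho = 0.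
Proof. by move=> [_ f0] r0; exact: (f0 [::]). Qed.

(** If one bound is 0 the product vanishes; otherwise Leibniz applied to the innermost derivative
    lowers one of the two bounds by one. *)
Lemma killed_mul r1 r2 f g : killed r1 f -> killed r2 g ->
  killed (r1 + r2) (fun x => f x * g x).
Proof.
move=> fk gk; split; first exact: (smooth_mul pos_open fk.1 gk.1).
move=> ws; elim/last_ind: ws r1 r2 f g fk gk => [|ws w IH] r1 r2 f g fk gk rho rw r0.
  move: rw fk; rewrite leqn0 addn_eq0 => /andP[/eqP -> _] fk.
  by rewrite /= (killed0 fk r0) mul0r.
case: r1 fk rw => [|r1] fk rw.
  have E0 : eq_pos s (fun x => f x * g x) (fun=> 0).
    by move=> x x0; rewrite (killed0 fk x0) mul0r.
  by rewrite (ders_eq _ E0 r0) (ders_cst0 _ r0).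
case: r2 gk rw => [|r2] gk rw.
  have E0 : eq_pos s (fun x => f x * g x) (fun=> 0).
    by move=> x x0; rewrite (killed0 gk x0) mulr0.
  by rewrite (ders_eq _ E0 r0) (ders_cst0 _ r0).
rewrite ders_rcons.
have E0 : eq_pos s (der w (fun x => f x * g x)) (fun x => f x * der w g x + der w f x * g x).
  by move=> x x0; exact: (der_mul w fk.1 gk.1 x0).
have [dfk dgk] := (killed_der w fk, killed_der w gk).
rewrite (ders_eq ws E0 r0).
rewrite (ders_add ws (smooth_mul pos_open fk.1 dgk.1) (smooth_mul pos_open dfk.1 gk.1) r0).
move: rw; rewrite size_rcons => rw.
rewrite (IH r1.+1 r2 _ _ fk dgk rho _ r0); last by rewrite -ltnS -addnS.
by rewrite (IH r1 r2.+1 _ _ dfk gk rho _ r0) ?addr0 // -ltnS -addSn.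
Qed.

Lemma killed_cst (c : R[i]) : killed 1 (fun _ : E R n => c).
Proof.
split; first exact: smooth_cst.
move=> ws rho; case/lastP: ws => // ws w _ r0.
rewrite ders_rcons -[RHS](ders_cst0 ws r0); apply: (ders_eq ws _ r0) => x _.
exact: der_cst.
Qed.

Lemma killed_zc b k : killed 2 (zc b k).
Proof.
split; first exact: zc_smooth.
move=> ws rho; case/lastP: ws => // ws w; rewrite size_rcons ltnS => wsz r0.
have E0 : eq_pos s (der w (zc b k)) (fun=> sgi R b * w 1 k + w 0 k).
  by move=> x x0; rewrite (der_zc w b k x0).
by rewrite ders_rcons (ders_eq ws E0 r0); exact: (killed_cst _).2.
Qed.

(** The added 1 accounts for the constant function at exponent 0. *)
Lemma killed_exp r k f : killed r f -> killed (k * r + 1) (fun x => f x ^+ k).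
Proof.
move=> fk; elim: k => [|k IH]; first exact: killed_cst.
have := killed_mul fk IH; rewrite addnA -mulSn; apply: killed_eq => x _.
by rewrite exprS.
Qed.

Lemma killed_prod (I : Type) (l : seq I) (d : I -> nat) (f : I -> E R n -> R[i]) :
  (forall i, killed (d i) (f i)) ->
  killed (\sum_(i <- l) d i + 1) (fun x => \prod_(i <- l) f i x).
Proof.
move=> fk; elim: l => [|i l IH].
  rewrite big_nil; apply: killed_eq (killed_cst 1) => x _; by rewrite big_nil.
rewrite big_cons -addnA; apply: killed_eq (killed_mul (fk i) IH) => x _.
by rewrite big_cons.
Qed.

Lemma killed_add r f g : killed r f -> killed r g -> killed r (fun x => f x + g x).
Proof.
move=> [fs f0] [gs g0]; split; first exact: (smooth_add pos_open fs gs).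
by move=> ws rho rw r0; rewrite (ders_add ws fs gs r0) f0 // g0 // addr0.
Qed.

Lemma killed_sum (I : Type) (l : seq I) (d : I -> nat) (f : I -> E R n -> R[i]) :
  (forall i, killed (d i) (f i)) ->
  killed (\sum_(i <- l) d i) (fun x => \sum_(i <- l) f i x).
Proof.
move=> fk; elim: l => [|i l IH].
  rewrite big_nil; split; first exact: (eqon_smooth pos_open (fun x _ => esym (big_nil _ _ _ _)) (smooth_cst _ 0)).
  move=> ws rho _ r0; rewrite -[RHS](ders_cst0 ws r0); apply: (ders_eq ws _ r0) => x _.
  by rewrite big_nil.
rewrite big_cons; apply: (killed_eq (f := fun x => f i x + \sum_(j <- l) f j x)).
  by move=> x _; rewrite big_cons.
by apply: killed_add; [apply: killed_le (fk i); exact: leq_addr|apply: killed_le IH; exact: leq_addl].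
Qed.

End Killed.

(** * Polynomials at the rescaled point *)

Section Polynomials.
Variables (R : realType) (n s : nat) (b : bool) (rho : E R n).
Hypothesis r0 : E_pos s rho.
Implicit Types (f g : E R n -> R[i]).
Local Notation pos_open := (@E_pos_open R n s).

(** Smoothness is bundled in because the ideal property [hnull_mul] is available for smooth
    functions. *)
Definition shcong f g := [/\ smooth_pos s f, smooth_pos s g & hcong s b rho f g].

Lemma shcong_refl f : smooth_pos s f -> shcong f f.
Proof.
move=> fs; split=> //; have E0 : eq_pos s (fun=> 0) (fun x => f x - f x).
  by move=> x _; rewrite subrr.
exact: (hnull_eq r0 E0 (hnull0 r0)).
Qed.

Lemma smooth_sub f g : smooth_pos s f -> smooth_pos s g -> smooth_pos s (fun x => f x - g x).
Proof.
move=> fs gs; apply: (eqon_smooth pos_open _ (smooth_add pos_open fs (smooth_scale pos_open (-1) gs))).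
by move=> x _; rewrite mulN1r.
Qed.

Lemma shcong_add f f' g g' : shcong f f' -> shcong g g' ->
  shcong (fun x => f x + g x) (fun x => f' x + g' x).
Proof.
move=> [fs fs' ff] [gs gs' gg]; split; [exact: (smooth_add pos_open fs gs)|exact: (smooth_add pos_open fs' gs')|].
have E0 : eq_pos s (fun x => (f x - f' x) + (g x - g' x)) (fun x => f x + g x - (f' x + g' x)).
  by move=> x _; ring.
exact: (hnull_eq r0 E0 (hnull_add r0 (smooth_sub fs fs') (smooth_sub gs gs') ff gg)).
Qed.

Lemma shcong_mul f f' g g' : shcong f f' -> shcong g g' ->
  shcong (fun x => f x * g x) (fun x => f' x * g' x).
Proof.
move=> [fs fs' ff] [gs gs' gg]; split; [exact: (smooth_mul pos_open fs gs)|exact: (smooth_mul pos_open fs' gs')|].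
have [df dg] := (smooth_sub fs fs', smooth_sub gs gs').
have E0 : eq_pos s (fun x => (f x - f' x) * g x + (g x - g' x) * f' x) (fun x => f x * g x - f' x * g' x).
  by move=> x _; ring.
apply: (hnull_eq r0 E0 (hnull_add r0 (smooth_mul pos_open df gs) (smooth_mul pos_open dg fs') _ _)).
  exact: (hnull_mul r0 df gs ff).
exact: (hnull_mul r0 dg fs' gg).
Qed.

Lemma shcong_exp k f g : shcong f g -> shcong (fun x => f x ^+ k) (fun x => g x ^+ k).
Proof.
move=> fg; elim: k => [|k IH]; first exact: (shcong_refl (smooth_cst _ 1)).
have := shcong_mul fg IH.
have -> : (fun x => f x * f x ^+ k) = (fun x => f x ^+ k.+1) by apply/funext => x; rewrite exprS.
by have -> : (fun x => g x * g x ^+ k) = (fun x => g x ^+ k.+1) by apply/funext => x; rewrite exprS.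
Qed.

Lemma shcong_sum (I : Type) (l : seq I) (f g : I -> E R n -> R[i]) :
  (forall i, shcong (f i) (g i)) ->
  shcong (fun x => \sum_(i <- l) f i x) (fun x => \sum_(i <- l) g i x).
Proof.
move=> fg; elim: l => [|i l IH].
  have e (h : I -> E R n -> R[i]) : (fun x => \sum_(i <- [::]) h i x) = fun=> 0.
    by apply/funext => x; rewrite big_nil.
  by rewrite !e; exact: (shcong_refl (smooth_cst _ 0)).
have e (h : I -> E R n -> R[i]) : (fun x => \sum_(i <- i :: l) h i x) =
    fun x => h i x + \sum_(i <- l) h i x by apply/funext => x; rewrite big_cons.
by rewrite !e; exact: (shcong_add (fg i) IH).
Qed.

Lemma shcong_prod (I : Type) (l : seq I) (f g : I -> E R n -> R[i]) :
  (forall i, shcong (f i) (g i)) ->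
  shcong (fun x => \prod_(i <- l) f i x) (fun x => \prod_(i <- l) g i x).
Proof.
move=> fg; elim: l => [|i l IH].
  have e (h : I -> E R n -> R[i]) : (fun x => \prod_(i <- [::]) h i x) = fun=> 1.
    by apply/funext => x; rewrite big_nil.
  by rewrite !e; exact: (shcong_refl (smooth_cst _ 1)).
have e (h : I -> E R n -> R[i]) : (fun x => \prod_(i <- i :: l) h i x) =
    fun x => h i x * \prod_(i <- l) h i x by apply/funext => x; rewrite big_cons.
by rewrite !e; exact: (shcong_mul (fg i) IH).
Qed.

Lemma shcong_rJ : shcong (rJ s) (fun=> rJ s rho).
Proof. by split; [exact: rJ_smooth|exact: smooth_cst|exact: hnull_rJ]. Qed.

Local Notation monomial := (R[i] * {ffun 'I_n.+1 -> nat} * {ffun 'I_n.+1 -> nat})%type.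

(* the polynomial with monomials [ms] on the rescaled point [c x] *)
Definition scaled_poly (ms : seq monomial) (c : E R n -> R[i]) (x : E R n) : R[i] :=
  \sum_(m <- ms) m.1.1 * \prod_(k < n.+1) ((c x * zc true k x) ^+ m.1.2 k *
                                          (c x * zc false k x) ^+ m.2 k).

(** The bounds of the [killed] lemmas added up; 3 = 1 + 2 belongs to a constant times a coordinate.
    What matters is independence of the point and of the scaling constant. *)
Definition poly_order (ms : seq monomial) : nat :=
  \sum_(m <- ms) (1 + (\sum_(k < n.+1) ((m.1.2 k * 3 + 1) + (m.2 k * 3 + 1)) + 1)).

(** The congruence respects sums and products, so replacing [rJ] by its value at [rho] passes
    through the whole polynomial. *)
Lemma shcong_scaled_poly ms : shcong (scaled_poly ms (rJ s)) (scaled_poly ms (fun=> rJ s rho)).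
Proof.
apply: shcong_sum => m; apply: shcong_mul; first exact: (shcong_refl (smooth_cst _ _)).
apply: shcong_prod => k.
have c b' j : shcong (fun x => (rJ s x * zc b' k x) ^+ j) (fun x => (rJ s rho * zc b' k x) ^+ j).
  by apply: shcong_exp; apply: (shcong_mul shcong_rJ); exact: (shcong_refl (zc_smooth _ _)).
exact: shcong_mul.
Qed.

Lemma killed_scaled_poly ms (c : R[i]) : killed s (poly_order ms) (scaled_poly ms (fun=> c)).
Proof.
apply: killed_sum => m; apply: killed_mul; first exact: killed_cst.
apply: killed_prod => k.
have kz b' := killed_mul (@killed_cst R n s c) (@killed_zc R n s b' k).
exact: (killed_mul (killed_exp (m.1.2 k) (kz true)) (killed_exp (m.2 k) (kz false))).
Qed.

Lemma horizontal_ders_poly ms f ws : eq_pos s f (scaled_poly ms (rJ s)) ->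
  (poly_order ms <= size ws)%N -> (forall w, w \in ws -> horizontal s b rho w) ->
  ders ws f rho = 0.
Proof.
move=> fE msz hws; have [ps qs pq] := shcong_scaled_poly ms.
rewrite (ders_eq ws fE r0) (hcong_ders r0 ps qs pq hws).
exact: (killed_scaled_poly ms (rJ s rho)).2.
Qed.

End Polynomials.

(** * Reduced polynomials and the final comparison *)

Section ReducedPolynomials.
Variables (R : realType) (n s : nat).

Lemma Pr_normalize (rho : Cplus R n s) :
  exists2 rho1 : Cplus R n s, J s (val rho1) = 1 /\ Pr rho1 = Pr rho &
    val rho1 = (Num.sqrt (J s (val rho)))^-1 *: val rho.
Proof.
have J1 := eqP (J_normalize rho).
have J0 : 0 < J s ((Num.sqrt (J s (val rho)))^-1 *: val rho) by rewrite J1.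
pose rho1 : Cplus R n s := exist (fun x : E R n => 0 < J s x) _ J0.
exists rho1 => //; split; first exact: J1.
apply: (@Pr_cscale _ _ _ (Num.sqrt (J s (val rho)))^-1 0).
apply: zcoord_inj => k; rewrite zcoord_cscale zcoord_scale; congr (_ * _).
Qed.

Lemma pullback_poly (g : Mred R n s -> R[i]) : in_Pred g ->
  exists ms, eq_pos s (pullback g) (scaled_poly ms (rJ s)).
Proof.
move=> [p [[ms pE] _ gE]]; exists ms => x x0.
(* [is_reduction] gives values on Z only, so the point is first replaced by its normalized
   multiple. *)
have [rho1 [J1 Pr1] rho1E] := Pr_normalize (exist _ x x0).
rewrite (pullback_pos g x0) -Pr1 (gE _ J1) pE; apply: eq_bigr => m _; congr (_ * _).
apply: eq_bigr => k _; rewrite rho1E zcoord_scale !zc_def rmorphM.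
congr (_ * (_ * _) ^+ _).
by rewrite /rJ; apply/eqP; rewrite eq_complex /= oppr0 !eqxx.
Qed.

End ReducedPolynomials.

Theorem theorem5p12 (R : realType) (n s : nat)
    (hn : (1 <= n)%N) (hs : (1 <= s <= n.+1)%N)
    (D : forall k, symtensor R n s k -> symtensor R n s k.+1)
    (hD : is_Dsym_red D)
    (t : nat -> nat -> R -> R[i]) (ht : is_T n s t)
    (star : (nat -> Cinf_red R n s) -> (nat -> Cinf_red R n s) ->
            nat -> Cinf_red R n s)
    (hstar : is_reduced_wick t star)
    (f g : Cinf_red R n s) :
  (forall rho : Cplus R n s, J s (val rho) = 1 -> forall N : nat,
     star (const_series_red f) (const_series_red g) N (Pr rho) =
     fps_sum (fun r => star_red_term D f g r rho) N) /\
  (in_Pred g ->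
   exists r0 : nat, forall r : nat, (r0 <= r)%N ->
     forall rho : Cplus R n s, J s (val rho) = 1 -> forall N : nat,
       star_red_term D f g r rho N = 0).
Proof.
have [fs gs] := (Cinf_smooth f, Cinf_smooth g).
have [fI gI] := (pullback_euler f, pullback_euler g).
split=> [rho J1 N|/pullback_poly[ms gE]].
  have [_ _ H] := hstar.
  (* The pullbacks are taken as the invariant functions whose reductions are [f] and [g]. *)
  rewrite (H _ _ f g fs (pullback_invariant f) gs (pullback_invariant g)
    (fun x _ => esym (pullbackE f x)) (fun x _ => esym (pullbackE g x)) N rho J1).
  have r0 : E_pos s (val rho) := valP rho.
  have JC1 : JC s (val rho) = 1 by rewrite /JC J1.
  (* On Z the powers of J relating [red0] to the pairing and [star_coef] to the product are all
     1. *)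
  rewrite (star_formula ht fs gs fI gI N r0) JinvE // JC1 invr1 expr1n mul1r.
  apply: eq_bigr => m _; rewrite (red0E fs gs fI gI m r0) JC1 expr1n mul1r.
  by rewrite /star_red_term (pairing_HredE hD) [inv_falling R m N * _]mulrC.
exists (poly_order ms) => r rr rho J1 N; rewrite /star_red_term (pairing_HredE hD).
have r0 : E_pos s (val rho) := valP rho.
rewrite /pairing_sum big1 ?mulr0 // => kappa _.
(* The second factor of H is holomorphic, so [g] receives projected holomorphic vectors; their
   number alone makes its factor vanish, uniformly in [rho]. *)
rewrite (horizontal_ders_poly (b := true) r0 gE) ?mulr0 //.
  by rewrite size_map size_enum_ord.
move=> w /mapP[i _ ->]; exact: (Theta_horizontal (dzc_vtype _ _ _) r0).
Qed.
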